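(* Let $R$ be a commutative Noetherian ring with unity in which $2$ is invertible. Let $(Q,q)$ be a quadratic $R$-space of rank $n\ge 1$, let $P$ be a finitely generated projective $R$-module of rank $m\ge 2$, and let $M=Q\perp\mathbb{H}(P)$. Let $h$ denote the hyperbolic form on $\mathbb{H}(P)$. Suppose that for every maximal ideal $\mathfrak{m}$ of $R$ one has $q_{\mathfrak{m}}\perp h_{\mathfrak{m}}=\tilde{\phi}_{n+2m}$ (i.e. with respect to a suitable basis of the free module $M_{\mathfrak m}$, the matrix of the bilinear form associated to $q_{\mathfrak m}\perp h_{\mathfrak m}$ is $\tilde\phi_{n+2m}$). Then the group $$\frac{\mathrm{SO}_{(R[X],(X))}(M[X],XM[X])}{\mathrm{EO}_{(R[X],(X))}(Q[X],\mathbb{H}(P[X]))}$$ is nilpotent of nilpotency class at most $2$.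
   Context: Let $A$ be a commutative ring in which $2$ is invertible. A quadratic form $q$ on an $A$-module $M$ satisfies $q(rx)=r^2q(x)$ and $\langle x,y\rangle_q:=q(x+y)-q(x)-q(y)$ is bilinear. A quadratic $A$-space is a finitely generated projective $A$-module $Q$ with a non-degenerate quadratic form $q$, meaning that $d_{\langle\,,\rangle_q}:Q\to Q^*=\mathrm{Hom}_A(Q,A)$, $z\mapsto\langle z,-\rangle_q$, is an isomorphism. For a finitely generated projective $A$-module $P$, $\mathbb{H}(P)=P\oplus P^*$ with the hyperbolic quadratic form $(x,f)\mapsto f(x)$; $\perp$ denotes orthogonal sum. $\mathrm{O}_A(M)$ is the group of $A$-linear automorphisms of a quadratic space $M$ preserving the bilinear form. For an ideal $J$ of $A$, $\mathrm{O}_{(A,J)}(M,JM)$ is the kernel of the natural map $\mathrm{O}_A(M)\to\mathrm{O}_{A/J}(M/JM)$, and $\mathrm{SO}_{(A,J)}(M,JM)$ is the kernel of $\det:\mathrm{O}_{(A,J)}(M,JM)\to A^*$. DSER elementary orthogonal group: let $M=Q\perp\mathbb{H}(P)$. For $A$-linear $\alpha:Q\to P$ let $\alpha^*:P^*\to Q$ be determined by $\langle\alpha^*(f),z\rangle_q=f(\alpha(z))$, and put $$E_\alpha(z,x,f)=\bigl(z-\alpha^*(f),\;x+\alpha(z)-\tfrac12\alpha\alpha^*(f),\;f\bigr).$$ For $A$-linear $\beta:Q\to P^*$ let $\beta^*:P\to Q$ be determined by $\langle\beta^*(x),z\rangle_q=\beta(z)(x)$, and put $$E^*_\beta(z,x,f)=\bigl(z-\beta^*(x),\;x,\;\beta(z)-\tfrac12\beta\beta^*(x)+f\bigr).$$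 $\mathrm{EO}_A(Q,\mathbb{H}(P))$ is the subgroup of $\mathrm{O}_A(M)$ generated by all $E_\alpha,E^*_\beta$. For an ideal $J$ of $A$, $\mathrm{EO}_J(Q,\mathbb{H}(P))$ is generated by those with $\alpha:Q\to JP$, $\beta:Q\to JP^*$, and $\mathrm{EO}_{(A,J)}(Q,\mathbb{H}(P))$ is the normal closure of $\mathrm{EO}_J(Q,\mathbb{H}(P))$ in $\mathrm{EO}_A(Q,\mathbb{H}(P))$. For an $R$-module $N$, $N[X]=N\otimes_R R[X]$ (with the extended form if $N$ is quadratic); the subscript $\mathfrak m$ denotes localization at $\mathfrak m$. With $e_{i,j}$ the matrix units, $\tilde\phi_{2r}=\sum_{i=1}^r(e_{2i-1,2i}+e_{2i,2i-1})$ and $\tilde\phi_{2r+1}=(2)\perp\tilde\phi_{2r}$ (block diagonal sum). Put $G^{(0)}=G$, $G^{(k+1)}=[G,G^{(k)}]$; $G$ is nilpotent of class at most $2$ if $G^{(2)}=\{e\}$. *)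

(* Defs.v *)
From HB Require Import structures.
From mathcomp Require Import all_boot all_order all_algebra.
From mathcomp Require Import boolp classical_sets ring.

Set Implicit Arguments.
Unset Strict Implicit.
Unset Printing Implicit Defensive.

Import GRing.Theory.
Local Open Scope classical_set_scope.
Local Open Scope quotient_scope.
Local Open Scope ring_scope.

Section Groups.
Local Open Scope group_scope.

Definition is_subgroup (G : groupType) (H : set G) : Prop :=
  group_closed [in H].

Definition gen_subgroup (G : groupType) (S : set G) : set G :=
  smallest (@is_subgroup G) S.

(* x ^ y is y^-1 x y, so h ^ g^-1 is g h g^-1. *)
Definition normal_closure (G : groupType) (H S : set G) : set G :=
  gen_subgroup [set x | exists g h, [/\ H g, S h & x = h ^ g^-1]].

Record normal_in (G : groupType) (N H : set G) : Prop := NormalIn {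
  normal_group : is_subgroup H;
  normal_subgroup : is_subgroup N;
  normal_sub : N `<=` H;
  normal_conj : forall h n, H h -> N n -> N (n ^ h)
}.

Section Quotient.
Variables (G : groupType) (N H : set G) (NH : normal_in N H).

Definition left_coset (h : G) : set G := [set h * n | n in N].

Record quotient := Quotient {
  coset_set :> set G;
  coset_setP : exists2 h, H h & coset_set = left_coset h
}.

HB.instance Definition _ := gen_eqMixin quotient.
HB.instance Definition _ := gen_choiceMixin quotient.

Lemma quotient_eq (C D : quotient) : coset_set C = coset_set D -> C = D.
Proof.
case: C D => [C hC] [D hD] /= e; move: hC hD; rewrite e => hC hD.
by congr Quotient.
Qed.

Lemma sg1 (K : set G) : is_subgroup K -> K 1.
Proof. by case=> /set_mem. Qed.

Lemma sgM (K : set G) : is_subgroup K -> forall x y, K x -> K y -> K (x * y).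
Proof.
by move=> /group_closedM KM x y Kx Ky; apply/set_mem/KM; apply/mem_set.
Qed.

Lemma sgV (K : set G) : is_subgroup K -> forall x, K x -> K x^-1.
Proof. by move=> /group_closedV KV x Kx; apply/set_mem/KV/mem_set. Qed.

Let HG := normal_group NH.
Let NG := normal_subgroup NH.

Definition qmul_set (C D : set G) : set G := [set c * d | c in C & d in D].
Definition qinv_set (C : set G) : set G := [set c^-1 | c in C].

Lemma qmul_cosets h k : H k ->
  qmul_set (left_coset h) (left_coset k) = left_coset (h * k).
Proof.
move=> Hk; apply/seteqP; split=> x /=.
  move=> [_ [n Nn <-]] [_ [n' Nn' <-]] <-.
  exists (n ^ k * n'); first by apply: sgM => //; apply: (normal_conj NH).
  by rewrite conjgE !mulgA mulgK.
move=> [n Nn <-]; exists h; first by exists 1; [apply: sg1 | rewrite mulg1].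
by exists (k * n); [exists n | rewrite mulgA].
Qed.

Lemma qinv_coset h : H h -> qinv_set (left_coset h) = left_coset h^-1.
Proof.
move=> Hh; apply/seteqP; split=> x /=.
  move=> [_ [n Nn <-]] <-; exists (n^-1 ^ h^-1).
    by apply: (normal_conj NH); apply: sgV.
  by rewrite conjgE invgK invgM !mulgA mulVg mul1g.
move=> [n Nn <-]; exists (h * (n^-1 ^ h)).
  by exists (n^-1 ^ h) => //; apply: (normal_conj NH) => //; apply: sgV.
by rewrite conjgE !invgM !invgK -!mulgA mulgV mulg1.
Qed.

Lemma qmul_subproof (C D : quotient) :
  exists2 h, H h & qmul_set C D = left_coset h.
Proof.
case: C D => [C [h Hh eC]] [D [k Hk eD]] /=; exists (h * k).
  exact: sgM.
by rewrite eC eD qmul_cosets.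
Qed.

Lemma qinv_subproof (C : quotient) : exists2 h, H h & qinv_set C = left_coset h.
Proof.
case: C => [C [h Hh eC]] /=; exists h^-1; first exact: sgV.
by rewrite eC qinv_coset.
Qed.

Lemma N_coset : N = left_coset 1.
Proof.
apply/seteqP; split=> x /=; first by move=> Nx; exists x; rewrite ?mul1g.
by case=> n Nn <-; rewrite mul1g.
Qed.

Lemma qone_subproof : exists2 h, H h & N = left_coset h.
Proof. by exists 1; [apply: sg1 | apply: N_coset]. Qed.

Definition qmul C D := Quotient (qmul_subproof C D).
Definition qinv C := Quotient (qinv_subproof C).
Definition qone := Quotient qone_subproof.

Lemma qmulA : associative qmul.
Proof.
case=> [C [h Hh eC]] [D [k Hk eD]] [E [l Hl eE]]; apply: quotient_eq => /=.
by rewrite eC eD eE !qmul_cosets ?mulgA //; apply: sgM.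
Qed.

Lemma qmul1g : left_id qone qmul.
Proof.
case=> [C [h Hh eC]]; apply: quotient_eq => /=.
by rewrite eC {1}N_coset qmul_cosets ?mul1g.
Qed.

Lemma qmulg1 : right_id qone qmul.
Proof.
case=> [C [h Hh eC]]; apply: quotient_eq => /=.
by rewrite eC {1}N_coset qmul_cosets ?mulg1 //; apply: sg1.
Qed.

Lemma qmulVg : left_inverse qone qinv qmul.
Proof.
case=> [C [h Hh eC]]; apply: quotient_eq => /=.
by rewrite eC qinv_coset // qmul_cosets // mulVg -N_coset.
Qed.

Lemma qmulgV : right_inverse qone qinv qmul.
Proof.
case=> [C [h Hh eC]]; apply: quotient_eq => /=.
by rewrite eC qinv_coset // qmul_cosets ?mulgV -?N_coset //; apply: sgV.
Qed.

(* The alias carries the proof of normality, on which the group laws depend. *)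
Definition quotient_group of normal_in N H := quotient.
HB.instance Definition _ := Choice.on (quotient_group NH).
HB.instance Definition _ :=
  isGroup.Build (quotient_group NH) qmulA qmul1g qmulg1 qmulVg qmulgV.

End Quotient.

Fixpoint lower_central (G : groupType) (k : nat) : set G :=
  if k is k'.+1 then
    gen_subgroup [set z | exists x y : G, lower_central k' y /\ z = [~ x, y]]
  else setT.
Arguments lower_central : clear implicits.

Definition nilpotent_of_class_le (G : groupType) (c : nat) : Prop :=
  lower_central G c = [set 1].

End Groups.

(* [idealr R] is the library's type of proper ideals; the unit ideal, which is
   generated by 1, is not an element of it. *)
Definition noetherian (R : comNzRingType) : Prop :=
  forall I : idealr R, exists k (a : 'I_k -> R), forall x,
    x \in I <-> exists c : 'I_k -> R, x = \sum_i c i * a i.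

Definition maximal_ideal (R : comNzRingType) (m : idealr R) : Prop :=
  forall J : idealr R, {subset m <= J} -> {subset J <= m}.

Definition principal_ideal (A : comNzRingType) (a : A) : {pred A} :=
  fun x => `[< exists c, x = c * a >].

Section MaximalPrime.
Variables (R : comNzRingType) (m : idealr R) (hm : maximal_ideal m).

Lemma maximal_is_prime : prime_idealr_closed (m : {pred R}).
Proof.
move=> u v uv; apply/orP; have [um|num] := boolP (u \in m); first by left.
right; pose J : {pred R} := fun x => `[< exists a b, a \in m /\ x = a + b * u >].
have J0 : forall x, x \in m -> x \in J.
  by move=> x xm; apply/asboolP; exists x, 0; rewrite mul0r addr0.
have uJ : u \in J.
  by apply/asboolP; exists 0, 1; rewrite rpred0 mul1r add0r.
have [/asboolP[a [b [am e]]]|nJ1] := boolP (1 \in J).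
  rewrite -(mul1r v) e mulrDl rpredD //; first by rewrite mulrC idealMr.
  by rewrite -mulrA idealMr.
have Jid : idealr_closed J.
  split=> //; first by apply: J0; rewrite rpred0.
  move=> c x y /asboolP[a [b [am ->]]] /asboolP[a' [b' [am' ->]]].
  apply/asboolP; exists (c * a + a'), (c * b + b'); split.
    by rewrite rpredD // idealMr.
  by rewrite mulrDr mulrDl addrACA mulrA.
pose J' : idealr R := HB.pack J (isIdealr.Build R J Jid).
by move: num; rewrite (hm (J := J') J0 uJ).
Qed.

Definition prime_of_maximal : prime_idealr R :=
  HB.pack (m : R -> bool) (Idealr.on m)
    (isPrimeIdealrClosed.Build R m maximal_is_prime).

End MaximalPrime.

Section Localization.
Variables (R : comNzRingType) (p : prime_idealr R).

Record fraction := Fraction { fnum : R; fden : R; fdenP : fden \notin p }.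

HB.instance Definition _ := gen_eqMixin fraction.
HB.instance Definition _ := gen_choiceMixin fraction.

Lemma one_notin : 1 \notin p. Proof. by rewrite idealr1. Qed.

Lemma mul_notin u v : u \notin p -> v \notin p -> u * v \notin p.
Proof. by move=> up vp; rewrite prime_idealrM negb_or up. Qed.

Definition fraction_equiv (x y : fraction) : bool :=
  `[< exists2 u, u \notin p & u * (fnum x * fden y - fnum y * fden x) = 0 >].

Lemma fraction_equiv_refl : reflexive fraction_equiv.
Proof.
by move=> x; apply/asboolP; exists 1; rewrite ?one_notin // subrr mulr0.
Qed.

Lemma fraction_equiv_sym : symmetric fraction_equiv.
Proof.
have sub x y : fraction_equiv x y -> fraction_equiv y x.
  move=> /asboolP[u up e]; apply/asboolP; exists u => //.
  by rewrite -opprB mulrN e oppr0.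
by move=> x y; apply/idP/idP; apply: sub.
Qed.

Lemma fraction_equiv_trans : transitive fraction_equiv.
Proof.
move=> [b t tp] [a s sp] [c v vp] /asboolP[/= u up e] /asboolP[/= w wp e'].
apply/asboolP; exists (u * w * t); first by rewrite !mul_notin.
have -> : u * w * t * (a * v - c * s) =
  w * v * (u * (a * t - b * s)) + u * s * (w * (b * v - c * t)) by ring.
by rewrite e e' !mulr0 addr0.
Qed.

Canonical fraction_equiv_rel := EquivRel fraction_equiv
  fraction_equiv_refl fraction_equiv_sym fraction_equiv_trans.

Definition localization := {eq_quot fraction_equiv}.
HB.instance Definition _ : EqQuotient _ fraction_equiv localization :=
  EqQuotient.on localization.
HB.instance Definition _ := Choice.on localization.

Lemma loc_eq x y :
  (exists2 u, u \notin p & u * (fnum x * fden y - fnum y * fden x) = 0) ->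
  \pi_localization x = \pi_localization y.
Proof. by move=> h; apply/eqmodP/asboolP. Qed.

Lemma loc_reprP x : exists2 u, u \notin p &
  u * (fnum x * fden (repr (\pi_localization x))
       - fnum (repr (\pi_localization x)) * fden x) = 0.
Proof. by apply/asboolP; rewrite -[`[< _ >]]/(fraction_equiv _ _) -eqmodE reprK. Qed.

Definition addf x y := Fraction (fnum x * fden y + fnum y * fden x)
  (mul_notin (fdenP x) (fdenP y)).
Definition oppf x := Fraction (- fnum x) (fdenP x).
Definition mulf x y :=
  Fraction (fnum x * fnum y) (mul_notin (fdenP x) (fdenP y)).
Definition inj_frac (a : R) := Fraction (a) one_notin.

Definition loc_add := lift_op2 localization addf.
Definition loc_opp := lift_op1 localization oppf.
Definition loc_mul := lift_op2 localization mulf.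
Definition to_loc (a : R) :=
  \pi_localization (inj_frac a) : localization.

Lemma loc_addE x y : loc_add (\pi_localization x) (\pi_localization y) = \pi_localization (addf x y).
Proof.
have [u up e] := loc_reprP x; have [v vp e'] := loc_reprP y.
unlock loc_add; apply: loc_eq => /=.
move: (repr (\pi_localization x)) e => [a s sp] /= e.
move: (repr (\pi_localization y)) e' => [b t tp] /= e'.
case: x y e e' => [c w wp] [d z zp] /= e e'.
exists (u * v); first exact: mul_notin.
have -> : u * v * ((a * t + b * s) * (w * z) - (c * z + d * w) * (s * t)) =
  - (v * t * z * (u * (c * s - a * w)) + u * s * w * (v * (d * t - b * z)))
  by ring.
by rewrite e e' !mulr0 addr0 oppr0.
Qed.

Lemma loc_oppE x : loc_opp (\pi_localization x) = \pi_localization (oppf x).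
Proof.
have [u up e] := loc_reprP x.
unlock loc_opp; apply: loc_eq => /=.
move: (repr _) e => [a s sp] /= e; exists u => //.
have -> : u * (- a * fden x - - fnum x * s) = u * (fnum x * s - a * fden x) by ring.
by [].
Qed.

Lemma loc_mulE x y : loc_mul (\pi_localization x) (\pi_localization y) = \pi_localization (mulf x y).
Proof.
have [u up e] := loc_reprP x; have [v vp e'] := loc_reprP y.
unlock loc_mul; apply: loc_eq => /=.
move: (repr (\pi_localization x)) e => [a s sp] /= e.
move: (repr (\pi_localization y)) e' => [b t tp] /= e'.
case: x y e e' => [c w wp] [d z zp] /= e e'.
exists (u * v); first exact: mul_notin.
have -> : u * v * (a * b * (w * z) - c * d * (s * t)) =
  - (v * d * t * (u * (c * s - a * w)) + u * a * w * (v * (d * t - b * z)))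
  by ring.
by rewrite e e' !mulr0 addr0 oppr0.
Qed.

Lemma loc_exact x y : fnum x * fden y = fnum y * fden x ->
  \pi_localization x = \pi_localization y.
Proof.
by move=> e; apply: loc_eq; exists 1; rewrite ?one_notin // e subrr mulr0.
Qed.

Lemma loc_addA : associative loc_add.
Proof.
elim/quotW=> x; elim/quotW=> y; elim/quotW=> z.
by rewrite !loc_addE; apply: loc_exact => /=; ring.
Qed.

Lemma loc_addC : commutative loc_add.
Proof.
elim/quotW=> x; elim/quotW=> y.
by rewrite !loc_addE; apply: loc_exact => /=; ring.
Qed.

Lemma loc_add0 : left_id (to_loc 0) loc_add.
Proof.
by elim/quotW=> x; rewrite {1}/to_loc loc_addE; apply: loc_exact => /=; ring.
Qed.

Lemma loc_addN : left_inverse (to_loc 0) loc_opp loc_add.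
Proof.
elim/quotW=> x.
by rewrite loc_oppE loc_addE; apply: loc_exact => /=; ring.
Qed.

HB.instance Definition _ :=
  GRing.isZmodule.Build localization loc_addA loc_addC loc_add0 loc_addN.

Lemma loc_mulA : associative loc_mul.
Proof.
elim/quotW=> x; elim/quotW=> y; elim/quotW=> z.
by rewrite !loc_mulE; apply: loc_exact => /=; ring.
Qed.

Lemma loc_mulC : commutative loc_mul.
Proof.
elim/quotW=> x; elim/quotW=> y.
by rewrite !loc_mulE; apply: loc_exact => /=; ring.
Qed.

Lemma loc_mul1 : left_id (to_loc 1) loc_mul.
Proof.
by elim/quotW=> x; rewrite {1}/to_loc loc_mulE; apply: loc_exact => /=; ring.
Qed.

Lemma loc_mulDl : left_distributive loc_mul loc_add.
Proof.
elim/quotW=> x; elim/quotW=> y; elim/quotW=> z.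
by rewrite !(loc_mulE, loc_addE); apply: loc_exact => /=; ring.
Qed.

Lemma loc_neq0 : to_loc 1 != to_loc 0.
Proof.
apply/eqP => /eqmodP /asboolP[u up] /=.
by rewrite !mulr1 subr0 mulr1 => u0; move: up; rewrite u0 rpred0.
Qed.

HB.instance Definition _ := GRing.Zmodule_isComNzRing.Build localization
  loc_mulA loc_mulC loc_mul1 loc_mulDl loc_neq0.

Lemma to_loc_zmod : zmod_morphism to_loc.
Proof.
move=> a b; rewrite -[RHS]/(loc_add _ (loc_opp _)) loc_oppE loc_addE.
by apply: loc_exact => /=; ring.
Qed.

Lemma to_loc_monoid : monoid_morphism to_loc.
Proof.
split=> // a b; rewrite -[RHS]/(loc_mul _ _) loc_mulE.
by apply: loc_exact => /=; ring.
Qed.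

HB.instance Definition _ :=
  GRing.isZmodMorphism.Build R localization to_loc to_loc_zmod.
HB.instance Definition _ :=
  GRing.isMonoidMorphism.Build R localization to_loc to_loc_monoid.

End Localization.

Section Dual.
Variables (A : comNzRingType) (M : lmodType A).

Definition dual := {scalar M}.

HB.instance Definition _ := gen_eqMixin dual.
HB.instance Definition _ := gen_choiceMixin dual.

Definition dual_fun (f : dual) : M -> A := (f : {scalar M}).
Coercion dual_fun : dual >-> Funclass.

Lemma dual_lin (f : dual) : scalar f.
Proof. by move=> a x y; exact: (linearP (f : {scalar M}) a x y). Qed.

Lemma dual_eq (f g : dual) : (forall x, f x = g x) -> f = g.
Proof.
case: f g => [f cf] [g cg] /= e.
have {}e : f = g by apply/funext.
move: cf cg; rewrite e => -[[c1] [c2]] [[d1] [d2]].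
by rewrite (Prop_irrelevance c1 d1) (Prop_irrelevance c2 d2).
Qed.

Definition mk_dual (f : M -> A) (hf : scalar f) : dual :=
  HB.pack_for {scalar M} f (GRing.isLinear.Build A M A *%R f hf).

Lemma dual_add_lin (f g : dual) : scalar (fun x => f x + g x).
Proof. by move=> a x y; rewrite !dual_lin; ring. Qed.
Lemma dual_opp_lin (f : dual) : scalar (fun x => - f x).
Proof. by move=> a x y; rewrite !dual_lin; ring. Qed.
Lemma dual_scale_lin (a : A) (f : dual) : scalar (fun x => a * f x).
Proof. by move=> b x y; rewrite !dual_lin; ring. Qed.
Lemma dual_zero_lin : scalar (fun _ : M => 0 : A).
Proof. by move=> b x y; ring. Qed.

Definition dual_zero := mk_dual dual_zero_lin.
Definition dual_add f g := mk_dual (dual_add_lin f g).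
Definition dual_opp f := mk_dual (dual_opp_lin f).
Definition dual_scale a f := mk_dual (dual_scale_lin a f).

Lemma dual_addA : associative dual_add.
Proof. by move=> f g h; apply: dual_eq => x; rewrite /= addrA. Qed.
Lemma dual_addC : commutative dual_add.
Proof. by move=> f g; apply: dual_eq => x; rewrite /= addrC. Qed.
Lemma dual_add0 : left_id dual_zero dual_add.
Proof. by move=> f; apply: dual_eq => x; rewrite /= add0r. Qed.
Lemma dual_addN : left_inverse dual_zero dual_opp dual_add.
Proof. by move=> f; apply: dual_eq => x; rewrite /= addNr. Qed.

HB.instance Definition _ :=
  GRing.isZmodule.Build dual dual_addA dual_addC dual_add0 dual_addN.

Lemma dual_scaleA a b f : dual_scale a (dual_scale b f) = dual_scale (a * b) f.
Proof. by apply: dual_eq => x; rewrite /= mulrA. Qed.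
Lemma dual_scale1 : left_id 1 dual_scale.
Proof. by move=> f; apply: dual_eq => x; rewrite /= mul1r. Qed.
Lemma dual_scaleDr : right_distributive dual_scale +%R.
Proof. by move=> a f g; apply: dual_eq => x; rewrite /= mulrDr. Qed.
Lemma dual_scaleDl f : {morph dual_scale^~ f : a b / a + b}.
Proof. by move=> a b; apply: dual_eq => x; rewrite /= mulrDl. Qed.

HB.instance Definition _ := GRing.Zmodule_isLmodule.Build A dual
  dual_scaleA dual_scale1 dual_scaleDr dual_scaleDl.

End Dual.

Section ModuleNotions.
Variables (A : comNzRingType) (M : lmodType A).

Definition is_basis k (e : 'I_k -> M) : Prop :=
  forall x, exists! c : {ffun 'I_k -> A}, x = \sum_i c i *: e i.

Definition finitely_generated : Prop :=
  exists k (e : 'I_k -> M), forall x,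
    exists c : 'I_k -> A, x = \sum_i c i *: e i.

Definition projective : Prop :=
  forall (U V : lmodType A) (g : {linear U -> V}) (f : {linear M -> V}),
    (forall v, exists u, g u = v) ->
    exists f' : {linear M -> U}, forall x, g (f' x) = f x.

Definition ideal_mul (J : {pred A}) : set M :=
  [set x | exists k (a : 'I_k -> A) (y : 'I_k -> M),
     (forall i, a i \in J) /\ x = \sum_i a i *: y i].

End ModuleNotions.

(* The determinant of an endomorphism f of a finitely generated projective
   module M: writing A^k = M (+) M' (via i and p), it is the determinant of the
   endomorphism f (+) id of A^k. By [proj_detE] below it does not depend on the
   decomposition; the default value 1 of [xget] is irrelevant, as decompositions
   exist when M is finitely generated projective. *)
Section Determinant.
Variables (A : comNzRingType) (M : lmodType A).

Definition stabilize k (i : {linear M -> 'rV[A]_k}) (p : {linear 'rV[A]_k -> M})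
  (f : M -> M) (v : 'rV[A]_k) : 'rV[A]_k := i (f (p v)) + (v - i (p v)).

Definition proj_det (f : M -> M) : A :=
  xget 1 [set d | exists k (i : {linear M -> 'rV[A]_k})
                    (p : {linear 'rV[A]_k -> M}),
            cancel i p /\ d = \det (lin1_mx (stabilize i p f))].

Lemma sylvester_det k l (B : 'M[A]_(k, l)) (C : 'M[A]_(l, k)) :
  \det (1%:M + B *m C) = \det (1%:M + C *m B).
Proof.
have e1 : block_mx 1%:M (- B) C 1%:M =
    block_mx 1%:M (- B) 0 1%:M *m block_mx (1%:M + B *m C) 0 C 1%:M.
  by rewrite mulmx_block !(mul1mx, mulmx1, mul0mx, mulmx0, mulNmx) !add0r addrK.
have e2 : block_mx 1%:M (- B) C 1%:M =
    block_mx 1%:M 0 C 1%:M *m block_mx 1%:M (- B) 0 (1%:M + C *m B).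
  rewrite mulmx_block !(mul1mx, mulmx1, mul0mx, mulmx0, mulmxN) !addr0.
  by rewrite addrC addrK.
have := e1; rewrite {1}e2 => /(congr1 determinant).
by rewrite !det_mulmx !det_ublock !det_lblock !det1 !mul1r !mulr1 => ->.
Qed.

Lemma stabilize_indep (f : {linear M -> M})
    k (i : {linear M -> 'rV[A]_k}) (p : {linear 'rV[A]_k -> M})
    l (j : {linear M -> 'rV[A]_l}) (r : {linear 'rV[A]_l -> M}) :
  cancel i p -> cancel j r ->
  \det (lin1_mx (stabilize i p f)) = \det (lin1_mx (stabilize j r f)).
Proof.
move=> ip jr.
pose B : 'M[A]_(k, l) := lin1_mx (fun v => j (p v)).
pose C : 'M[A]_(l, k) := lin1_mx (fun v => i (f (r v) - r v)).
have lB : linear (fun v => j (p v)) by move=> a x y; rewrite !linearP.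
have lC : linear (fun v => i (f (r v) - r v)).
  by move=> a x y; rewrite !linearB /= !linearP /= scalerN addrACA.
pose jp : {linear 'rV[A]_k -> 'rV[A]_l} :=
  HB.pack (fun v => j (p v)) (GRing.isLinear.Build _ _ _ _ _ lB).
pose ir : {linear 'rV[A]_l -> 'rV[A]_k} :=
  HB.pack (fun v => i (f (r v) - r v)) (GRing.isLinear.Build _ _ _ _ _ lC).
have vB v : v *m B = j (p v) by apply: (mul_rV_lin1 jp).
have vC v : v *m C = i (f (r v) - r v) by apply: (mul_rV_lin1 ir).
have rl d (g : 'rV[A]_d -> 'rV[A]_d) s :
    row s (lin1_mx g) = g (delta_mx 0 s) by apply/rowP => t; rewrite !mxE.
have -> : lin1_mx (stabilize i p f) = 1%:M + B *m C.
  apply/row_matrixP => s; rewrite rl rowE mulmxDr mulmx1 mulmxA vB vC jr.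
  by rewrite /stabilize linearB /= addrCA.
have -> : lin1_mx (stabilize j r f) = 1%:M + C *m B.
  apply/row_matrixP => s; rewrite rl rowE mulmxDr mulmx1 mulmxA vC vB ip.
  by rewrite /stabilize linearB /= addrCA.
exact: sylvester_det.
Qed.

Lemma proj_detE (f : {linear M -> M})
    k (i : {linear M -> 'rV[A]_k}) (p : {linear 'rV[A]_k -> M}) :
  cancel i p -> proj_det f = \det (lin1_mx (stabilize i p f)).
Proof.
move=> ip; rewrite /proj_det; case: xgetP => [d _ /= [l [j [r [jr ->]]]]|no].
  exact: stabilize_indep.
by case: (no (\det (lin1_mx (stabilize i p f)))); exists k, i, p.
Qed.

End Determinant.

(* The module B (x)_A N for a ring morphism phi : A -> B: formal sums of pairs
   (b, x), written as sequences, modulo the relations of the tensor product. *)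
Section Extension.
Variables (A B : comNzRingType) (phi : {rmorphism A -> B}) (N : lmodType A).

Inductive tensor_eq : seq (B * N) -> seq (B * N) -> Prop :=
| TensorRefl s : tensor_eq s s
| TensorSym s t : tensor_eq s t -> tensor_eq t s
| TensorTrans s t u : tensor_eq s t -> tensor_eq t u -> tensor_eq s u
| TensorCat s s' t t' :
    tensor_eq s s' -> tensor_eq t t' -> tensor_eq (s ++ t) (s' ++ t')
| TensorCatC s t : tensor_eq (s ++ t) (t ++ s)
| TensorZero x : tensor_eq [:: (0, x)] [::]
| TensorAddl a b x : tensor_eq [:: (a + b, x)] [:: (a, x); (b, x)]
| TensorAddr b x y : tensor_eq [:: (b, x + y)] [:: (b, x); (b, y)]
| TensorScale b r x : tensor_eq [:: (b, r *: x)] [:: (b * phi r, x)].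

Definition tensor_rel (s t : seq (B * N)) : bool := `[< tensor_eq s t >].

Lemma tensor_rel_refl : reflexive tensor_rel.
Proof. by move=> s; apply/asboolP; apply: TensorRefl. Qed.

Lemma tensor_rel_sym : symmetric tensor_rel.
Proof.
by move=> s t; apply/idP/idP => /asboolP h; apply/asboolP; apply: TensorSym.
Qed.

Lemma tensor_rel_trans : transitive tensor_rel.
Proof.
move=> t s u /asboolP h /asboolP h'; apply/asboolP.
exact: TensorTrans h h'.
Qed.

Canonical tensor_rel_equiv := EquivRel tensor_rel
  tensor_rel_refl tensor_rel_sym tensor_rel_trans.

Definition extension := {eq_quot tensor_rel}.
HB.instance Definition _ : EqQuotient _ tensor_rel extension :=
  EqQuotient.on extension.
HB.instance Definition _ := Choice.on extension.

Lemma ext_eqP s t :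
  tensor_eq s t <-> \pi_extension s = \pi_extension t.
Proof. by split=> [h|/eqmodP/asboolP//]; apply/eqmodP/asboolP. Qed.

Lemma ext_repr s : tensor_eq s (repr (\pi_extension s)).
Proof. by apply/ext_eqP; rewrite reprK. Qed.

Definition scale_seq (b : B) (s : seq (B * N)) := [seq (b * u.1, u.2) | u <- s].
Definition opp_seq (s : seq (B * N)) := [seq (- u.1, u.2) | u <- s].

Lemma scale_seq_eq b s t : tensor_eq s t ->
  tensor_eq (scale_seq b s) (scale_seq b t).
Proof.
elim=> {s t} /=.
- by move=> s; apply: TensorRefl.
- by move=> s t _; apply: TensorSym.
- by move=> s t u _ h _; apply: TensorTrans h.
- by move=> s s' t t' _ h _ h'; rewrite /scale_seq !map_cat; apply: TensorCat.
- by move=> s t; rewrite /scale_seq !map_cat; apply: TensorCatC.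
- by move=> x; rewrite mulr0; apply: TensorZero.
- by move=> a c x; rewrite mulrDr; apply: TensorAddl.
- by move=> c x y; apply: TensorAddr.
- by move=> c r x; rewrite mulrA; apply: TensorScale.
Qed.

Lemma opp_seqE s : opp_seq s = scale_seq (- 1) s.
Proof. by apply: eq_map => u; rewrite mulN1r. Qed.

Lemma opp_seq_eq s t : tensor_eq s t -> tensor_eq (opp_seq s) (opp_seq t).
Proof. by rewrite !opp_seqE; apply: scale_seq_eq. Qed.

Definition ext_add := lift_op2 extension cat.
Definition ext_opp := lift_op1 extension opp_seq.
Definition ext_scale (b : B) := lift_op1 extension (scale_seq b).
Definition ext_zero := lift_cst extension [::].

Lemma ext_addE s t : ext_add (\pi_extension s) (\pi_extension t) =
  \pi_extension (s ++ t).
Proof.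
by unlock ext_add; apply/ext_eqP/TensorSym/TensorCat; apply: ext_repr.
Qed.

Lemma ext_oppE s : ext_opp (\pi_extension s) = \pi_extension (opp_seq s).
Proof.
by unlock ext_opp; apply/ext_eqP/TensorSym/opp_seq_eq; apply: ext_repr.
Qed.

Lemma ext_scaleE b s :
  ext_scale b (\pi_extension s) = \pi_extension (scale_seq b s).
Proof.
by unlock ext_scale; apply/ext_eqP/TensorSym/scale_seq_eq; apply: ext_repr.
Qed.

Lemma ext_zeroE : ext_zero = \pi_extension [::].
Proof. by unlock ext_zero. Qed.

Lemma ext_addA : associative ext_add.
Proof.
elim/quotW=> s; elim/quotW=> t; elim/quotW=> u.
by rewrite !ext_addE catA.
Qed.

Lemma ext_addC : commutative ext_add.
Proof.
elim/quotW=> s; elim/quotW=> t.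
by rewrite !ext_addE; apply/ext_eqP/TensorCatC.
Qed.

Lemma ext_add0 : left_id ext_zero ext_add.
Proof. by elim/quotW=> s; rewrite ext_zeroE ext_addE. Qed.

Lemma opp_seqP s : tensor_eq (opp_seq s ++ s) [::].
Proof.
elim: s => [|[b x] s IHs]; first exact: TensorRefl.
apply: TensorTrans (_ : tensor_eq ([:: (- b, x); (b, x)] ++ (opp_seq s ++ s)) _).
  rewrite /= -(cat1s (b, x)) -[X in tensor_eq _ (_ :: X)]cat1s.
  rewrite -(cat1s (- b, x) (_ ++ _)) -[X in tensor_eq _ X]cat1s.
  apply: TensorCat; first exact: TensorRefl.
  rewrite !catA; apply: TensorCat; last exact: TensorRefl.
  exact: TensorCatC.
rewrite -[[::]]/([::] ++ [::]); apply: TensorCat => //.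
apply: TensorTrans (TensorZero x); rewrite -(addNr b).
exact/TensorSym/TensorAddl.
Qed.

Lemma ext_addN : left_inverse ext_zero ext_opp ext_add.
Proof.
elim/quotW=> s; rewrite ext_zeroE ext_oppE ext_addE.
exact/ext_eqP/opp_seqP.
Qed.

HB.instance Definition _ :=
  GRing.isZmodule.Build extension ext_addA ext_addC ext_add0 ext_addN.

Lemma ext_scaleA a b x : ext_scale a (ext_scale b x) = ext_scale (a * b) x.
Proof.
elim/quotW: x => s; rewrite !ext_scaleE /scale_seq -map_comp.
by congr (\pi_extension _); apply: eq_map => u /=; rewrite mulrA.
Qed.

Lemma ext_scale1 : left_id 1 ext_scale.
Proof.
elim/quotW=> s; rewrite ext_scaleE /scale_seq; congr (\pi_extension _).
by rewrite -[RHS]map_id; apply: eq_map => -[b x]; rewrite /= mul1r.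
Qed.

Lemma ext_scaleDr : right_distributive ext_scale +%R.
Proof.
move=> b; elim/quotW=> s; elim/quotW=> t.
rewrite -[_ + _]/(ext_add _ _) -[RHS]/(ext_add _ _) !(ext_scaleE, ext_addE).
by rewrite /scale_seq map_cat.
Qed.

Lemma ext_scaleDl x : {morph ext_scale^~ x : a b / a + b}.
Proof.
elim/quotW: x => s a b; rewrite -[RHS]/(ext_add _ _) !(ext_scaleE, ext_addE).
apply/ext_eqP; elim: s => [|[c x] s IHs]; first exact: TensorRefl.
apply: TensorTrans
  (_ : tensor_eq ([:: (a * c, x); (b * c, x)] ++
                  (scale_seq a s ++ scale_seq b s)) _).
  rewrite /= -cat1s mulrDl -[X in tensor_eq _ X]/([:: _; _] ++ _).
  by apply: TensorCat => //; apply: TensorAddl.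
rewrite /= -cat1s -[X in tensor_eq _ X]cat1s.
apply: TensorCat; first exact: TensorRefl.
rewrite -cat1s -[(b * c, x) :: scale_seq b s]cat1s !catA.
apply: TensorCat; last exact: TensorRefl.
exact: TensorCatC.
Qed.

HB.instance Definition _ := GRing.Zmodule_isLmodule.Build B extension
  ext_scaleA ext_scale1 ext_scaleDr ext_scaleDl.

End Extension.

Definition has_rank (R : comNzRingType) (P : lmodType R) (n : nat) : Prop :=
  forall p : prime_idealr R,
    exists e : 'I_n -> extension (@to_loc R p) P, is_basis e.

Section QuadraticForms.
Variables (A : comNzRingType) (M : lmodType A).

Definition polar (q : M -> A) (x y : M) : A := q (x + y) - q x - q y.

Record is_quadratic_form (q : M -> A) : Prop := QuadraticForm {
  quad_scale : forall r x, q (r *: x) = r ^+ 2 * q x;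
  polar_linl : forall y, scalar (polar q ^~ y);
  polar_linr : forall x, scalar (polar q x)
}.

(* The map z |-> polar q z from M to its dual is bijective. *)
Definition nondegenerate (q : M -> A) : Prop :=
  forall g : dual M, exists! z, forall w, polar q z w = g w.

Record is_quadratic_space (q : M -> A) : Prop := QuadraticSpace {
  quad_fg : finitely_generated M;
  quad_proj : projective M;
  quad_form : is_quadratic_form q;
  quad_nondeg : nondegenerate q
}.

End QuadraticForms.

Definition qperp (A : comNzRingType) (M N : lmodType A)
  (q : M -> A) (q' : N -> A) (x : M * N) : A := q x.1 + q' x.2.

Definition hyperbolic (A : comNzRingType) (P : lmodType A)
  (x : P * dual P) : A := x.2 x.1.
Arguments hyperbolic {A} P x.

(* The extension of q to B (x)_A N:
   q (\sum_i b_i (x) x_i) =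
     \sum_i b_i^2 q(x_i) + \sum_(i < j) b_i b_j polar q x_i x_j. *)
Section ExtensionForm.
Variables (A B : comNzRingType) (phi : {rmorphism A -> B}) (N : lmodType A).
Variable q : N -> A.

Fixpoint qseq (s : seq (B * N)) : B :=
  if s is u :: s' then
    u.1 ^+ 2 * phi (q u.2)
    + \sum_(v <- s') u.1 * v.1 * phi (polar q u.2 v.2) + qseq s'
  else 0.

Definition qext (x : extension phi N) : B := qseq (repr x).

Definition bseq (s t : seq (B * N)) : B :=
  \sum_(u <- s) \sum_(v <- t) u.1 * v.1 * phi (polar q u.2 v.2).

Lemma qseq_cat s t : qseq (s ++ t) = qseq s + qseq t + bseq s t.
Proof.
elim: s => [|u s IHs] /=; first by rewrite /bseq big_nil add0r addr0.
by rewrite IHs /bseq big_cons big_cat /=; ring.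
Qed.

Hypothesis hq : is_quadratic_form q.

Lemma polarC x y : polar q x y = polar q y x.
Proof. by rewrite /polar [x + y]addrC addrAC. Qed.

Lemma bseqC s t : bseq s t = bseq t s.
Proof.
rewrite /bseq exchange_big; apply: eq_bigr => u _; apply: eq_bigr => v _.
by rewrite polarC [v.1 * _]mulrC.
Qed.

Lemma polar0 x : polar q x 0 = 0.
Proof.
have := polar_linr hq x 1 0 0; rewrite scale1r addr0 mul1r => e.
by apply: (addrI (polar q x 0)); rewrite addr0 -e.
Qed.

Lemma polarD x y z : polar q x (y + z) = polar q x y + polar q x z.
Proof. by rewrite -[y]scale1r (polar_linr hq) mul1r scale1r. Qed.

Lemma polarZ x r y : polar q x (r *: y) = r * polar q x y.
Proof. by rewrite -[r *: y]addr0 (polar_linr hq) polar0 addr0. Qed.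

Lemma bseq_eq u s t : tensor_eq phi s t -> bseq u s = bseq u t.
Proof.
have bcat s1 s2 : bseq u (s1 ++ s2) = bseq u s1 + bseq u s2.
  rewrite /bseq -big_split; apply: eq_bigr => v _.
  by rewrite big_cat.
elim=> {s t} //=.
- by move=> s t w _ -> _ ->.
- by move=> s s' t t' _ h _ h'; rewrite !bcat h h'.
- by move=> s t; rewrite !bcat addrC.
- move=> x; rewrite /bseq; apply: eq_bigr => v _.
  by rewrite big_seq1 big_nil /= mulr0 mul0r.
- move=> a b x; rewrite /bseq; apply: eq_bigr => v _.
  by rewrite !big_cons !big_nil /=; ring.
- move=> b x y; rewrite /bseq; apply: eq_bigr => v _.
  by rewrite !big_cons !big_nil /= polarD rmorphD; ring.
- move=> b r x; rewrite /bseq; apply: eq_bigr => v _.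
  by rewrite !big_cons !big_nil /= polarZ rmorphM; ring.
Qed.

Lemma qseq_eq s t : tensor_eq phi s t -> qseq s = qseq t.
Proof.
elim=> {s t} //=.
- by move=> s t w _ -> _ ->.
- move=> s s' t t' h0 h h0' h'; rewrite !qseq_cat h h'; congr (_ + _).
  by rewrite (bseq_eq _ h0') bseqC (bseq_eq _ h0) bseqC.
- by move=> s t; rewrite !qseq_cat bseqC [qseq s + _]addrC.
- by move=> x; rewrite big_nil; ring.
- move=> a b x; rewrite !big_cons !big_nil /=.
  have -> : polar q x x = 2%:R * q x.
    rewrite /polar; have -> : x + x = 2%:R *: x by rewrite scaler_nat.
    by rewrite (quad_scale hq); ring.
  by rewrite rmorphM rmorph_nat; ring.
- move=> b x y; rewrite !big_cons !big_nil /=.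
  have -> : q (x + y) = q x + q y + polar q x y by rewrite /polar; ring.
  by rewrite !rmorphD; ring.
- move=> b r x; rewrite !big_nil (quad_scale hq) rmorphM rmorphXn; ring.
Qed.

Lemma qextE s : qext (\pi_(extension phi N) s) = qseq s.
Proof. exact/esym/qseq_eq/ext_repr. Qed.

End ExtensionForm.

Section LinearGroup.
Variables (A : comNzRingType) (M : lmodType A).

Record lin_aut := LinAut {
  aut_fun :> M -> M;
  aut_inv : M -> M;
  aut_linear : linear aut_fun;
  aut_funK : cancel aut_fun aut_inv;
  aut_invK : cancel aut_inv aut_fun
}.

HB.instance Definition _ := gen_eqMixin lin_aut.
HB.instance Definition _ := gen_choiceMixin lin_aut.

Lemma lin_aut_eq (s t : lin_aut) : (forall x, s x = t x) -> s = t.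
Proof.
case: s t => [f f' lf fK f'K] [g g' lg gK g'K] /= e.
have {}e : f = g by apply/funext.
have e' : f' = g'.
  by apply/funext => x; rewrite -{1}(g'K x) -e fK.
by move: lf fK f'K lg gK g'K; rewrite e e' => *; congr LinAut.
Qed.

Lemma id_linear : linear (@id M). Proof. by []. Qed.

Definition aut_one := LinAut id_linear (fun=> erefl) (fun=> erefl).

Lemma comp_linear (s t : lin_aut) : linear (s \o t).
Proof. by move=> a x y; rewrite /= !aut_linear. Qed.

Definition aut_mul (s t : lin_aut) := LinAut (comp_linear s t)
  (can_comp (aut_funK s) (aut_funK t)) (can_comp (aut_invK t) (aut_invK s)).

Lemma inv_linear (s : lin_aut) : linear (aut_inv s).
Proof.
move=> a x y; apply: (can_inj (aut_funK s)).
by rewrite aut_linear !aut_invK.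
Qed.

Definition aut_inverse (s : lin_aut) :=
  LinAut (inv_linear s) (aut_invK s) (aut_funK s).

Lemma aut_mulA : associative aut_mul.
Proof. by move=> s t u; apply: lin_aut_eq. Qed.
Lemma aut_mul1 : left_id aut_one aut_mul.
Proof. by move=> s; apply: lin_aut_eq. Qed.
Lemma aut_1mul : right_id aut_one aut_mul.
Proof. by move=> s; apply: lin_aut_eq. Qed.
Lemma aut_mulV : left_inverse aut_one aut_inverse aut_mul.
Proof. by move=> s; apply: lin_aut_eq => x /=; rewrite aut_funK. Qed.
Lemma aut_Vmul : right_inverse aut_one aut_inverse aut_mul.
Proof. by move=> s; apply: lin_aut_eq => x /=; rewrite aut_invK. Qed.

HB.instance Definition _ :=
  isGroup.Build lin_aut aut_mulA aut_mul1 aut_1mul aut_mulV aut_Vmul.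

Definition orthogonal (q : M -> A) : set lin_aut :=
  [set s | forall x y, polar q (s x) (s y) = polar q x y].

(* The kernel of O_A(M) -> O_(A/J)(M/JM): the isometries inducing the identity
   on M/JM. *)
Definition orthogonal_rel (J : {pred A}) (q : M -> A) : set lin_aut :=
  [set s | orthogonal q s /\ forall x, ideal_mul J (s x - x)].

Definition special_orthogonal_rel (J : {pred A}) (q : M -> A) : set lin_aut :=
  [set s | orthogonal_rel J q s /\ proj_det s = 1].

End LinearGroup.

(* The default value 0 of [xget] is only used when 2 is not invertible. *)
Definition half (A : comNzRingType) : A := xget 0 [set u | 2%:R * u = 1].

(* Since q is non-degenerate, the maps alpha' and beta' below, which stand for
   alpha^* and beta^*, exist and are unique. *)
Section Elementary.
Variables (A : comNzRingType) (Q : lmodType A) (q : Q -> A) (P : lmodType A).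

Local Notation M := (Q * (P * dual P))%type.

Definition is_E (alpha : {linear Q -> P}) (s : lin_aut M) : Prop :=
  exists alpha' : dual P -> Q,
    (forall f z, polar q (alpha' f) z = f (alpha z)) /\
    forall z x f, s (z, (x, f)) =
      (z - alpha' f, (x + alpha z - half A *: alpha (alpha' f), f)).

Definition is_Estar (beta : {linear Q -> dual P}) (s : lin_aut M) : Prop :=
  exists beta' : P -> Q,
    (forall x z, polar q (beta' x) z = beta z x) /\
    forall z x f, s (z, (x, f)) =
      (z - beta' x, (x, beta z - half A *: beta (beta' x) + f)).

Definition EO_ideal (J : {pred A}) : set (lin_aut M) :=
  gen_subgroup
    ([set s | exists2 alpha : {linear Q -> P},
        forall z, ideal_mul J (alpha z) & is_E alpha s] `|`
     [set s | exists2 beta : {linear Q -> dual P},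
        forall z, ideal_mul J (beta z) & is_Estar beta s]).

Definition EO : set (lin_aut M) :=
  gen_subgroup
    ([set s | exists alpha : {linear Q -> P}, is_E alpha s] `|`
     [set s | exists beta : {linear Q -> dual P}, is_Estar beta s]).

Definition EO_rel (J : {pred A}) : set (lin_aut M) :=
  normal_closure EO (EO_ideal J).

End Elementary.
Arguments EO_ideal {A Q} q P J.
Arguments EO {A Q} q P.
Arguments EO_rel {A Q} q P J.

(* e_(i,j), with rows and columns numbered from 0. *)
Definition unit_mx (A : comNzRingType) (N i j : nat) : 'M[A]_N :=
  \matrix_(a, b) ((a == i :> nat) && (b == j :> nat))%:R.

Definition phi_even (A : comNzRingType) (r : nat) : 'M[A]_r.*2 :=
  \sum_(k < r) (unit_mx A r.*2 k.*2 k.*2.+1 + unit_mx A r.*2 k.*2.+1 k.*2).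

(* The block (2) has size [odd N], so it is absent when N is even. *)
Definition phi_tilde (A : comNzRingType) (N : nat) : 'M[A]_N :=
  castmx (odd_double_half N, odd_double_half N)
    (block_mx (2%:R%:M : 'M_(odd N)) 0 0 (phi_even A N./2)).

Notation poly_module N := (extension polyC N).
Notation poly_form q := (@qext _ _ polyC _ q).
Notation local_module p N := (extension (@to_loc _ p) N).
Notation local_form p q := (@qext _ _ (@to_loc _ p) _ q).

(* q_p (+) h_p = phi~_N, on Q_p (+) H(P)_p. *)
Definition is_locally_phi_tilde (R : comNzRingType) (Q P : lmodType R)
    (q : Q -> R) (N : nat) (p : prime_idealr R) : Prop :=
  exists e : 'I_N -> local_module p Q * local_module p (P * dual P)%type,
    is_basis e /\
    forall i j,
      polar (qperp (local_form p q) (local_form p (hyperbolic P))) (e i) (e j)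
      = phi_tilde (localization p) N i j.

(* Main.v *)
Require Import Defs.
From HB Require Import structures.
From mathcomp Require Import all_boot all_order all_algebra.
From mathcomp Require Import boolp classical_sets ring.

(** Write M = Q + P + P^* for the quadratic space and <,> for its bilinear form.

Matrices.  Q and P are retracts of free modules, so an automorphism of M is a
matrix acting on row vectors and fixing a complement of M ([mxs]).  The groups
of the theorem become groups of matrices over R[X] which make sense over every
R-algebra ([model], [smap]) and so can be localized.  The elementary group is
the group [EOm] generated by the Eichler transvections
  v |-> v + <v,x> z - <v,z> x - q(z) <v,x> x,   x in P or in P^*, z in Q
([E_EO], [Estar_EO], [EOm_EO]).  The normal closure of the elementary group of
the ideal (X) consists of the elementary g with g(0) = 1, because a word for such
a g can be rearranged into conjugates of transvections with a factor X
([EO_rel_split]).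

Local rings.  There P and P^* have dual bases, and <u,u> is a unit for some u
in Q ([frame_model]).  The elementary group then moves every unimodular vector to a standard
position in one hyperbolic plane ([unimodular_transitive]).  Consequently an
isometry is an elementary matrix times an isometry that fixes a hyperbolic pair;
the latter normalizes the elementary group, since that group is also generated
by the transvections along the two vectors of the pair ([stab_conj]).  Isometries
are products of reflections ([isom_reflections]); each reflection is conjugate
under the elementary group to one in the fixed hyperbolic plane, so modulo
elementary matrices the isometries of determinant 1 are the diagonal matrices of
that plane.  These commute, so the commutators are elementary
([local_commutator]).

Local to global.  If a matrix s(T) over A[T] has s(0) = 1 and is elementary over
A_m[T] for every maximal ideal m of A, then s(1) is elementary over A
([local_global]).  This is applied twice.  With s(T) = g^-1 E(x,Tz) g E(x,Tz)^-1
it shows that isometries normalize the elementary group ([EO_normal]).  With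
s(T) = [g, h(XT)], where h(0) = 1 and g is elementary at all localizations of
R[X], it shows that [g, h] is elementary ([commutator_EO]): locally g is
elementary, and conjugation by h(XT) preserves elementary matrices.

Let G be the group of the isometries of determinant 1 that are trivial mod X and
K the subgroup of its elements which are elementary at all localizations.  Then
[G, G] lies in K and [G, K] in the elementary group, so the quotient of G by the
relative elementary group has class at most 2 ([SO_quotient_nilpotent]). *)

Set Implicit Arguments.
Unset Strict Implicit.
Unset Printing Implicit Defensive.

Import GRing.Theory.
Local Open Scope quotient_scope.
Local Open Scope ring_scope.

(** * Eichler transvections *)

Section Generated.
Variables (B : comNzRingType) (N : nat).
Implicit Types (g h a : 'M[B]_N) (G H : 'M[B]_N -> Prop).

Inductive gen G : 'M[B]_N -> Prop :=
| gen1 : gen G 1%:M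
| genM g h : G g -> gen G h -> gen G (g *m h).

Lemma gen_in G g : G g -> gen G g.
Proof. by move=> Gg; rewrite -[g]mulmx1; apply: genM => //; apply: gen1. Qed.

Lemma gen_mul G g h : gen G g -> gen G h -> gen G (g *m h).
Proof.
by elim=> [|g1 g2 Gg1 _ IH] Gh; rewrite ?mul1mx // -mulmxA; apply: genM; auto.
Qed.

Lemma gen_sub G H g : (forall h, G h -> gen H h) -> gen G g -> gen H g.
Proof.
move=> GH; elim=> [|g1 g2 Gg1 _ IH]; first exact: gen1.
by apply: gen_mul => //; apply: GH.
Qed.

Lemma gen_conj G H a a' g : a *m a' = 1%:M ->
  (forall h, G h -> gen H (a' *m h *m a)) -> gen G g -> gen H (a' *m g *m a).
Proof.
move=> aa' GH; elim=> [|g1 g2 Gg1 _ IH].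
  by rewrite mulmx1 (mulmx1C aa'); apply: gen1.
have -> : a' *m (g1 *m g2) *m a = (a' *m g1 *m a) *m (a' *m g2 *m a).
  by rewrite !mulmxA -(mulmxA (a' *m g1) a) aa' mulmx1.
by apply: gen_mul => //; apply: GH.
Qed.

Lemma gen_inv G g : (forall h, G h -> exists2 h', gen G h' & h *m h' = 1%:M) ->
  gen G g -> exists2 g', gen G g' & g *m g' = 1%:M.
Proof.
move=> Ginv; elim=> [|g1 g2 /Ginv[h1 Gh1 e1] _ [h2 Gh2 e2]].
  by exists 1%:M; rewrite ?mulmx1 //; apply: gen1.
exists (h2 *m h1); first exact: gen_mul.
by rewrite mulmxA -(mulmxA g1) e2 mulmx1.
Qed.

Lemma inv_uniq g h h' : g *m h = 1%:M -> g *m h' = 1%:M -> h = h'.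
Proof.
by move=> e e'; rewrite -[h']mul1mx -(mulmx1C e) -mulmxA e' mulmx1.
Qed.

Lemma mx_ext m (g h : 'M[B]_(N, m)) :
  (forall x : 'rV_N, x *m g = x *m h) -> g = h.
Proof. by move=> e; apply/row_matrixP => i; rewrite !rowE e. Qed.

End Generated.

Lemma gen_map (B C : comNzRingType) (f : {rmorphism B -> C}) N
    (G : 'M[B]_N -> Prop) (H : 'M[C]_N -> Prop) g :
  (forall h, G h -> gen H (map_mx f h)) -> gen G g -> gen H (map_mx f g).
Proof.
move=> GH; elim=> [|g1 g2 Gg1 _ IH]; first by rewrite map_mx1; apply: gen1.
by rewrite map_mxM; apply: gen_mul => //; apply: GH.
Qed.

(** A quadratic space given by matrices: the image in B^N of the projection
[prM], split into a part Q and two parts P and D in duality.  [cogram] inverts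
the Gram matrix on that image, and [hf] is one half, kept as a field so that a
ring morphism carries it along. *)
Record hspace (B : comNzRingType) (N : nat) := HSpace {
  gram : 'M[B]_N;
  cogram : 'M[B]_N;
  prQ : 'M[B]_N;
  prP : 'M[B]_N;
  prD : 'M[B]_N;
  hf : B
}.

Definition prM B N (S : hspace B N) := prQ S + prP S + prD S.

Definition bil B N (S : hspace B N) (x y : 'rV[B]_N) : B :=
  (x *m gram S *m y^T) 0 0.

(** The Eichler transvection of an isotropic u and a v orthogonal to u, given on
vectors by [mul_eich], where hf S * bil S v v is q(v). *)
Definition eich B N (S : hspace B N) (u v : 'rV[B]_N) : 'M[B]_N :=
  1%:M + gram S *m u^T *m v - gram S *m v^T *m u
  - (hf S * bil S v v) *: (gram S *m u^T *m u).

(** The last three fields say that Q is self-adjoint and that P and D are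
adjoint to each other: Q is orthogonal to P + D, and P and D are isotropic. *)
Record space_axioms B N (S : hspace B N) : Prop := SpaceAxioms {
  gram_sym : (gram S)^T = gram S;
  gram_cogram : gram S *m cogram S = prM S;
  hf2 : 2%:R * hf S = 1;
  prQQ : prQ S *m prQ S = prQ S;
  prPP : prP S *m prP S = prP S;
  prDD : prD S *m prD S = prD S;
  prQP : prQ S *m prP S = 0;
  prQD : prQ S *m prD S = 0;
  prPQ : prP S *m prQ S = 0;
  prPD : prP S *m prD S = 0;
  prDQ : prD S *m prQ S = 0;
  prDP : prD S *m prP S = 0;
  prQ_gram : prQ S *m gram S = gram S *m (prQ S)^T;
  prP_gram : prP S *m gram S = gram S *m (prD S)^T;
  prD_gram : prD S *m gram S = gram S *m (prP S)^T
}.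

Definition inQ B N (S : hspace B N) (x : 'rV[B]_N) := x *m prQ S = x.
Definition inM B N (S : hspace B N) (x : 'rV[B]_N) := x *m prM S = x.
Definition lagr B N (S : hspace B N) (x : 'rV[B]_N) :=
  x *m prP S = x \/ x *m prD S = x.

(** Isometries of the image of [prM], extended by the identity on the kernel;
with this normalization an isometry is determined by its restriction. *)
Definition isom B N (S : hspace B N) (g : 'M[B]_N) : Prop :=
  [/\ forall x y, bil S (x *m g) (y *m g) = bil S x y,
      forall x, inM S x -> inM S (x *m g)
    & (1%:M - prM S) *m g = 1%:M - prM S].

Definition EOgen B N (S : hspace B N) (g : 'M[B]_N) : Prop :=
  exists x z, [/\ lagr S x, inQ S z & g = eich S x z].

Definition EOm B N (S : hspace B N) := gen (EOgen S).

Section Bilinear.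
Variables (B : comNzRingType) (N : nat) (S : hspace B N).
Local Notation "<| x , y |>" := (bil S x y).
Implicit Types (x y z u v w : 'rV[B]_N) (a b : B).

Lemma bilDl x y z : <|x + y, z|> = <|x, z|> + <|y, z|>.
Proof. by rewrite /bil !mulmxDl mxE. Qed.
Lemma bilZl a x z : <|a *: x, z|> = a * <|x, z|>.
Proof. by rewrite /bil -!scalemxAl mxE. Qed.
Lemma bilNl x z : <|- x, z|> = - <|x, z|>.
Proof. by rewrite -scaleN1r bilZl mulN1r. Qed.
Lemma bilDr x y z : <|x, y + z|> = <|x, y|> + <|x, z|>.
Proof. by rewrite /bil linearD /= mulmxDr mxE. Qed.
Lemma bilZr a x z : <|x, a *: z|> = a * <|x, z|>.
Proof. by rewrite /bil linearZ /= -scalemxAr mxE. Qed.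
Lemma bilNr x z : <|x, - z|> = - <|x, z|>.
Proof. by rewrite -scaleN1r bilZr mulN1r. Qed.
Lemma bil0l x : <|0, x|> = 0.
Proof. by rewrite -[0](scale0r x) bilZl mul0r. Qed.
Lemma bil0r x : <|x, 0|> = 0.
Proof. by rewrite -[X in <|_, X|>](scale0r x) bilZr mul0r. Qed.
Lemma bil_sumr I r (P : pred I) (F : I -> 'rV_N) x :
  <|x, \sum_(i <- r | P i) F i|> = \sum_(i <- r | P i) <|x, F i|>.
Proof. by elim/big_rec2: _ => [|i a b _ <-]; rewrite ?bil0r ?bilDr. Qed.

Definition bilE := (bilDl, bilDr, bilZl, bilZr, bilNl, bilNr).

Lemma bil_mx x y : x *m gram S *m y^T = <|x, y|>%:M.
Proof. by rewrite [LHS]mx11_scalar. Qed.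

Lemma mul_eich x u v : x *m eich S u v =
  x + <|x, u|> *: v - <|x, v|> *: u - (hf S * <|v, v|> * <|x, u|>) *: u.
Proof.
rewrite /eich !mulmxBr mulmxDr mulmx1 -scalemxAr !mulmxA !bil_mx.
by rewrite !mul_scalar_mx scalerA.
Qed.

Lemma eich0 u : eich S u 0 = 1%:M.
Proof.
by apply: mx_ext => x; rewrite mul_eich mulmx1 !bil0r scaler0 addr0 !(mulr0, mul0r, scale0r) !subr0.
Qed.

Lemma eichZ a u v : eich S (a *: u) v = eich S u (a *: v).
Proof.
apply: mx_ext => x; rewrite !mul_eich !bilE.
by apply/rowP => j; rewrite !mxE; ring.
Qed.

(** For isotropic u and v the transvection only depends on the bivector
u ^ v. *)
Lemma eich_swap u v : <|u, u|> = 0 -> <|v, v|> = 0 ->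
  eich S u v = eich S v (- u).
Proof.
move=> uu vv; apply: mx_ext => x; rewrite !mul_eich !bilE uu vv.
by apply/rowP => j; rewrite !mxE; ring.
Qed.

Hypothesis axS : space_axioms S.

Lemma bilC x y : <|x, y|> = <|y, x|>.
Proof.
have := congr1 trmx (bil_mx x y).
rewrite !trmx_mul trmxK (gram_sym axS) mulmxA tr_scalar_mx bil_mx.
by move/matrixP/(_ 0 0); rewrite !mxE.
Qed.

Lemma bil_prQ x y : <|x *m prQ S, y|> = <|x, y *m prQ S|>.
Proof. by rewrite /bil -(mulmxA x) (prQ_gram axS) trmx_mul !mulmxA. Qed.
Lemma bil_prP x y : <|x *m prP S, y|> = <|x, y *m prD S|>.
Proof. by rewrite /bil -(mulmxA x) (prP_gram axS) trmx_mul !mulmxA. Qed.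
Lemma bil_prD x y : <|x *m prD S, y|> = <|x, y *m prP S|>.
Proof. by rewrite /bil -(mulmxA x) (prD_gram axS) trmx_mul !mulmxA. Qed.
Lemma bil_prM x y : <|x *m prM S, y|> = <|x, y *m prM S|>.
Proof.
rewrite /prM !mulmxDr !bilE bil_prQ bil_prP bil_prD; ring.
Qed.

Lemma prMM : prM S *m prM S = prM S.
Proof.
rewrite /prM !mulmxDl !mulmxDr (prQQ axS) (prPP axS) (prDD axS) (prQP axS).
rewrite (prQD axS) (prPQ axS) (prPD axS) (prDQ axS) (prDP axS).
by rewrite !(addr0, add0r).
Qed.

Lemma lagrP_iso x : x *m prP S = x -> <|x, x|> = 0.
Proof. by move=> e; rewrite -{1}e bil_prP -e -mulmxA (prPD axS) mulmx0 bil0r. Qed.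
Lemma lagrD_iso x : x *m prD S = x -> <|x, x|> = 0.
Proof. by move=> e; rewrite -{1}e bil_prD -e -mulmxA (prDP axS) mulmx0 bil0r. Qed.
Lemma lagr_iso x : lagr S x -> <|x, x|> = 0.
Proof. by case=> [/lagrP_iso|/lagrD_iso]. Qed.

Lemma bil_lagrQ x z : lagr S x -> inQ S z -> <|x, z|> = 0.
Proof.
move=> lx <-; rewrite -bil_prQ.
by case: lx => <-; rewrite -mulmxA ?(prPQ axS) ?(prDQ axS) mulmx0 bil0l.
Qed.

Lemma inQ_inM x : inQ S x -> inM S x.
Proof.
rewrite /inQ /inM => <-; rewrite -mulmxA /prM !mulmxDr (prQQ axS) (prQP axS).
by rewrite (prQD axS) !mulmx0 !addr0.
Qed.
Lemma lagr_inM x : lagr S x -> inM S x.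
Proof.
rewrite /inM; case=> <-; rewrite -mulmxA /prM !mulmxDr.
  by rewrite (prPQ axS) (prPP axS) (prPD axS) ?mulmx0 addr0 add0r.
by rewrite (prDQ axS) (prDD axS) (prDP axS) ?mulmx0 !add0r ?addr0.
Qed.

Lemma inM_D x y : inM S x -> inM S y -> inM S (x + y).
Proof. by rewrite /inM mulmxDl => -> ->. Qed.
Lemma inM_Z a x : inM S x -> inM S (a *: x).
Proof. by rewrite /inM -scalemxAl => ->. Qed.
Lemma inM_N x : inM S x -> inM S (- x).
Proof. by rewrite /inM mulNmx => ->. Qed.
Lemma inQ_D x y : inQ S x -> inQ S y -> inQ S (x + y).
Proof. by rewrite /inQ mulmxDl => -> ->. Qed.
Lemma inQ_Z a x : inQ S x -> inQ S (a *: x).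
Proof. by rewrite /inQ -scalemxAl => ->. Qed.
Lemma inQ_N x : inQ S x -> inQ S (- x).
Proof. by rewrite /inQ mulNmx => ->. Qed.
Lemma lagr_Z a x : lagr S x -> lagr S (a *: x).
Proof. by rewrite /lagr -!scalemxAl; case=> ->; [left|right]. Qed.
(** Reduces an identity that needs 2 * hf = 1 to a ring identity with an
explicit multiple t of 2 * hf - 1. *)
Lemma hf_eq t a b : a = b + t * (2%:R * hf S - 1) -> a = b.
Proof. by rewrite (hf2 axS) subrr mulr0 addr0. Qed.

Lemma eichD u v w : <|u, u|> = 0 -> <|u, v|> = 0 -> <|u, w|> = 0 ->
  eich S u v *m eich S u w = eich S u (v + w).
Proof.
move=> uu uv uw; apply: mx_ext => x; rewrite mulmxA !mul_eich !bilE.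
rewrite uu (bilC v u) uv uw ?(bilC w v).
apply/rowP => j; rewrite !mxE.
apply: (hf_eq (t := <|x, u|> * <|v, w|> * u 0 j)); ring.
Qed.

Lemma eichN u v : <|u, u|> = 0 -> <|u, v|> = 0 ->
  eich S u v *m eich S u (- v) = 1%:M.
Proof. by move=> uu uv; rewrite eichD ?subrr ?eich0 // bilNr uv oppr0. Qed.

Lemma eich_bil u v x y : <|u, u|> = 0 -> <|u, v|> = 0 ->
  <|x *m eich S u v, y *m eich S u v|> = <|x, y|>.
Proof.
move=> uu uv; rewrite !mul_eich !bilE uu (bilC v u) uv.
apply: (hf_eq (t := - (<|v, v|> * <|x, u|> * <|y, u|>))).
rewrite (bilC u y) (bilC v y); ring.
Qed.

Lemma eich_isom u v : inM S u -> inM S v -> <|u, u|> = 0 -> <|u, v|> = 0 ->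
  isom S (eich S u v).
Proof.
move=> Mu Mv uu uv; split=> [x y|x Mx|]; first exact: eich_bil.
  rewrite mul_eich; do 3?[apply: inM_D => //]; rewrite -?scaleNr; exact: inM_Z.
apply: mx_ext => x; rewrite mulmxA mul_eich.
have orth w : inM S w -> <|x *m (1%:M - prM S), w|> = 0.
  move=> Mw; rewrite mulmxBr mulmx1 bilDl bilNl bil_prM Mw; ring.
by rewrite !orth // mulr0 !scale0r addr0 !subr0.
Qed.

Lemma eich_conj g g' u v : g *m g' = 1%:M ->
  (forall x y, <|x *m g, y *m g|> = <|x, y|>) ->
  g' *m eich S u v *m g = eich S (u *m g) (v *m g).
Proof.
move=> gg' gO; have g'g := mulmx1C gg'.
apply: mx_ext => x; rewrite !mulmxA !mul_eich gO.
have e y : <|x *m g', y|> = <|x, y *m g|> by rewrite -gO -mulmxA g'g mulmx1.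
by rewrite !e !mulmxBl !mulmxDl -!scalemxAl -mulmxA g'g mulmx1.
Qed.

Lemma eich_conj_eich u v w z : <|u, u|> = 0 -> <|u, v|> = 0 ->
  eich S u (- v) *m eich S w z *m eich S u v =
    eich S (w *m eich S u v) (z *m eich S u v).
Proof.
move=> uu uv; apply: eich_conj => [|x y]; last exact: eich_bil.
exact: eichN.
Qed.

(** The transvection along e' is conjugated into the hyperbolic plane of e, f':
moving f' by the transvection along e creates f' + v - q(v) e, and the outer
factors remove the terms in f' and in e.  Hence transvections
along e' are products of transvections along e and f' with vectors orthogonal to
the plane.  The scalar a serves to share a factor between e' and v when
denominators are controlled. *)
Lemma eich_opp_split e e' f' v a :
  <|e, e|> = 0 -> <|f', f'|> = 0 -> <|e', e'|> = 0 -> <|f', e|> = 1 ->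
  <|e', e|> = 0 -> <|e', f'|> = 0 -> <|v, e|> = 0 -> <|v, f'|> = 0 ->
  <|v, e'|> = 0 ->
  eich S e' (- (a *: v)) =
    eich S e' (a *: f') *m
    (eich S e (- v) *m eich S f' (a *: e') *m eich S e v) *m
    eich S e' (- ((a * (hf S * <|v, v|>)) *: e)).
Proof.
move=> ee ff gg fe ge gf ve vf vg.
rewrite eich_conj_eich //; last by rewrite bilC.
rewrite !mul_eich !bilE fe ge (bilC f' v) vf (bilC e' v) vg.
rewrite scale1r !scale0r mulr1 !mulr0 !scale0r !subr0 !addr0.
set y := f' + v - _.
have yy : <|y, y|> = 0.
  rewrite /y !bilE ff ee (bilC f' v) vf fe (bilC e f') fe (bilC e v) ve.
  apply: (hf_eq (t := - <|v, v|>)); ring.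
have ey : <|e', y|> = 0.
  rewrite /y !bilE gf (bilC e' v) vg ge; ring.
have -> : eich S y (a *: e') = eich S e' (- (a *: y)).
  by rewrite -eichZ eich_swap ?eichZ ?scalerN // bilZl bilZr yy !mulr0.
rewrite !eichD //; first congr (eich S _ _); rewrite ?bilE ?gf ?(bilC e' v) ?vg ?ge ?ey.
- by apply/rowP => k; rewrite /y !mxE; ring.
all: ring.
Qed.

End Bilinear.

(** * Hyperbolic frames *)

Section Elementary.
Variables (B : comNzRingType) (N : nat) (S : hspace B N).
Hypothesis axS : space_axioms S.
Local Notation "<| x , y |>" := (bil S x y).
Implicit Types (x y z u v w : 'rV[B]_N).

Lemma EOgen_inv g : EOgen S g -> exists2 g', EOm S g' & g *m g' = 1%:M.
Proof.
case=> x [z [lx Qz ->]]; exists (eich S x (- z)).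
  by apply: gen_in; exists x, (- z); split=> //; apply: inQ_N.
by apply: (eichN axS); [apply: (lagr_iso axS)|apply: (bil_lagrQ axS)].
Qed.

Lemma EOm_inv g : EOm S g -> exists2 g', EOm S g' & g *m g' = 1%:M.
Proof. exact/gen_inv/EOgen_inv. Qed.

Lemma EOm_inverse g g' : EOm S g -> g *m g' = 1%:M -> EOm S g'.
Proof. by move=> /EOm_inv[h Eh e] /(inv_uniq e) <-. Qed.

Lemma isom1 : isom S 1%:M.
Proof. by split=> [x y|x|]; rewrite ?mulmx1. Qed.

Lemma isomM g h : isom S g -> isom S h -> isom S (g *m h).
Proof.
move=> [g1 g2 g3] [h1 h2 h3]; split=> [x y|x Mx|].
- by rewrite !mulmxA h1 g1.
- by rewrite mulmxA; apply/h2/g2.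
- by rewrite mulmxA g3 h3.
Qed.

Lemma isom_inv g g' : isom S g -> g *m g' = 1%:M -> isom S g'.
Proof.
move=> [g1 g2 g3] e; have e' := mulmx1C e.
have cM : (1%:M - prM S) *m g' = 1%:M - prM S.
  by rewrite -{1}g3 -mulmxA e mulmx1.
split=> // [x y|x Mx]; first by rewrite -g1 -!mulmxA e' !mulmx1.
have : inM S (x *m g' *m prM S *m g).
  by apply: g2; rewrite /inM -mulmxA (prMM axS).
rewrite /inM => h.
have e1 : x *m g' *m (1%:M - prM S) = x - x *m g' *m prM S *m g.
  by rewrite -{1}g3 mulmxA mulmxBr mulmx1 mulmxBl -(mulmxA x g' g) e' mulmx1.
have e2 : x *m g' *m (1%:M - prM S) *m prM S = 0.
  by rewrite -mulmxA mulmxBl mul1mx (prMM axS) subrr mulmx0.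
have : x *m g' *m (1%:M - prM S) = 0.
  by rewrite -e2 e1 mulmxBl h Mx.
by rewrite mulmxBr mulmx1 => /subr0_eq.
Qed.

Lemma EOgen_isom g : EOgen S g -> isom S g.
Proof.
case=> x [z [lx Qz ->]]; apply: (eich_isom axS).
- exact: (lagr_inM axS).
- exact: (inQ_inM axS).
- exact: (lagr_iso axS).
- exact: (bil_lagrQ axS).
Qed.

Lemma EOm_isom g : EOm S g -> isom S g.
Proof.
by elim=> [|g1 g2 Gg1 _ IH]; [apply: isom1|apply: isomM => //; apply: EOgen_isom].
Qed.

(** A commutator of two transvections with vectors in Q is a transvection in the
plane of u and u'; it produces the long generators from the short ones. *)
Lemma eich_comm u u' z w :
  <|u, u|> = 0 -> <|u', u'|> = 0 -> <|u', u|> = 0 ->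
  <|u, z|> = 0 -> <|u, w|> = 0 -> <|u', z|> = 0 -> <|u', w|> = 0 ->
  eich S u' (- (<|z, w|> *: u)) =
    eich S u' (- z) *m (eich S u (- w) *m eich S u' z *m eich S u w).
Proof.
move=> uu u'u' u'u uz uw u'z u'w.
rewrite (eich_conj_eich axS) // !mul_eich u'u u'w (bilC axS z u) uz.
rewrite !(mulr0, scale0r, subr0, addr0) (eichD axS) ?bilE ?u'z ?u'u //; try ring.
by rewrite addrA addNr add0r.
Qed.

(** Additivity in the isotropic vector, up to the transvection in the plane of
u and u' caused by the quadratic term. *)
Lemma eich_sum u u' z :
  <|u, u|> = 0 -> <|u', u'|> = 0 -> <|u', u|> = 0 ->
  <|u, z|> = 0 -> <|u', z|> = 0 ->
  eich S (u + u') z =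
    eich S u z *m eich S u' z *m eich S u' (- (<|z, hf S *: z|> *: u)).
Proof.
move=> uu u'u' u'u uz u'z; apply: mx_ext => x; rewrite !mulmxA !mul_eich.
rewrite !bilE uu u'u' u'u (bilC axS u u') u'u (bilC axS z u) uz (bilC axS z u') u'z.
apply/rowP => j; rewrite !mxE.
apply: (hf_eq axS (t := - (<|x, u|> * <|z, z|> * u' 0 j))); ring.
Qed.

End Elementary.

Definition opp_ix m (a : 'I_m * bool) := (a.1, ~~ a.2).

(** Dual bases [fr (i, true)] of P and [fr (i, false)] of D, at least two
hyperbolic planes, and a vector u of Q with
<u,u> a unit.  The second plane and the
unit vector are what the generation and transitivity arguments below use. *)
Record frame (B : comNzRingType) N (S : hspace B N) m
    (fr : 'I_m * bool -> 'rV[B]_N) (u : 'rV[B]_N) (c : B) : Prop := Frame {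
  fr_bil : forall a b, bil S (fr a) (fr b) = (b == opp_ix a)%:R;
  fr_P : forall i, fr (i, true) *m prP S = fr (i, true);
  fr_D : forall i, fr (i, false) *m prD S = fr (i, false);
  fr_spanP : forall x, x *m prP S = \sum_i bil S x (fr (i, false)) *: fr (i, true);
  fr_spanD : forall x, x *m prD S = \sum_i bil S x (fr (i, true)) *: fr (i, false);
  fr_unitQ : inQ S u;
  fr_unit : bil S u u * c = 1;
  fr_m : (1 < m)%N
}.

Definition FEgen (B : comNzRingType) N (S : hspace B N) m
    (fr : 'I_m * bool -> 'rV[B]_N) (g : 'M[B]_N) : Prop :=
  exists a z, inQ S z /\ g = eich S (fr a) z.

Section Frame.
Variables (B : comNzRingType) (N : nat) (S : hspace B N).
Hypothesis axS : space_axioms S.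
Variables (m : nat) (fr : 'I_m * bool -> 'rV[B]_N) (u0 : 'rV[B]_N) (c0 : B).
Hypothesis frS : frame S fr u0 c0.
Local Notation "<| x , y |>" := (bil S x y).
Implicit Types (x y z u v w : 'rV[B]_N) (a b : 'I_m * bool).
Local Notation FE := (gen (FEgen S fr)).

Lemma fr_lagr a : lagr S (fr a).
Proof. by case: a => i []; [left; apply: (fr_P frS)|right; apply: (fr_D frS)]. Qed.
Lemma fr_iso a : <|fr a, fr a|> = 0.
Proof. exact/(lagr_iso axS)/fr_lagr. Qed.
Lemma fr_orth a b : a.1 != b.1 -> <|fr a, fr b|> = 0.
Proof.
by move=> ab; rewrite (fr_bil frS) /opp_ix -pair_eqE /= eq_sym (negPf ab).
Qed.
Lemma fr_opp a : <|fr a, fr (opp_ix a)|> = 1.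
Proof. by rewrite (fr_bil frS) eqxx. Qed.
Lemma fr_opp' a : <|fr (opp_ix a), fr a|> = 1.
Proof. by rewrite (bilC axS) fr_opp. Qed.
Lemma opp_ixK a : opp_ix (opp_ix a) = a.
Proof. by case: a => i b; rewrite /opp_ix /= negbK. Qed.
Lemma fr_Q a z : inQ S z -> <|fr a, z|> = 0.
Proof. exact/(bil_lagrQ axS)/fr_lagr. Qed.
Lemma Q_fr a z : inQ S z -> <|z, fr a|> = 0.
Proof. by move=> Qz; rewrite (bilC axS) fr_Q. Qed.
Lemma fr_inM a : inM S (fr a).
Proof. exact/(lagr_inM axS)/fr_lagr. Qed.

Lemma other_ix a : exists b : 'I_m * bool, b.1 != a.1.
Proof.
have m1 := fr_m frS; case: a => i b.
have [i0|i0] := eqVneq (i : nat) 0%N.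
  by exists (Ordinal m1, true); rewrite -val_eqE /= i0.
by exists (Ordinal (ltnW m1), true); rewrite -val_eqE /= eq_sym.
Qed.

Lemma FE_EO g : FE g -> EOm S g.
Proof.
apply: gen_sub => h [a [z [Qz ->]]]; apply: gen_in; exists (fr a), z; split=> //.
exact: fr_lagr.
Qed.

Lemma FE_short a z : inQ S z -> FE (eich S (fr a) z).
Proof. by move=> Qz; apply: gen_in; exists a, z. Qed.

(** The unit vector u0 of Q makes <z, u0> an arbitrary scalar, so [eich_comm]
yields every coefficient t. *)
Lemma FE_long a b t : a.1 != b.1 -> FE (eich S (fr a) (t *: fr b)).
Proof.
move=> ab; have Qu := fr_unitQ frS.
pose z := - (t * c0) *: u0.
have -> : t *: fr b = - (<|z, u0|> *: fr b).
  rewrite /z bilZl mulNr scaleNr opprK -mulrA (mulrC c0) (fr_unit frS).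
  by rewrite mulr1.
have Qz : inQ S z by apply: inQ_Z.
rewrite (eich_comm axS) ?fr_iso ?fr_orth ?fr_Q //.
by do !apply: gen_mul; apply: FE_short => //; apply: inQ_N.
Qed.

(** Expand an element of P or D in the frame and apply [eich_sum]; the
correction terms are commutators of transvections already obtained. *)
Lemma EO_FE g : EOm S g -> FE g.
Proof.
apply: gen_sub => h [x [z [lx Qz ->]]].
have K0 : forall z, inQ S z -> FE (eich S 0 z).
  by move=> w _; rewrite -(scale0r (0 : 'rV_N)) eichZ scale0r eich0; apply: gen1.
have KZ t a w : inQ S w -> FE (eich S (t *: fr a) w).
  by move=> Qw; rewrite eichZ; apply/FE_short/inQ_Z.
have KD u u' : <|u, u|> = 0 -> <|u', u'|> = 0 -> <|u', u|> = 0 ->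
    (forall z, inQ S z -> <|u, z|> = 0) -> (forall z, inQ S z -> <|u', z|> = 0) ->
    (forall z, inQ S z -> FE (eich S u z)) ->
    (forall z, inQ S z -> FE (eich S u' z)) ->
    forall z, inQ S z -> FE (eich S (u + u') z).
  move=> uu u'u' u'u uQ u'Q uE u'E w Qw.
  have Qw' : inQ S (hf S *: w) by apply: inQ_Z.
  rewrite (eich_sum axS) ?(uQ _ Qw) ?(u'Q _ Qw) //; apply: gen_mul.
    by apply: gen_mul; auto.
  rewrite (eich_comm axS) ?(uQ _ Qw) ?(u'Q _ Qw) ?(uQ _ Qw') ?(u'Q _ Qw') //.
  by do !apply: gen_mul; auto using inQ_N.
have main s (r : seq 'I_m) (d : 'I_m -> B) :
    let y := \sum_(i <- r) d i *: fr (i, s) in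
    [/\ <|y, y|> = 0, forall i, <|y, fr (i, s)|> = 0,
        forall z, inQ S z -> <|y, z|> = 0 &
        forall z, inQ S z -> FE (eich S y z)].
  elim: r => [|i r /= [IH1 IH2 IH3 IH4]] /=.
    by rewrite big_nil; split=> *; rewrite ?bil0l //; apply: K0.
  rewrite big_cons; move: (\sum_(j <- r) _) IH1 IH2 IH3 IH4 => v IH1 IH2 IH3 IH4.
  have ss j k : <|fr (j, s), fr (k, s)|> = 0.
    by rewrite (fr_bil frS) /opp_ix -pair_eqE /=; case: (s); rewrite andbF.
  split.
  - by rewrite !bilE ss IH1 (bilC axS (fr (i, s)) v) IH2; ring.
  - by move=> j; rewrite !bilE ss IH2; ring.
  - by move=> w Qw; rewrite !bilE fr_Q // IH3 //; ring.
  apply: KD => //.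
  - by rewrite !bilE ss !mulr0.
  - by rewrite !bilE IH2 mulr0.
  - by move=> w Qw; rewrite bilE fr_Q // mulr0.
  - by move=> w; apply: KZ.
case: lx => <-; rewrite ?(fr_spanP frS) ?(fr_spanD frS).
  by have [] := main true (index_enum _) (fun i => <|x, fr (i, false)|>); auto.
by have [] := main false (index_enum _) (fun i => <|x, fr (i, true)|>); auto.
Qed.

Lemma fr_span x : inM S x ->
  x = x *m prQ S + \sum_i <|x, fr (i, false)|> *: fr (i, true)
      + \sum_i <|x, fr (i, true)|> *: fr (i, false).
Proof. by rewrite -(fr_spanP frS) -(fr_spanD frS) -!mulmxDr => ->. Qed.

(** Expand v in the frame: it has no component along the a-th plane, so every
term is a short or a long generator. *)
Lemma FE_perp a v : inM S v -> <|v, fr a|> = 0 -> <|v, fr (opp_ix a)|> = 0 ->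
  FE (eich S (fr a) v).
Proof.
move=> Mv va vb.
pose K w := <|fr a, w|> = 0 /\ FE (eich S (fr a) w).
have K0 : K 0 by split; rewrite ?bil0r ?eich0 //; apply: gen1.
have KD w w' : K w -> K w' -> K (w + w').
  move=> [e1 f1] [e2 f2]; split; first by rewrite bilDr e1 e2 addr0.
  by rewrite -(eichD axS) ?fr_iso //; apply: gen_mul.
have Kterm i s : K (<|v, fr (i, ~~ s)|> *: fr (i, s)).
  have [ia|ia] := eqVneq i a.1.
    suff -> : <|v, fr (i, ~~ s)|> = 0 by rewrite scale0r.
    move: va vb; rewrite ia /opp_ix; case: (a) => j b /=.
    by case: b s => -[].
  split; first by rewrite bilZr fr_orth ?mulr0 // eq_sym.
  by apply: FE_long; rewrite eq_sym.
suff [] : K v by [].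
rewrite (fr_span Mv); apply: (KD); first apply: (KD).
- have Qv : inQ S (v *m prQ S) by rewrite /inQ -mulmxA (prQQ axS).
  by split; [apply: fr_Q|apply: FE_short].
- by elim/big_ind: _ => // i _; apply: (Kterm i true).
- by elim/big_ind: _ => // i _; apply: (Kterm i false).
Qed.

(** Generators of the same group ([FE1_FE], [FE_FE1]) that refer to a single
hyperbolic pair. *)
Definition FE1gen a (g : 'M[B]_N) : Prop :=
  exists b v, [/\ b.1 = a.1, inM S v, <|v, fr a|> = 0,
                  <|v, fr (opp_ix a)|> = 0 & g = eich S (fr b) v].

Lemma ix_cases a b : b.1 = a.1 -> b = a \/ b = opp_ix a.
Proof.
by case: a b => i s [j t] /= ->; case: s t => -[]; [left|right|right|left].
Qed.

Lemma FE1_FE a g : gen (FE1gen a) g -> FE g.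
Proof.
apply: gen_sub => h [b [v [/ix_cases ab Mv va va' ->]]].
by case: ab => ->; apply: FE_perp; rewrite ?opp_ixK.
Qed.

Lemma FE_FE1 a g : FE g -> gen (FE1gen a) g.
Proof.
apply: gen_sub => h [b [z [Qz ->]]].
have Q1 w : inQ S w -> gen (FE1gen a) (eich S (fr a) w).
  move=> Qw; apply: gen_in; exists a, w.
  by split=> //; rewrite ?Q_fr //; apply: (inQ_inM axS).
have [ba|ba] := eqVneq b.1 a.1.
  apply: gen_in; exists b, z.
  by split; rewrite ?Q_fr //; apply: (inQ_inM axS).
have L1 t c : c.1 = a.1 -> gen (FE1gen a) (eich S (fr b) (t *: fr c)).
  move=> ca; rewrite (eich_swap) ?bilE ?fr_iso ?mulr0 // eichZ.
  apply: gen_in; exists c, (t *: (- fr b)); split=> //.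
  - by apply/inM_Z/inM_N/fr_inM.
  - by rewrite !bilE fr_orth // oppr0 mulr0.
  - by rewrite !bilE fr_orth // oppr0 mulr0.
have -> : z = - (1 *: (- z)) by rewrite scale1r opprK.
have Qz' := inQ_N Qz.
rewrite (eich_opp_split axS (e := fr a) (f' := fr (opp_ix a)));
  rewrite ?fr_iso ?fr_opp' ?fr_orth ?Q_fr //.
apply: gen_mul; first apply: gen_mul; first exact: L1.
  apply: gen_mul; first apply: gen_mul; rewrite ?opprK; try exact: Q1.
  apply: gen_in; exists (opp_ix a), (1 *: fr b).
  split=> //; rewrite ?bilE ?fr_orth ?mulr0 //.
  by apply/inM_Z/fr_inM.
by rewrite -scaleNr; apply: L1.
Qed.

(** The set [FE1gen a], which generates the elementary group by
[eich_opp_split], is permuted by an isometry that fixes the a-th pair. *)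
Lemma stab_conj a g g' h : isom S g -> g *m g' = 1%:M ->
  fr a *m g = fr a -> fr (opp_ix a) *m g = fr (opp_ix a) ->
  FE h -> FE (g' *m h *m g).
Proof.
move=> [g1 g2 g3] gg' ga gb /(FE_FE1 a) Eh; apply: (@FE1_FE a).
apply: gen_conj Eh => // k [b [v [ab Mv va va' ->]]].
rewrite (eich_conj _ _ gg' g1); apply: gen_in; exists b, (v *m g); split=> //.
- exact: g2.
- by rewrite -ga g1.
- by rewrite -gb g1.
- by case: (ix_cases ab) => ->; rewrite ?ga ?gb.
Qed.

End Frame.

(** * Change of rings *)

Definition smap (B C : comNzRingType) (f : {rmorphism B -> C}) N
    (S : hspace B N) : hspace C N :=
  HSpace (map_mx f (gram S)) (map_mx f (cogram S)) (map_mx f (prQ S))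
    (map_mx f (prP S)) (map_mx f (prD S)) (f (hf S)).

Lemma hspace_eq (B : comNzRingType) N (S T : hspace B N) :
  gram S = gram T -> cogram S = cogram T -> prQ S = prQ T -> prP S = prP T ->
  prD S = prD T -> hf S = hf T -> S = T.
Proof. by case: S T => ? ? ? ? ? ? [? ? ? ? ? ?] /= -> -> -> -> -> ->. Qed.

Lemma smap_comp (B C D : comNzRingType) (f : {rmorphism B -> C})
    (g : {rmorphism C -> D}) (h : {rmorphism B -> D}) N (S : hspace B N) :
  (forall x, g (f x) = h x) -> smap g (smap f S) = smap h S.
Proof.
by move=> e; apply: hspace_eq => //=; first [exact: e|apply/matrixP => i j; rewrite !mxE].
Qed.

Lemma smap_comp3 (B C D E : comNzRingType) (f : {rmorphism B -> C})
    (g : {rmorphism C -> D}) (h : {rmorphism D -> E}) (k : {rmorphism B -> E})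
    N (S : hspace B N) :
  (forall x, h (g (f x)) = k x) -> smap h (smap g (smap f S)) = smap k S.
Proof.
by move=> e; apply: hspace_eq => //=; first [exact: e|apply/matrixP => i j; rewrite !mxE].
Qed.

(** Quantifier-free form of [isom], needed to transport isometries along a ring
morphism that is not surjective. *)
Lemma isom_mxP (B : comNzRingType) N (S : hspace B N) g :
  space_axioms S ->
  isom S g <-> [/\ g *m gram S *m g^T = gram S, prM S *m g *m prM S = prM S *m g
                & (1%:M - prM S) *m g = 1%:M - prM S].
Proof.
move=> axS; split=> [[g1 g2 g3]|[g1 g2 g3]]; split=> //.
- apply: mx_ext => x; apply: trmx_inj; apply: mx_ext => y; apply/matrixP => i j.
  have := g1 x y; rewrite /bil !trmx_mul (gram_sym axS) trmxK !mulmxA => e.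
  rewrite !ord1.
  have -> : (y *m g *m gram S *m g^T *m x^T) 0 0 = bil S (y *m g) (x *m g).
    by rewrite /bil trmx_mul !mulmxA.
  by rewrite g1.
- apply: mx_ext => x; rewrite !mulmxA; apply: g2.
  by rewrite /inM -mulmxA (prMM axS).
- by move=> x y; rewrite /bil trmx_mul !mulmxA -(mulmxA x g) -(mulmxA x) g1.
- by move=> x <-; rewrite /inM -!mulmxA (mulmxA (prM S)) g2.
Qed.

Section Smap.
Variables (B C : comNzRingType) (f : {rmorphism B -> C}) (N : nat).
Variable S : hspace B N.

Lemma prM_map : prM (smap f S) = map_mx f (prM S).
Proof. by rewrite /prM !map_mxD. Qed.

Lemma smap_axioms : space_axioms S -> space_axioms (smap f S).
Proof.
case=> h1 h2 h3 h4 h5 h6 h7 h8 h9 h10 h11 h12 h13 h14 h15.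
split; rewrite ?prM_map /= ?map_trmx -?map_mxM ?h1 ?h2 ?h4 ?h5 ?h6 ?h7 ?h8
  ?h9 ?h10 ?h11 ?h12 ?h13 ?h14 ?h15 ?map_mx0 //.
by rewrite -(rmorph_nat f 2) -rmorphM h3 rmorph1.
Qed.

Lemma bil_map x y : bil (smap f S) (map_mx f x) (map_mx f y) = f (bil S x y).
Proof. by rewrite /bil /= map_trmx -!map_mxM mxE. Qed.

Lemma eich_map u v :
  map_mx f (eich S u v) = eich (smap f S) (map_mx f u) (map_mx f v).
Proof.
rewrite /eich bil_map /= !map_trmx -!map_mxM -rmorphM -map_mxZ.
by rewrite !(map_mxB, map_mxD) map_mx1.
Qed.

Lemma inQ_map z : inQ S z -> inQ (smap f S) (map_mx f z).
Proof. by rewrite /inQ /= -map_mxM => ->. Qed.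
Lemma lagr_map z : lagr S z -> lagr (smap f S) (map_mx f z).
Proof. by rewrite /lagr /= -!map_mxM; case=> ->; [left|right]. Qed.

Lemma EOm_map g : EOm S g -> EOm (smap f S) (map_mx f g).
Proof.
apply: gen_map => h [x [z [lx Qz ->]]]; apply: gen_in; rewrite eich_map.
by exists (map_mx f x), (map_mx f z); split=> //; [apply: lagr_map|apply: inQ_map].
Qed.

Lemma isom_map g : space_axioms S -> isom S g -> isom (smap f S) (map_mx f g).
Proof.
move=> axS /(isom_mxP _ axS)[g1 g2 g3].
apply/(isom_mxP _ (smap_axioms axS)); rewrite prM_map /=.
rewrite -(map_mx1 f) map_trmx -map_mxB -!map_mxM.
by split; congr (map_mx f _).
Qed.

(** The expansion is the matrix identity pr = sum of gram * F_i^T * G_i. *)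
Lemma spans_map (pr : 'M[B]_N) k (F G : 'I_k -> 'rV[B]_N) :
  (forall x, x *m pr = \sum_i bil S x (F i) *: G i) ->
  forall x, x *m map_mx f pr =
    \sum_i bil (smap f S) x (map_mx f (F i)) *: map_mx f (G i).
Proof.
move=> h x.
have -> : pr = \sum_i gram S *m (F i)^T *m G i.
  apply: mx_ext => y; rewrite h mulmx_sumr; apply: eq_bigr => i _.
  by rewrite !mulmxA bil_mx mul_scalar_mx.
rewrite raddf_sum mulmx_sumr; apply: eq_bigr => i _.
by rewrite /= !map_mxM -map_trmx !mulmxA (bil_mx (smap f S)) mul_scalar_mx.
Qed.

Lemma frame_map m (fr : 'I_m * bool -> 'rV[B]_N) u c : frame S fr u c ->
  frame (smap f S) (fun a => map_mx f (fr a)) (map_mx f u) (f c).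
Proof.
case=> h1 h2 h3 h4 h5 h6 h7 h8; split=> //.
- by move=> a b; rewrite bil_map h1 rmorph_nat.
- by move=> i; rewrite /= -map_mxM h2.
- by move=> i; rewrite /= -map_mxM h3.
- exact: (spans_map h4).
- exact: (spans_map h5).
- exact: inQ_map.
- by rewrite bil_map -rmorphM h7 rmorph1.
Qed.

End Smap.

(** * Clearing denominators *)

(** The properties of a localization that permit descent from L to A; unlike the
universal property they pass at once to polynomial rings. *)
Record localizing (A L : comNzRingType) (phi : {rmorphism A -> L})
    (Sg : A -> Prop) : Prop := Localizing {
  lz1 : Sg 1;
  lzM : forall s t, Sg s -> Sg t -> Sg (s * t);
  lz_num : forall x, exists2 s, Sg s & exists a, phi s * x = phi a;
  lz_ker : forall a, phi a = 0 -> exists2 s, Sg s & s * a = 0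
}.

Section Localizing.
Variables (A L : comNzRingType) (phi : {rmorphism A -> L}) (Sg : A -> Prop).
Hypothesis lz : localizing phi Sg.

Lemma lz_num_fam (I : finType) (x : I -> L) :
  exists2 s, Sg s & exists a : I -> A, forall i, phi s * x i = phi (a i).
Proof.
suff [s Ss H] : exists2 s, Sg s & forall i, i \in enum I -> exists a, phi s * x i = phi a.
  exists s => //.
  have /choice[a Ha] : forall i, exists a, phi s * x i = phi a.
    by move=> i; apply: H; rewrite mem_enum.
  by exists a.
elim: (enum I) => [|i r [s Ss H]]; first by exists 1 => //; exact: (lz1 lz).
have [t St [a Ha]] := lz_num lz (x i).
exists (s * t); first exact: (lzM lz).
move=> j; rewrite inE => /orP[/eqP->|/H[b Hb]].
  by exists (s * a); rewrite !rmorphM -Ha mulrA.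
by exists (t * b); rewrite !rmorphM -Hb; ring.
Qed.

Lemma lz_ker_fam (I : finType) (x : I -> A) : (forall i, phi (x i) = 0) ->
  exists2 s, Sg s & forall i, s * x i = 0.
Proof.
move=> x0.
suff [s Ss H] : exists2 s, Sg s & forall i, i \in enum I -> s * x i = 0.
  by exists s => // i; apply: H; rewrite mem_enum.
elim: (enum I) => [|i r [s Ss H]]; first by exists 1 => //; exact: (lz1 lz).
have [t St e] := lz_ker lz (x0 i).
exists (s * t); first exact: (lzM lz).
move=> j; rewrite inE => /orP[/eqP->|/H Hb].
  by rewrite -mulrA e mulr0.
by rewrite mulrAC Hb mul0r.
Qed.

Lemma lz_num_mx m n (M : 'M[L]_(m, n)) :
  exists2 s, Sg s & exists a : 'M[A]_(m, n), phi s *: M = map_mx phi a.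
Proof.
have [s Ss [a Ha]] := lz_num_fam (fun ij : 'I_m * 'I_n => M ij.1 ij.2).
exists s => //; exists (\matrix_(i, j) a (i, j)).
by apply/matrixP => i j; rewrite !mxE -Ha.
Qed.

Lemma lz_ker_mx m n (M : 'M[A]_(m, n)) : map_mx phi M = 0 ->
  exists2 s, Sg s & s *: M = 0.
Proof.
move=> M0; have [|s Ss H] := lz_ker_fam (x := fun ij : 'I_m * 'I_n => M ij.1 ij.2).
  by move=> [i j] /=; move/matrixP/(_ i j): M0; rewrite !mxE.
by exists s => //; apply/matrixP => i j; rewrite !mxE (H (i, j)).
Qed.

Lemma lz_num_poly (p : {poly L}) :
  exists2 s, Sg s & exists a : {poly A}, map_poly phi s%:P * p = map_poly phi a.
Proof.
elim/poly_ind: p => [|p c [s Ss [a Ha]]].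
  by exists 1; [exact: (lz1 lz)|exists 0; rewrite mulr0 rmorph0].
have [t St [b Hb]] := lz_num lz c.
exists (s * t); first exact: (lzM lz).
exists (t%:P * a * 'X + (s * b)%:P).
move: Ha; rewrite !(rmorphD, rmorphM) /= !map_polyC map_polyX /= => <-.
rewrite -Hb rmorphM /=; ring.
Qed.

Definition const_poly (Sg : A -> Prop) (p : {poly A}) : Prop :=
  exists2 s, Sg s & p = s%:P.

(** A polynomial has finitely many coefficients, hence a common denominator. *)
Lemma localizing_poly : localizing (map_poly phi) (const_poly Sg).
Proof.
split.
- by exists 1 => //; exact: (lz1 lz).
- move=> _ _ [s Ss ->] [t St ->]; exists (s * t); first exact: (lzM lz).
  by rewrite rmorphM.
- move=> x; have [s Ss [a Ha]] := lz_num_poly x.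
  by exists s%:P; [exists s|exists a].
- move=> p p0.
  have [|s Ss H] := lz_ker_fam (x := fun i : 'I_(size p) => p`_i).
    by move=> i; rewrite -coef_map p0 coef0.
  exists s%:P; first by exists s.
  apply/polyP => i; rewrite mul_polyC coefZ coef0.
  have [lt_ip|le_pi] := ltnP i (size p); first exact: (H (Ordinal lt_ip)).
  by rewrite nth_default // mulr0.
Qed.

End Localizing.

Section Lattice.
Variables (A L : comNzRingType) (phi : {rmorphism A -> L}) (Sg : A -> Prop).
Hypothesis lz : localizing phi Sg.
Variables (N : nat) (S : hspace A N).
Hypothesis axS : space_axioms S.
Local Notation T := (smap phi S).
Variables (m : nat) (fr : 'I_m * bool -> 'rV[L]_N) (u0 : 'rV[L]_N) (c0 : L).
Hypothesis frT : frame T fr u0 c0.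
Local Notation "<| x , y |>" := (bil T x y).
Local Notation im := (map_mx phi).

Let axT : space_axioms T := smap_axioms phi axS.

(** The frame has denominators over A, so these transvections need not come from
A unless s is divisible enough ([F_image]). *)
Definition Fgen (s : A) (g : 'M[L]_N) : Prop :=
  exists a (z : 'rV[A]_N), inQ S z /\ g = eich T (fr a) (phi s *: im z).
Local Notation F s := (gen (Fgen s)).

Lemma F_short s r a z : inQ S z -> F s (eich T (fr a) (phi (s * r) *: im z)).
Proof.
move=> Qz; apply: gen_in; exists a, (r *: z); split; first exact: inQ_Z.
by rewrite map_mxZ scalerA -rmorphM.
Qed.

Lemma lz_Q z : inQ T z ->
  exists2 s, Sg s & exists2 z', inQ S z' & phi s *: z = im z'.
Proof.
move=> Qz; have [s Ss [a Ha]] := lz_num_mx lz z.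
exists s => //; exists (a *m prQ S); first by rewrite /inQ -mulmxA (prQQ axS).
by rewrite map_mxM -Ha -scalemxAl Qz.
Qed.

(** As in [FE_long], with the denominators of the unit vector and of the inverse
of its length collected in d. *)
Lemma F_long : exists2 d, Sg d & forall s a b r, a.1 != b.1 ->
  F s (eich T (fr a) (phi (s * s * d * r) *: fr b)).
Proof.
have [d1 Sd1 [w Qw Hw]] := lz_Q (fr_unitQ frT).
have [d2 Sd2 [c Hc]] := lz_num lz c0.
exists (d1 * d1 * d2); first by do !apply: (lzM lz).
move=> s a b r ab.
pose z1 := phi s *: im (- (r * c) *: w); pose w1 := phi s *: im w.
have -> : phi (s * s * (d1 * d1 * d2) * r) *: fr b = - (<|z1, w1|> *: fr b).
  rewrite -scaleNr; congr (_ *: _).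
  rewrite /z1 /w1 map_mxZ -Hw !bilE rmorphN !rmorphM -Hc.
  have := fr_unit frT; rewrite -/T => e; ring: e.
have Qz1 : inQ S (- (r * c) *: w) by apply: inQ_Z.
have QT z : inQ S z -> inQ T (phi s *: im z).
  by move=> Qz; apply/inQ_Z/inQ_map.
have Tz1 : inQ T z1 by apply: QT.
have Tw1 : inQ T w1 by apply: QT.
rewrite (eich_comm axT) ?(fr_iso axT frT) ?(fr_orth frT) ?(fr_Q axT frT) //.
by do !apply: gen_mul; apply: gen_in; rewrite -?scalerN -?map_mxN;
  [exists a, (- (- (r * c) *: w))|exists b, (- w)|exists a, (- (r * c) *: w)|exists b, w];
  split=> //; apply: inQ_N.
Qed.

Lemma conjM (g g' x y : 'M[L]_N) : g *m g' = 1%:M ->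
  g' *m (x *m y) *m g = (g' *m x *m g) *m (g' *m y *m g).
Proof. by move=> e; rewrite !mulmxA -(mulmxA (g' *m x) g) e mulmx1. Qed.

(** Conjugation by a fixed elementary generator is continuous for the topology
given by the groups F s: enough divisibility of the argument survives.  The
generators along the vectors off the i-th plane and along fr i itself are direct;
the generator along the opposite of fr i is rewritten by [eich_opp_split] through
another plane k, which is possible as the frame has at least two planes. *)
Lemma F_conj i z0 s : inQ T z0 -> Sg s ->
  exists2 s', Sg s' & forall g, F s' g ->
    F s (eich T (fr i) (- z0) *m g *m eich T (fr i) z0).
Proof.
move=> Qz0 Ss; have [d Sd long] := F_long.
have [s0 Ss0 [z Qz Hz]] := lz_Q Qz0.
pose t := s * s * d * s0 * s0.
have St : Sg t by do !apply: (lzM lz).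
exists (t * t); first exact: (lzM lz).
have iso a : <|fr a, fr a|> = 0 := fr_iso axT frT a.
have frQ a w : inQ T w -> <|fr a, w|> = 0 := @fr_Q _ _ _ axT _ _ _ _ frT a w.
have Qfr a w : inQ T w -> <|w, fr a|> = 0 := @Q_fr _ _ _ axT _ _ _ _ frT a w.
have orth a b : a.1 != b.1 -> <|fr a, fr b|> = 0 := @fr_orth _ _ _ _ _ _ _ frT a b.
have QT w : inQ S w -> inQ T (im w) := @inQ_map _ _ phi _ S w.
have Ei : eich T (fr i) z0 *m eich T (fr i) (- z0) = 1%:M.
  by apply: (eichN axT); rewrite ?iso ?frQ.
set E := eich T (fr i) z0 in Ei *; set E' := eich T (fr i) (- z0) in Ei *.
have conjE v w : E' *m eich T v w *m E = eich T (v *m E) (w *m E).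
  by apply: (eich_conj_eich axT); rewrite ?iso ?frQ.
have frE k : k.1 != i.1 -> fr k *m E = fr k.
  by move=> ki; rewrite mul_eich orth // frQ // mulr0 !scale0r addr0 !subr0.
have QE w : inQ T w -> w *m E = w - <|w, z0|> *: fr i.
  by move=> Qw; rewrite mul_eich Qfr // mulr0 !scale0r addr0 subr0.
have z0E w : phi s0 * <|im w, z0|> = phi (bil S w z).
  by rewrite -bilZr Hz bil_map.
have qE : phi s0 * phi s0 * (phi (hf S) * <|z0, z0|>) = phi (hf S * bil S z z).
  rewrite rmorphM -bil_map -Hz !bilE; ring.
move: (hf S * bil S z z) qE => kap qE.
(* The generators along a vector off the i-th plane: conjugation only changes
   the vector of Q, by a multiple of fr i. *)
have short k w r : k.1 != i.1 -> inQ S w ->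
    F s (E' *m eich T (fr k) (phi (t * r) *: im w) *m E).
  move=> ki Qw; rewrite conjE frE // QE; last exact/inQ_Z/QT.
  rewrite -(eichD axT) ?bilE ?iso ?orth ?frQ ?mulr0 ?oppr0 //; last exact: QT.
  apply: gen_mul.
    have -> : t * r = s * (s * d * s0 * s0 * r) by rewrite /t; ring.
    exact: F_short.
  have -> : - (phi (t * r) * <|im w, z0|> *: fr i) =
     phi (s * s * d * (- (s0 * r * bil S w z))) *: fr i.
    by rewrite -scaleNr /t; congr (_ *: _); rewrite !rmorphM rmorphN !rmorphM -z0E; ring.
  exact: long.
(* The long generators that involve the opposite of fr i: conjugation turns that
   vector into y, which is expanded again along fr j, Q and fr i. *)
have longE j k r : j = opp_ix i -> k.1 != i.1 ->
    F s (E' *m eich T (fr j) (phi (t * r) *: fr k) *m E).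
  move=> ji ki; have jk : j.1 != k.1 by rewrite ji eq_sym.
  have fji : <|fr j, fr i|> = 1 by rewrite ji (fr_opp' axT frT).
  rewrite conjE -scalemxAl (frE k) // mul_eich fji frQ // mulr1 scale1r scale0r subr0.
  set y := fr j + z0 - _.
  have yy : <|y, y|> = 0.
    rewrite /y !bilE !iso !(Qfr _ _ Qz0) !(frQ _ _ Qz0) (bilC axT (fr i) (fr j)) fji.
    apply: (hf_eq axT (t := - <|z0, z0|>)); ring.
  rewrite eich_swap // ?eichZ; last by rewrite bilZl bilZr iso !mulr0.
  have -> : phi (t * r) *: - y = phi (s * s * d * (- (s0 * s0 * r))) *: fr j
     + phi (s * (- (s * d * s0 * r))) *: im z
     + phi (s * s * d * (r * kap)) *: fr i.
    have -> : phi (s * (- (s * d * s0 * r))) *: im z =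
              phi (- (s * s * d * s0 * s0 * r)) *: z0.
      by rewrite -Hz scalerA -rmorphM; congr (phi _ *: _); ring.
    have -> : phi (s * s * d * (r * kap)) =
      phi (t * r) * (phi (hf S) * <|z0, z0|>).
      rewrite /t !rmorphM -qE; ring.
    rewrite /y /t /=; apply/rowP => l; rewrite !mxE !rmorphM !rmorphN !rmorphM; ring.
  have kk : <|fr k, fr j|> = 0 by rewrite orth // eq_sym.
  rewrite -(eichD axT) ?bilE ?iso ?kk ?orth ?frQ ?mulr0 ?addr0 //; last exact: QT.
  rewrite -(eichD axT) ?bilE ?iso ?kk ?orth ?frQ ?mulr0 ?addr0 //; last exact: QT.
  apply: gen_mul; first apply: gen_mul; first by apply: long; rewrite eq_sym.
    exact: F_short.
  exact: long.
move=> g; apply: gen_conj => // h [j [w [Qw ->]]].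
have [ji|ji] := eqVneq j.1 i.1; last exact: short.
have [ji'|ji'] := ix_cases ji.
  rewrite conjE ji' mul_eich iso frQ // mulr0 !scale0r addr0 !subr0.
  rewrite QE; last exact/inQ_Z/QT.
  rewrite -(eichD axT) ?bilE ?iso ?frQ ?mulr0 ?oppr0 //; last exact: QT.
  apply: gen_mul; last first.
    rewrite -scaleNr -eichZ.
    suff -> : forall c, eich T (c *: fr i) (fr i) = 1%:M by apply: gen1.
    move=> c; apply: mx_ext => x; rewrite mul_eich mulmx1 !bilE iso.
    by apply/rowP => l; rewrite !mxE; ring.
  have -> : t * t = s * (s * d * s0 * s0 * t) by rewrite {1}/t; ring.
  exact: F_short.
have [k ki] := other_ix frT i.
have kj : k.1 != j.1 by rewrite ji.
pose v := phi (- t) *: im w.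
have Qv : inQ T v by apply/inQ_Z/QT.
have -> : phi (t * t) *: im w = - (phi t *: v).
  by rewrite /v scalerA -scaleNr -rmorphM -rmorphN; congr (phi _ *: _); ring.
have jk : j.1 != k.1 by rewrite eq_sym.
rewrite (eich_opp_split axT (e := fr k) (f' := fr (opp_ix k)));
  rewrite ?iso ?(fr_opp' axT frT) ?orth ?Qfr //.
have sw : eich T (fr (opp_ix k)) (phi t *: fr j) =
          eich T (fr j) (phi (t * (-1)) *: fr (opp_ix k)).
  rewrite eich_swap ?iso ?bilE ?iso ?mulr0 // eichZ; congr (eich _ _ _).
  by rewrite mulrN1 rmorphN scaleNr scalerN.
have long1 r k' : k'.1 = k.1 -> F s (E' *m eich T (fr j) (phi (t * r) *: fr k') *m E).
  by move=> e; apply: longE => //; rewrite e.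
rewrite !(conjM _ _ Ei) sw; apply: gen_mul;
  [apply: gen_mul; [|apply: gen_mul; [apply: gen_mul|]]|].
- by rewrite -(mulr1 t); apply: long1.
- rewrite /v -scaleNr -rmorphN opprK -(mulr1 t); exact: short.
- exact: long1.
- by rewrite /v -mulrN1; apply: short.
have -> : - ((phi t * (hf T * <|v, v|>)) *: fr k) =
   phi (t * (- (hf S * bil S (t *: w) (t *: w)))) *: fr k.
  rewrite -scaleNr; congr (_ *: _); rewrite /v !bilE !rmorphM !rmorphN !rmorphM.
  rewrite -bil_map /=; ring.
exact: long1.
Qed.

(** Take d to clear the denominators of the frame and move it from the vector of
Q to the isotropic vector. *)
Lemma F_image : exists2 d, Sg d & forall g, F d g ->
  exists2 h, EOm S h & g = im h.
Proof.
have [d Sd [x Hx]] := lz_num_fam lz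
  (fun c : ('I_m * bool) * 'I_N => fr c.1 0 c.2).
exists d => // g.
elim=> [|g1 g2 [a [z [Qz ->]]] _ [h Eh ->]].
  by exists 1%:M; [apply: gen1|rewrite map_mx1].
pose y := \row_j x (a, j).
have Hy : phi d *: fr a = im y by apply/rowP => j; rewrite !mxE -(Hx (a, j)).
pose y' := if a.2 then y *m prP S else y *m prD S.
have ly' : lagr S y'.
  rewrite /y' /lagr; case: ifP => _; [left|right];
  by rewrite -mulmxA ?(prPP axS) ?(prDD axS).
have {}Hy : phi d *: fr a = im y'.
  rewrite /y'; case: (a) Hy => i [] /= Hy; rewrite map_mxM -Hy -scalemxAl.
    by rewrite (fr_P frT).
  by rewrite (fr_D frT).
exists (eich S y' z *m h).
  by apply: genM => //; exists y', z.
by rewrite map_mxM eich_map -eichZ Hy.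
Qed.

End Lattice.

(** * Dilation of a polynomial matrix *)

(** Substitution as a ring morphism, so that it applies to matrices with
[map_mx]; in particular [psub 0] is reduction modulo 'X, with values in the
constant polynomials. *)
Definition psub (B : comNzRingType) (c : {poly B}) : {rmorphism {poly B} -> {poly B}} :=
  comp_poly c.

Section Psub.
Variable B : comNzRingType.
Implicit Types (c : {poly B}).

Lemma psubC c b : psub c b%:P = b%:P.
Proof. exact: comp_polyC. Qed.
Lemma psubX c : psub c 'X = c.
Proof. exact: comp_polyX. Qed.

Lemma psub_const m n c (M : 'M[B]_(m, n)) :
  map_mx (psub c) (map_mx polyC M) = map_mx polyC M.
Proof. by apply/matrixP => i j; rewrite !mxE psubC. Qed.

Lemma smap_psub N c (S : hspace B N) :
  smap (psub c) (smap polyC S) = smap polyC S.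
Proof. by apply: smap_comp => x; rewrite psubC. Qed.

Lemma psub_psub c d p : psub c (psub d p) = psub (psub c d) p.
Proof. by rewrite /psub /= comp_polyA. Qed.

Lemma map_psub_psub m n c d (M : 'M[{poly B}]_(m, n)) :
  map_mx (psub c) (map_mx (psub d) M) = map_mx (psub (psub c d)) M.
Proof. by apply/matrixP => i j; rewrite !mxE psub_psub. Qed.

Lemma poly_split (p : {poly B}) : exists p1, p = p1 * 'X + psub 0 p.
Proof.
exists (drop_poly 1 p); rewrite /psub /= comp_poly0r.
by rewrite -{1}(poly_take_drop 1 p) addrC expr1; congr (_ + _);
  apply/polyP => i; rewrite coef_take_poly coefC; case: i.
Qed.

Lemma mx_poly_split m n (M : 'M[{poly B}]_(m, n)) :
  exists M1, M = 'X *: M1 + map_mx (psub 0) M.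
Proof.
have /choice[f Hf] : forall ij : 'I_m * 'I_n,
    exists p1, M ij.1 ij.2 = p1 * 'X + psub 0 (M ij.1 ij.2).
  by move=> ij; apply: poly_split.
exists (\matrix_(i, j) f (i, j)); apply/matrixP => i j.
by rewrite !mxE {1}(Hf (i, j)) mulrC.
Qed.

Lemma mulX_eq0 (p : {poly B}) : 'X * p = 0 -> p = 0.
Proof.
by move=> e; apply/polyP => i; have := coefXM p i.+1; rewrite e !coef0 /= => <-.
Qed.

End Psub.

Section Dilation.
Variables (A L : comNzRingType) (phi : {rmorphism A -> L}) (Sg : A -> Prop).
Hypothesis lz : localizing phi Sg.
Variables (N : nat) (S : hspace A N).
Hypothesis axS : space_axioms S.
Local Notation T := (smap phi S).
Variables (m : nat) (fr : 'I_m * bool -> 'rV[L]_N) (u0 : 'rV[L]_N) (c0 : L).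
Hypothesis frT : frame T fr u0 c0.
Local Notation phiX := (map_poly phi).
Local Notation S' := (smap (@polyC A) S).
Local Notation T' := (smap (@polyC L) T).
Local Notation fr' := (fun a => map_mx (@polyC L) (fr a)).

Lemma smap_phiX : smap phiX S' = T'.
Proof.
rewrite (@smap_comp _ _ _ polyC phiX (@polyC L \o phi)) => [|x /=]; last first.
  by rewrite map_polyC.
by rewrite -(@smap_comp _ _ _ phi polyC (@polyC L \o phi)).
Qed.

Let lzX := localizing_poly lz.
Let axS' : space_axioms S' := smap_axioms _ axS.
Let frT' : frame (smap phiX S') fr' (map_mx polyC u0) (c0%:P).
Proof. by rewrite smap_phiX; apply: frame_map. Qed.
Local Notation F s := (gen (Fgen phiX S' fr' s%:P)).

Lemma phi_psub c p : phiX (psub c p) = psub (phiX c) (phiX p).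
Proof. by rewrite /psub /= map_comp_poly. Qed.

Lemma map_phi_psub m' n' c (M : 'M_(m', n')) :
  map_mx phiX (map_mx (psub c) M) = map_mx (psub (phiX c)) (map_mx phiX M).
Proof. by apply/matrixP => i j; rewrite !mxE phi_psub. Qed.

(** A word g(U) over L[U], evaluated at s' r U and multiplied by g(0)^-1, becomes
a product of transvections with vectors divisible by s.  By induction on the
word: the constant term of the first letter is conjugated past the rest of the
word at the cost of more divisibility ([F_conj]), and the rest of that letter is
a multiple of s' U. *)
Lemma subst_step g : gen (FEgen T' fr') g ->
  forall s h, Sg s -> map_mx (psub 0) g *m h = 1%:M ->
  exists2 s', Sg s' & forall r,
    F s (map_mx (psub ((phi (s' * r))%:P * 'X)) g *m h).
Proof.
have axT' : space_axioms T' by do 2!apply: smap_axioms.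
have frT2 : frame T' fr' (map_mx polyC u0) (c0%:P) by apply: frame_map.
have smT c : smap (psub c) T' = T' by apply: smap_psub.
elim=> [|e g1 [a [z [Qz ->]]] _ IH] s h Ss.
  rewrite map_mx1 mul1mx => ->; exists 1; first exact: (lz1 lz).
  by move=> r; rewrite map_mx1 mulmx1; apply: gen1.
have Qc c : inQ T' (map_mx (psub c) z).
  by have := inQ_map (psub c) Qz; rewrite smT.
have Ec c : map_mx (psub c) (eich T' (fr' a) z) = eich T' (fr' a) (map_mx (psub c) z).
  by rewrite eich_map smT psub_const.
rewrite map_mxM Ec -mulmxA => e1.
have := mulmx1C e1; rewrite -mulmxA => /IH{}IH.
have Qz0 : inQ T' (- map_mx (psub 0) z) by apply: inQ_N.
have Sgs : const_poly Sg s%:P by exists s.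
have Qz0' : inQ (smap phiX S') (- map_mx (psub 0) z) by rewrite smap_phiX.
have [s1 Ss1 conj] := F_conj lzX axS' frT' a Qz0' Sgs.
case: Ss1 conj => [{}s1 Ss1 ->] conj.
have [s2 Ss2 H] := IH _ Ss1.
have [M1 HM1] := mx_poly_split z.
have [_ [d Sd ->] [M2 HM2]] := lz_num_mx lzX M1.
exists (s2 * (d * s)); first by do !apply: (lzM lz).
move=> r; rewrite map_mxM Ec.
set c := _ * 'X; set E := eich _ _ _; set E0 := eich T' (fr' a) (map_mx (psub 0) z) in e1 *.
have isoz w : inQ T' w -> bil T' (fr' a) w = 0 by apply: (fr_Q axT' frT2).
have E0V : E0 *m eich T' (fr' a) (- map_mx (psub 0) z) = 1%:M.
  by apply: (eichN axT'); [apply: (fr_iso axT' frT2)|apply: isoz].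
set E0' := eich T' (fr' a) (- _) in E0V.
have hE : h = h *m E0 *m E0' by rewrite -mulmxA E0V mulmx1.
have -> : E *m map_mx (psub c) g1 *m h =
    (E *m E0') *m (E0 *m (map_mx (psub c) g1 *m (h *m E0)) *m E0').
  rewrite !mulmxA -(mulmxA E E0' E0) (mulmx1C E0V) mulmx1.
  by rewrite -(mulmxA _ E0 E0') E0V mulmx1.
apply: gen_mul; last first.
  move: conj; rewrite smap_phiX opprK; apply.
  by have := H (d * s * r); rewrite mulrA.
rewrite /E /E0' (eichD axT') ?(fr_iso axT' frT2) ?isoz //.
have dz : map_mx (psub c) z - map_mx (psub 0) z =
    phiX s%:P *: map_mx phiX (((r * s2)%:P * 'X *: map_mx (psub ((s2 * (d * s) * r)%:P * 'X)) M2)).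
  rewrite map_mxZ map_phi_psub -HM2.
  have -> : phiX ((s2 * (d * s) * r)%:P * 'X) = c.
    by rewrite rmorphM /= map_polyC map_polyX.
  have -> : map_mx (psub c) z = c *: map_mx (psub c) M1 + map_mx (psub 0) z.
    rewrite {1}HM1 map_mxD map_mxZ psubX map_psub_psub.
    by rewrite rmorph0.
  rewrite addrK map_mxZ /= !map_polyC /= psubC !scalerA; congr (_ *: _).
  rewrite rmorphM /= !map_polyC map_polyX /= /c !rmorphM /=; ring.
have Qd : inQ T' (map_mx (psub c) z - map_mx (psub 0) z).
  by apply: inQ_D => //; apply: inQ_N.
rewrite -Qd dz -scalemxAl -[prQ T']/(prQ (smap polyC (smap phi S))) -smap_phiX.
rewrite -[prQ (smap phiX S')]/(map_mx phiX (prQ S')) -map_mxM.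
apply: gen_in; exists a; eexists; split; last reflexivity.
by rewrite /inQ -mulmxA (prQQ axS').
Qed.

(** Over L[U] the matrix tau(s'U) is the image of an elementary matrix th over
A[U] ([subst_step], [F_image]).  After division by its constant term, th and
tau(s'U) agree at U = 0 and over L[U]; their difference is U times a matrix killed
by some s2, so the substitution of s2 U makes them equal. *)
Lemma dilation (tau : 'M[{poly A}]_N) :
  map_mx (psub 0) tau = 1%:M -> EOm T' (map_mx phiX tau) ->
  exists2 s, Sg s & EOm S' (map_mx (psub (s%:P * 'X)) tau).
Proof.
move=> tau0 Etau.
have axT' : space_axioms T' by do 2!apply: smap_axioms.
have frT2 : frame T' fr' (map_mx polyC u0) (c0%:P) by apply: frame_map.
have [_ [s Ss ->] image] := F_image lzX axS' frT'.
have tauL0 : map_mx (psub 0) (map_mx phiX tau) = 1%:M.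
  by rewrite -[0](rmorph0 phiX) -map_phi_psub tau0 map_mx1.
have [|s' Ss' H] := subst_step (EO_FE axT' frT2 Etau) (h := 1%:M) Ss.
  by rewrite mulmx1.
have [th Eth Hth] := image _ (H 1); rewrite mulmx1 mulr1 in Hth.
have {}Hth : map_mx phiX th = map_mx phiX (map_mx (psub (s'%:P * 'X)) tau).
  by rewrite -Hth map_phi_psub rmorphM /= map_polyC map_polyX.
have Eth0 : EOm S' (map_mx (psub 0) th).
  by have := EOm_map (psub 0) Eth; rewrite smap_psub.
have [thV EthV HthV] := EOm_inv axS' Eth0.
have th0L : map_mx phiX (map_mx (psub 0) th) = 1%:M.
  rewrite map_phi_psub Hth -map_phi_psub map_psub_psub.
  have -> : map_mx (psub (psub 0 (s'%:P * 'X))) tau = map_mx (psub 0) tau.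
    by rewrite rmorphM /= psubX mulr0.
  by rewrite tau0 map_mx1.
have thVL : map_mx phiX thV = 1%:M.
  by rewrite -[LHS]mul1mx -th0L -map_mxM HthV map_mx1.
pose th1 := th *m thV.
have Eth1 : EOm S' th1 by apply: gen_mul.
have thV0 : map_mx (psub 0) thV = thV.
  apply: (inv_uniq _ HthV); rewrite -{1}[th]/(th).
  have -> : map_mx (psub 0) th = map_mx (psub 0) (map_mx (psub 0) th).
    by rewrite map_psub_psub rmorph0.
  by rewrite -map_mxM HthV map_mx1.
pose del := map_mx (psub (s'%:P * 'X)) tau - th1.
have del0 : map_mx (psub 0) del = 0.
  rewrite map_mxB map_mxM thV0 HthV map_psub_psub rmorphM /= psubX mulr0 tau0.
  by rewrite subrr.
have delL : map_mx phiX del = 0.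
  by rewrite map_mxB map_mxM thVL mulmx1 Hth subrr.
have [_ [s2 Ss2 ->] Hs2] := lz_ker_mx lzX delL.
have delS : map_mx (psub (s2%:P * 'X)) del = 0.
  have [D HD] := mx_poly_split del; rewrite del0 addr0 in HD.
  have D0 : s2%:P *: D = 0.
    move: Hs2; rewrite HD scalerA mulrC -scalerA => e.
    apply/matrixP => i j; move/matrixP/(_ i j): e; rewrite !mxE.
    exact: mulX_eq0.
  rewrite HD map_mxZ psubX [X in X *: _]mulrC -scalerA.
  have -> : s2%:P *: map_mx (psub (s2%:P * 'X)) D =
            map_mx (psub (s2%:P * 'X)) (s2%:P *: D).
    by rewrite map_mxZ psubC.
  by rewrite D0 map_mx0 scaler0.
exists (s' * s2); first exact: (lzM lz).
have -> : map_mx (psub ((s' * s2)%:P * 'X)) tau = map_mx (psub (s2%:P * 'X)) th1.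
  have /eqP := delS; rewrite map_mxB subr_eq0 map_psub_psub => /eqP <-.
  have -> : psub (s2%:P * 'X) (s'%:P * 'X) = (s' * s2)%:P * 'X.
    by rewrite rmorphM /= psubX psubC mulrA -polyCM.
  by [].
by have := EOm_map (psub (s2%:P * 'X)) Eth1; rewrite smap_psub.
Qed.

End Dilation.

(** * The local-global principle *)

Section Maximal.
Variable A : comNzRingType.

(** The type of ideals only has proper ideals, whence the hypothesis on 1. *)
Lemma idealr_of (I : A -> Prop) :
  I 0 -> ~ I 1 -> (forall a x y, I x -> I y -> I (a * x + y)) ->
  exists J : idealr A, forall x, x \in J <-> I x.
Proof.
move=> I0 I1 Ilin; pose J : {pred A} := fun x => `[< I x >].
have inJ x : x \in J <-> I x by split => [/asboolP|/asboolP].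
have Jid : idealr_closed J.
  split; first exact/inJ.
    by apply/negP => /inJ.
  by move=> a x y /inJ Ix /inJ Iy; apply/inJ/Ilin.
pose J' : idealr A := HB.pack J (isIdealr.Build A J Jid).
by exists J'.
Qed.

(** Zorn's lemma is applied to the sets X for which the union of I and X is a
proper ideal, so that the empty chain is harmless. *)
Lemma maximal_exists (I : A -> Prop) :
  I 0 -> ~ I 1 -> (forall a x y, I x -> I y -> I (a * x + y)) ->
  exists2 m : idealr A, maximal_ideal m & forall x, I x -> x \in m.
Proof.
move=> I0 I1 Ilin.
pose P (X : set A) := exists J : idealr A, forall x, x \in J <-> I x \/ X x.
have [|X [[m Hm] Xmax]] := @Zorn_bigcup A P.
  move=> F FP Ftot.
  have [[X1 FX1]|noF] := pselect (exists X, F X); last first.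
    have [J HJ] := idealr_of I0 I1 Ilin; exists J => x.
    rewrite HJ; split=> [|[//|[X FX]]]; first by left.
    by case: noF; exists X.
  have inF X x : F X -> I x \/ X x -> I x \/ (\bigcup_(Y in F) Y)%classic x.
    by move=> FX [|Xx]; [left|right; exists X].
  have Fin x : I x \/ (\bigcup_(Y in F) Y)%classic x -> exists2 X, F X & I x \/ X x.
    by move=> [Ix|[X FX Xx]]; [exists X1 => //; left|exists X => //; right].
  apply: idealr_of; first by left.
    move=> /Fin[X FX h]; have [J HJ] := FP _ FX.
    by have /HJ := h; rewrite idealr1.
  move=> a x y /Fin[X FX Xx] /Fin[Y FY Yy].
  have [J HJ] := FP _ FX; have [K HK] := FP _ FY.
  have [XY|YX] := Ftot _ _ FX FY.
    apply: (inF Y) => //; apply/HK; rewrite rpredD ?idealMr //; apply/HK => //.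
    by case: Xx => [|/XY]; [left|right].
  apply: (inF X) => //; apply/HJ; rewrite rpredD ?idealMr //; apply/HJ => //.
  by case: Yy => [|/YX]; [left|right].
exists m; last by move=> x Ix; apply/Hm; left.
move=> J mJ x xJ; apply/Hm; right.
apply: contrapT => nXx; pose Y : set A := fun y => is_true (y \in J).
apply: (Xmax Y).
  split; last by move=> YX; apply/nXx/YX.
  by move=> y Xy; apply: mJ; apply/Hm; right.
exists J => y; split=> [yJ|[Iy|//]]; first by right.
by apply/mJ/Hm; left.
Qed.

Variable p : prime_idealr A.

Lemma fraction_divE (x : localization p) :
  exists a s, s \notin p /\ to_loc p s * x = to_loc p a.
Proof.
elim/quotW: x => -[a s sp]; exists a, s; split=> //.
rewrite -[LHS]/(loc_mul _ _) loc_mulE; apply: loc_exact => /=; ring.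
Qed.

Lemma localizing_loc : localizing (@to_loc A p) (fun s => s \notin p).
Proof.
split.
- exact: one_notin.
- exact: mul_notin.
- by move=> x; have [a [s [sp e]]] := fraction_divE x; exists s => //; exists a.
- move=> a /eqmodP/asboolP[u up /=]; rewrite mulr1 mul0r subr0 => e.
  by exists u.
Qed.

Lemma to_loc_unit s : s \notin p -> exists y, to_loc p s * y = 1.
Proof.
move=> sp; exists (\pi_(localization p)%qT (Fraction 1 sp)).
rewrite -[LHS]/(loc_mul _ _) loc_mulE; apply: loc_exact => /=; ring.
Qed.

End Maximal.

(** This first-order form does not ask for a maximal ideal to be exhibited; the
ring is nonzero by type. *)
Definition is_local (L : comNzRingType) : Prop :=
  forall x y : L, (exists z, (x + y) * z = 1) ->
    (exists z, x * z = 1) \/ (exists z, y * z = 1).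

Lemma localization_local (A : comNzRingType) (p : prime_idealr A) :
  is_local (localization p).
Proof.
move=> x y [z xyz].
have [a [s [sp xa]]] := fraction_divE x; have [b [t [tp yb]]] := fraction_divE y.
have unit_of (w : localization p) c r :
    c \notin p -> to_loc p r * w = to_loc p c -> exists z, w * z = 1.
  move=> cp e; have [v Hv] := to_loc_unit cp.
  by exists (to_loc p r * v); rewrite mulrCA mulrA e Hv.
have [ap|ap] := boolP (a \in p); last by left; apply: unit_of xa.
have [bp|bp] := boolP (b \in p); last by right; apply: unit_of yb.
have [c [r [rp zc]]] := fraction_divE z.
have : to_loc p (s * t * r) = to_loc p ((t * a + s * b) * c).
  rewrite -[LHS]mulr1 -xyz !rmorphM !rmorphD !rmorphM /= -xa -yb -zc; ring.
move=> /eqP; rewrite -subr_eq0 -rmorphB => /eqP /(lz_ker (localizing_loc p)).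
case=> u up /eqP; rewrite mulrBr subr_eq0 => /eqP e.
have : u * (s * t * r) \in p by rewrite e idealMr // mulrC idealMr // rpredD ?idealMr.
by rewrite !prime_idealrM (negPf up) (negPf sp) (negPf tp) (negPf rp).
Qed.

Definition ev (A C : comNzRingType) (f : {rmorphism A -> C}) (c : C) :
    {rmorphism {poly A} -> C} :=
  horner_morph (fun x : A => mulrC c (f x)).

Lemma evC (A C : comNzRingType) (f : {rmorphism A -> C}) c a : ev f c a%:P = f a.
Proof. exact: horner_morphC. Qed.
Lemma evX (A C : comNzRingType) (f : {rmorphism A -> C}) c : ev f c 'X = c.
Proof. exact: horner_morphX. Qed.

Lemma poly_hom_ext (A C : comNzRingType) (f g : {rmorphism {poly A} -> C}) :
  (forall a, f a%:P = g a%:P) -> f 'X = g 'X -> f =1 g.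
Proof.
move=> eC eX p; elim/poly_ind: p => [|p c IH]; first by rewrite !rmorph0.
by rewrite !(rmorphD, rmorphM) IH eC eX.
Qed.

Lemma map_mx_eq_comp (A C D : comNzRingType) m n (f : A -> C) (g : C -> D)
   (h : A -> D) (M : 'M[A]_(m, n)) : (forall x, g (f x) = h x) ->
  map_mx g (map_mx f M) = map_mx h M.
Proof. by move=> e; apply/matrixP => i j; rewrite !mxE. Qed.

Definition polyCC (B : comNzRingType) : {rmorphism B -> {poly {poly B}}} :=
  polyC \o polyC.

(** The substitution T := V + s U from A[T] to A[V][U]: the inner variable is V
and the outer one U. *)
Definition shift (B : comNzRingType) (s : B) : {rmorphism {poly B} -> {poly {poly B}}} :=
  ev (polyCC B) ('X%:P + s%:P%:P * 'X).

Lemma shiftC (B : comNzRingType) (s b : B) : shift s b%:P = b%:P%:P.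
Proof. exact: evC. Qed.
Lemma shiftX (B : comNzRingType) (s : B) : shift s 'X = 'X%:P + s%:P%:P * 'X.
Proof. exact: evX. Qed.

Lemma smap_polyCC (B : comNzRingType) N (S : hspace B N) :
  smap polyC (smap polyC S) = smap (polyCC B) S.
Proof. exact: smap_comp. Qed.

Lemma smap_shift (B : comNzRingType) (s : B) N (S : hspace B N) :
  smap (shift s) (smap polyC S) = smap (polyCC B) S.
Proof. by apply: smap_comp => x; apply: shiftC. Qed.

Section LocalGlobal.
Variables (A : comNzRingType) (N : nat) (S : hspace A N).
Hypothesis axS : space_axioms S.
Variables (sig sig' : 'M[{poly A}]_N).
Hypothesis sigV : sig *m sig' = 1%:M.
Hypothesis sig0 : map_mx (psub 0) sig = 1%:M.

(** sig(V + sU) sig(V)^-1 is elementary over A[V][U].  The scalars s with this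
property form an ideal: it contains multiples by the substitution U := a U, and
sums by composing with V := V + s U. *)
Definition shifted s :=
  EOm (smap (polyCC A) S) (map_mx (shift s) sig *m map_mx (shift 0) sig').

Lemma shift_hom (s : A) (k : {rmorphism {poly {poly A}} -> {poly {poly A}}}) c :
  (forall a, k a%:P%:P = a%:P%:P) -> k ('X%:P + s%:P%:P * 'X) = 'X%:P + c%:P%:P * 'X ->
  forall m n (M : 'M_(m, n)), map_mx k (map_mx (shift s) M) = map_mx (shift c) M.
Proof.
move=> kC kX m n M; apply: map_mx_eq_comp => x.
have := @poly_hom_ext _ _ (k \o shift s) (shift c); apply=> /=.
  by move=> a; rewrite !shiftC kC.
by rewrite !shiftX kX.
Qed.

Lemma smap_const (k : {rmorphism {poly {poly A}} -> {poly {poly A}}}) :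
  (forall a, k a%:P%:P = a%:P%:P) ->
  smap k (smap (polyCC A) S) = smap (polyCC A) S.
Proof. by move=> kC; apply: smap_comp => x; apply: kC. Qed.

Lemma shifted0 : shifted 0.
Proof. by rewrite /shifted -map_mxM sigV map_mx1; apply: gen1. Qed.

Lemma shiftedM a s : shifted s -> shifted (a * s).
Proof.
move=> Es; pose k := psub (a%:P%:P * 'X : {poly {poly A}}).
have kC b : k b%:P%:P = b%:P%:P by apply: psubC.
have := EOm_map k Es; rewrite smap_const // map_mxM.
rewrite (@shift_hom s k (a * s)) ?(@shift_hom 0 k 0) //.
  by rewrite !(rmorphD, rmorphM) /= !psubC psubX /= !polyC0 !mul0r.
rewrite !(rmorphD, rmorphM) /= !psubC psubX /=; ring.
Qed.

Lemma shiftedD s t : shifted s -> shifted t -> shifted (s + t).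
Proof.
move=> Es Et.
pose k := ev (ev (polyCC A) ('X%:P + s%:P%:P * 'X)) ('X : {poly {poly A}}).
have kC b : k b%:P%:P = b%:P%:P by rewrite !evC.
have := EOm_map k Et; rewrite smap_const // map_mxM.
rewrite (@shift_hom t k (s + t)) ?(@shift_hom 0 k s) //; last 2 first.
- by rewrite !(rmorphD, rmorphM) /= !evC !evX /= !polyC0 !mul0r addr0.
- by rewrite !(rmorphD, rmorphM) /= !evC !evX /=; ring.
move=> Et'; have := gen_mul Et' Es.
by rewrite mulmxA -(mulmxA _ (map_mx (shift s) sig')) -map_mxM (mulmx1C sigV) map_mx1 mulmx1.
Qed.

Hypothesis local_EO : forall (I : idealr A) (hI : maximal_ideal I),
  let phi := @to_loc A (prime_of_maximal hI) in
  (exists m (fr : 'I_m * bool -> 'rV_N) u c, frame (smap phi S) fr u c) /\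
  EOm (smap polyC (smap phi S)) (map_mx (map_poly phi) sig).

(** Dilation applied to sig(V + U) sig(V)^-1, which is trivial at U = 0, over the
ring A[V]. *)
Lemma shifted_local (I : idealr A) : maximal_ideal I ->
  exists2 s, s \notin I & shifted s.
Proof.
move=> hI; have [[m [fr [u [c frT]]]] Esig] := local_EO hI.
set phi := @to_loc _ _ in frT Esig.
have lz := localizing_loc (prime_of_maximal hI).
pose tau := map_mx (shift 1) sig *m map_mx (shift 0) sig'.
have tau0 : map_mx (psub 0) tau = 1%:M.
  have kC b : psub (0 : {poly {poly A}}) b%:P%:P = b%:P%:P by apply: psubC.
  rewrite map_mxM (@shift_hom 1 _ 0) ?(@shift_hom 0 _ 0) //.
  - by rewrite -map_mxM sigV map_mx1.
  - by rewrite !(rmorphD, rmorphM) /= !psubC psubX /= !polyC0 ?mulr0 ?mul0r ?mulr0.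
  - by rewrite !(rmorphD, rmorphM) /= !psubC psubX /= !polyC0 ?mulr0 ?mul0r ?mulr0.
have frT1 : frame (smap (map_poly phi) (smap polyC S)) (fun a => map_mx polyC (fr a)) (map_mx polyC u) c%:P.
  by rewrite smap_phiX; apply: frame_map.
have sh s M : map_mx (map_poly (map_poly phi)) (map_mx (shift s) M) =
    map_mx (shift (phi s)) (map_mx (map_poly phi) M) :> 'M_N.
  rewrite -!map_mx_comp; apply: eq_map_mx => x /=.
  have := @poly_hom_ext _ _ (map_poly (map_poly phi) \o shift s) (shift (phi s) \o map_poly phi).
  apply=> /=; first by move=> a; rewrite map_polyC /= !shiftC !map_polyC /= map_polyC.
  by rewrite map_polyX !shiftX !(rmorphD, rmorphM) /= !map_polyC /= map_polyX !map_polyC map_polyX.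
have EtauL : EOm (smap polyC (smap (map_poly phi) (smap polyC S)))
    (map_mx (map_poly (map_poly phi)) tau).
  rewrite map_mxM !sh smap_phiX.
  rewrite smap_polyCC; apply: gen_mul.
    by rewrite -(smap_shift (phi 1)); apply: EOm_map.
  rewrite -(smap_shift (phi 0)).
  apply: EOm_map; apply: (EOm_inverse _ Esig); last by rewrite -map_mxM sigV map_mx1.
  by do 2!apply: smap_axioms.
have [_ [s sI ->] Es] := dilation (localizing_poly lz) (smap_axioms _ axS) frT1 tau0 EtauL.
exists s => //; move: Es; rewrite /shifted.
rewrite smap_polyCC map_mxM.
have kC b : psub (s%:P%:P * 'X : {poly {poly A}}) b%:P%:P = b%:P%:P by apply: psubC.
rewrite (@shift_hom 1 _ s) ?(@shift_hom 0 _ 0) //.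
- by rewrite !(rmorphD, rmorphM) /= !psubC psubX /= !polyC0 !mul0r.
- by rewrite !(rmorphD, rmorphM) /= !psubC psubX /= !polyC1 mul1r.
Qed.

(** By [shifted_local] the ideal of the scalars s is contained in no maximal
ideal, so it contains 1; then set V = 0 and U = 1. *)
Theorem local_global : EOm S (map_mx (horner_eval 1) sig).
Proof.
have sh1 : shifted 1.
  apply: contrapT => no1.
  have [|I hI shI] := maximal_exists shifted0 no1 _.
    by move=> a x y Ex Ey; exact: (shiftedD (shiftedM a Ex) Ey).
  have [s sI Es] := shifted_local hI.
  by move: sI; rewrite shI.
pose e := ev (ev idfun (0 : A)) 1.
have eC a : e a%:P%:P = a by rewrite !evC.
have := EOm_map e sh1; rewrite (@smap_comp _ _ _ _ e idfun) //.
have -> : smap idfun S = S.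
  by apply: hspace_eq => //=; apply/matrixP => i j; rewrite mxE.
rewrite map_mxM.
have -> : map_mx e (map_mx (shift 0) sig') = 1%:M.
  have e0 x : e (shift 0 x) = horner_eval 0 x.
    have := @poly_hom_ext _ _ (e \o shift 0) (horner_eval 0); apply=> /=.
      by move=> a; rewrite shiftC eC /horner_eval hornerC.
    by rewrite shiftX !(rmorphD, rmorphM) /= !evC !evX /= /horner_eval hornerX mul0r addr0.
  rewrite (map_mx_eq_comp _ e0).
  have s0 : map_mx (horner_eval 0) sig = 1%:M.
    have := congr1 (map_mx (horner_eval (0 : A))) sig0; rewrite map_mx1 => <-.
    apply/esym/map_mx_eq_comp => x.
    by rewrite /horner_eval /psub /= horner_comp horner0.
  by rewrite -[LHS]mul1mx -s0 -map_mxM sigV map_mx1.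
rewrite mulmx1 (@map_mx_eq_comp _ _ _ _ _ _ _ (horner_eval 1)) // => x.
have := @poly_hom_ext _ _ (e \o shift 1) (horner_eval 1); apply=> /=.
  by move=> a; rewrite shiftC eC /horner_eval hornerC.
by rewrite shiftX !(rmorphD, rmorphM) /= !evC !evX /= /horner_eval hornerX mulr1 add0r.
Qed.

End LocalGlobal.

(** * Local rings: transitivity and normality *)

Definition isu (L : comNzRingType) (x : L) : Prop := exists z, x * z = 1.

Section LocalRing.
Variable L : comNzRingType.
Hypothesis locL : is_local L.
Implicit Types x y : L.

Lemma isu1 : isu (1 : L). Proof. by exists 1; rewrite mulr1. Qed.
Lemma isuM x y : isu x -> isu y -> isu (x * y).
Proof. by move=> [u eu] [v ev]; exists (u * v); rewrite mulrACA eu ev mulr1. Qed.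
Lemma isu_l x y : isu (x * y) -> isu x.
Proof. by move=> [z e]; exists (y * z); rewrite mulrA. Qed.
Lemma isu_r x y : isu (x * y) -> isu y.
Proof. by rewrite mulrC; apply: isu_l. Qed.
Lemma isuN x : isu x -> isu (- x).
Proof. by move=> [z e]; exists (- z); rewrite mulrNN. Qed.
Lemma isu_add x y : isu (x + y) -> isu x \/ isu y.
Proof. exact: locL. Qed.
Lemma isu_addl x y : isu (x + y) -> ~ isu y -> isu x.
Proof. by move=> /isu_add[]. Qed.
Lemma isu_sum (I : finType) (F : I -> L) : isu (\sum_i F i) -> exists i, isu (F i).
Proof.
suff H r : isu (\sum_(i <- r) F i) -> exists i, isu (F i) by apply: H.
elim: r => [|i r IH]; last first.
  by rewrite big_cons => /isu_add[|/IH//]; exists i.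
by rewrite big_nil => -[z]; rewrite mul0r => /esym/eqP; rewrite oner_eq0.
Qed.

End LocalRing.

Section Transitivity.
Variables (L : comNzRingType) (N : nat) (S : hspace L N).
Hypothesis axS : space_axioms S.
Variables (m : nat) (fr : 'I_m * bool -> 'rV[L]_N) (u0 : 'rV[L]_N) (c0 : L).
Hypothesis frS : frame S fr u0 c0.
Local Notation "<| x , y |>" := (bil S x y).
Local Notation FE := (gen (FEgen S fr)).
Implicit Types (x y z u v w : 'rV[L]_N) (a b c : 'I_m * bool).

Definition qf x := hf S * <|x, x|>.

Lemma fr_isoo c : <|fr c, fr c|> = 0. Proof. exact: (fr_iso axS frS). Qed.

(** The transvection along fr c whose vector is the defect
fr (opp_ix c) + <x, fr (opp_ix c)> fr c - x, which is orthogonal to the c-th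
plane. *)
Lemma straighten x c : inM S x -> <|x, fr c|> = 1 ->
  exists v, FE (eich S (fr c) v) /\ <|fr c, v|> = 0 /\
    x *m eich S (fr c) v = fr (opp_ix c) + qf x *: fr c.
Proof.
move=> Mx xc; pose v := fr (opp_ix c) + <|x, fr (opp_ix c)|> *: fr c - x.
have cv : <|v, fr c|> = 0.
  by rewrite /v !bilE fr_isoo xc (fr_opp' axS frS); ring.
have dv : <|v, fr (opp_ix c)|> = 0.
  by rewrite /v !bilE fr_isoo (fr_opp frS); ring.
have Mv : inM S v.
  by apply: inM_D; [apply: inM_D; [|apply: inM_Z]|apply: inM_N => //]; apply: (fr_inM axS frS).
exists v; split; first exact: (FE_perp axS frS).
split; first by rewrite (bilC axS).
rewrite mul_eich xc /qf.
have -> : <|x, v|> = 2%:R * <|x, fr (opp_ix c)|> - <|x, x|>.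
  by rewrite /v !bilE xc; ring.
have -> : <|v, v|> = <|x, x|> - 2%:R * <|x, fr (opp_ix c)|>.
  rewrite /v !bilE !fr_isoo xc (fr_opp' axS frS) (fr_opp frS).
  rewrite !(bilC axS _ x) xc; ring.
apply/rowP => j; rewrite /v !mxE.
apply: (hf_eq axS (t := (<|x, fr (opp_ix c)|> - <|x, x|>) * fr c 0 j)); ring.
Qed.

Lemma qf_isom g x : isom S g -> qf (x *m g) = qf x.
Proof. by case=> g1 _ _; rewrite /qf g1. Qed.

Lemma FE_isom g : FE g -> isom S g.
Proof. by move=> /(FE_EO frS); apply: EOm_isom. Qed.

Lemma FE_inv g : FE g -> exists2 g', FE g' & g *m g' = 1%:M.
Proof.
move=> /(FE_EO frS) /(EOm_inv axS)[g' Eg' e]; exists g' => //.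
exact: (EO_FE axS frS).
Qed.

(** A long transvection uses the unit <x, fr b> to turn <x, fr c> into 1, after
which [straighten] applies. *)
Lemma transport x b c : inM S x -> isu <|x, fr b|> -> c.1 != b.1 ->
  exists2 g, FE g & x *m g = fr (opp_ix c) + qf x *: fr c.
Proof.
move=> Mx [d xd] cb.
pose g := eich S (fr (opp_ix c)) (((<|x, fr c|> - 1) * d) *: fr b).
have Eg : FE g by apply: (FE_long axS frS).
have Ig := FE_isom Eg; have [_ g2 _] := Ig.
have xg : <|x *m g, fr c|> = 1.
  have bc : b.1 != c.1 by rewrite eq_sym.
  have bb : <|fr b, fr b|> = 0 by apply: fr_isoo.
  rewrite /g mul_eich !bilE (fr_opp' axS frS) bb (fr_orth frS bc).
  have : <|x, fr b|> * d = 1 by [].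
  move: (<|x, fr b|>) => y yd.
  have -> : (<|x, fr c|> - 1) * d * y = (<|x, fr c|> - 1) * (y * d) by ring.
  rewrite yd; ring.
have [v [Ev [_ e]]] := straighten (g2 _ Mx) xg.
exists (g *m eich S (fr c) v); first exact: gen_mul.
by rewrite mulmxA e qf_isom.
Qed.

Hypothesis locL : is_local L.

(** If x pairs to a unit with no frame vector, it pairs to a unit with a vector
of Q, and a short transvection makes it pair to a unit with a frame vector.  Then
[transport], through a second plane when the frame vector lies in the a-th
one. *)
Lemma unimodular_transitive a x y : inM S x -> isu <|x, y|> ->
  exists2 g, FE g & x *m g = fr a + qf x *: fr (opp_ix a).
Proof.
move=> Mx xy.
have [g Eg [b gb]] : exists2 g, FE g & exists b, isu <|x *m g, fr b|>.
  have [[b xb]|nob] := pselect (exists b, isu <|x, fr b|>).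
    by exists 1%:M; [apply: gen1|exists b; rewrite mulmx1].
  have nb b : ~ isu <|x, fr b|> by move=> h; apply: nob; exists b.
  have Qz : inQ S (y *m prQ S) by rewrite /inQ -mulmxA (prQQ axS).
  have uz : isu <|x, y *m prQ S|>.
    move: xy; have -> : <|x, y|> = <|x, y *m prM S|> by rewrite -(bil_prM axS) Mx.
    have My : inM S (y *m prM S) by rewrite /inM -mulmxA (prMM axS).
    rewrite (fr_span frS My) !bilE !bil_sumr.
    have -> : y *m prM S *m prQ S = y *m prQ S.
      rewrite -mulmxA /prM !mulmxDl (prQQ axS) (prPQ axS) (prDQ axS).
      by rewrite !addr0.
    have nsum (c : 'I_m -> L) s : ~ isu (\sum_i <|x, c i *: fr (i, s)|>).
      by move=> /(isu_sum locL)[i]; rewrite bilZr => /isu_r; apply: nb.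
    by do 2!move=> /(isu_addl locL)/(_ (nsum _ _)).
  have [b _] := other_ix frS a.
  exists (eich S (fr b) (y *m prQ S)); first exact: FE_short.
  exists (opp_ix b); rewrite mul_eich !bilE (fr_opp frS) (Q_fr axS frS _ Qz).
  apply: isu_l (-1) _; rewrite mulrN1.
  set t := - _.
  have e : t + (<|x, fr (opp_ix b)|> - hf S * <|y *m prQ S, y *m prQ S|> * <|x, fr b|>)
      = <|x, y *m prQ S|> by rewrite /t; ring.
  move: uz; rewrite -e => /(isu_addl locL); apply.
  move=> /(isu_add locL)[|/isuN]; first exact: nb.
  by rewrite opprK => /isu_r; apply: nb.
have Ig := FE_isom Eg; have [_ g2 _] := Ig.
suff [h Eh e] : exists2 h, FE h & x *m g *m h = fr a + qf (x *m g) *: fr (opp_ix a).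
  by exists (g *m h); [apply: gen_mul|rewrite mulmxA e qf_isom].
have {g2}Mx' := g2 _ Mx; move: (x *m g) Mx' gb => {x Mx xy Ig} x Mx xb.
have [ba|ba] := eqVneq b.1 a.1; last first.
  have [|h Eh] := transport (c := opp_ix a) Mx xb; first by rewrite eq_sym.
  by rewrite opp_ixK; exists h.
have [c ca] := other_ix frS a.
have [|h Eh e] := transport (c := c) Mx xb; first by rewrite ba.
have Ih := FE_isom Eh; have [_ h2 _] := Ih.
have [||k Ek] := transport (x := x *m h) (b := c) (c := opp_ix a) (h2 _ Mx).
- rewrite e !bilE (fr_opp' axS frS) fr_isoo mulr0 addr0; exact: isu1.
- by rewrite eq_sym.
rewrite opp_ixK qf_isom // => e'; exists (h *m k); first exact: gen_mul.
by rewrite mulmxA.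
Qed.

(** Move fr a *m g back to fr a by transitivity, then fr (opp_ix a) by a
transvection along fr a, which does not disturb fr a. *)
Lemma decompose a g : isom S g -> exists2 h, FE h &
  fr a *m (g *m h) = fr a /\ fr (opp_ix a) *m (g *m h) = fr (opp_ix a).
Proof.
move=> Ig; have [g1 g2 _] := Ig.
have [|h Eh] := unimodular_transitive a (x := fr a *m g) (y := fr (opp_ix a) *m g) (g2 _ (fr_inM axS frS a)).
  by rewrite g1 (fr_opp frS); apply: isu1.
rewrite qf_isom // /qf fr_isoo mulr0 scale0r addr0 => e.
have Ih := FE_isom Eh; have [h1 h2 _] := Ih.
pose y := fr (opp_ix a) *m g *m h.
have My : inM S y by apply/h2/g2/(fr_inM axS frS).
have ya : <|y, fr a|> = 1 by rewrite -e /y h1 g1 (fr_opp' axS frS).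
have [v [Ev [va ev]]] := straighten My ya.
exists (h *m eich S (fr a) v); first exact: gen_mul.
rewrite !mulmxA e -/y ev; split.
  by rewrite mul_eich fr_isoo va mulr0 !scale0r addr0 !subr0.
by rewrite /qf /y h1 g1 fr_isoo mulr0 scale0r addr0.
Qed.

(** The isometry is defined over L while the elementary matrix is over an
L-algebra L', typically L[T], which is not local. *)
Lemma local_normal (L' : comNzRingType) (k : {rmorphism L -> L'}) g g' h :
  isom S g -> g *m g' = 1%:M ->
  gen (FEgen (smap k S) (fun a => map_mx k (fr a))) h ->
  gen (FEgen (smap k S) (fun a => map_mx k (fr a)))
    (map_mx k g' *m h *m map_mx k g).
Proof.
move=> Ig gg' Eh.
have axT := smap_axioms k axS; have frT := frame_map k frS.
have m0 : (0 < m)%N by apply: ltnW (fr_m frS).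
pose a := (Ordinal m0, true).
have [e Ee [fa fb]] := decompose a Ig; have [e' Ee' ee'] := FE_inv Ee.
have Ek (M : 'M_N) : FE M -> gen (FEgen (smap k S) (fun a => map_mx k (fr a))) (map_mx k M).
  by move=> EM; apply: (EO_FE axT frT); apply: EOm_map; apply: (FE_EO frS).
pose g2 := g *m e; pose g2' := e' *m g'.
have g22' : g2 *m g2' = 1%:M by rewrite /g2 /g2' mulmxA -(mulmxA g) ee' mulmx1.
have I2 : isom S g2 by apply: isomM => //; apply: FE_isom.
have -> : map_mx k g' *m h *m map_mx k g =
    map_mx k e *m (map_mx k g2' *m h *m map_mx k g2) *m map_mx k e'.
  rewrite /g2 /g2' !map_mxM !mulmxA -!map_mxM.
  by rewrite -(mulmxA _ (map_mx k e)) -!map_mxM ee' map_mx1 mulmx1 mul1mx.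
apply: gen_mul; last exact: Ek; apply: gen_mul; first exact: Ek.
apply: (stab_conj axT frT (a := a)) => //.
- exact: isom_map.
- by rewrite -map_mxM g22' map_mx1.
- by rewrite -map_mxM fa.
- by rewrite -map_mxM fb.
Qed.

Lemma local_normal1 g g' h : isom S g -> g *m g' = 1%:M -> FE h -> FE (g' *m h *m g).
Proof.
move=> Ig gg' Eh; have := local_normal (k := idfun) Ig gg' (h := h).
have -> : smap idfun S = S.
  by apply: hspace_eq => //=; apply/matrixP => i j; rewrite mxE.
have mid p q (M : 'M[L]_(p, q)) : map_mx idfun M = M by apply/matrixP => i j; rewrite mxE.
have -> : (fun a => map_mx idfun (fr a)) = fr by apply/funext => c; rewrite mid.
by rewrite !mid; apply.
Qed.

End Transitivity.

(** * Local rings: generation by reflections *)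

Section Reflections.
Variables (L : comNzRingType) (N : nat) (S : hspace L N).
Hypothesis axS : space_axioms S.
Hypothesis locL : is_local L.
Local Notation "<| x , y |>" := (bil S x y).
Implicit Types (x y z u v w : 'rV[L]_N).

(** c stands for the inverse of <u,u>. *)
Definition refl u (c : L) : 'M[L]_N := 1%:M - (2%:R * c) *: (gram S *m u^T *m u).

Definition Rgen (g : 'M[L]_N) : Prop :=
  exists u c, [/\ inM S u, <|u, u|> * c = 1 & g = refl u c].

Lemma mul_refl x u c : x *m refl u c = x - (2%:R * c * <|x, u|>) *: u.
Proof.
by rewrite /refl mulmxBr mulmx1 -scalemxAr !mulmxA bil_mx mul_scalar_mx scalerA.
Qed.

Lemma reflK u c : <|u, u|> * c = 1 -> refl u c *m refl u c = 1%:M.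
Proof.
move=> uc; apply: mx_ext => x; rewrite mulmxA !mul_refl mulmx1 !bilE.
apply/rowP => j; rewrite !mxE; ring: uc.
Qed.

Lemma refl_isom u c : inM S u -> <|u, u|> * c = 1 -> isom S (refl u c).
Proof.
move=> Mu uc; split=> [x y|x Mx|].
- rewrite !mul_refl !bilE (bilC axS u y); ring: uc.
- by rewrite mul_refl -scaleNr; apply: inM_D => //; apply: inM_Z.
apply: mx_ext => x; rewrite mulmxA mul_refl.
have -> : <|x *m (1%:M - prM S), u|> = 0.
  by rewrite mulmxBr mulmx1 bilDl bilNl (bil_prM axS) Mu subrr.
by rewrite mulr0 scale0r subr0.
Qed.

Lemma refl_det u c : <|u, u|> * c = 1 -> \det (refl u c) = -1.
Proof.
move=> uc.
have -> : refl u c = 1%:M + (- (2%:R * c) *: (gram S *m u^T)) *m u.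
  by rewrite /refl -scalemxAl scaleNr.
rewrite sylvester_det det_mx11 -scalemxAr mulmxA bil_mx !mxE eqxx.
have -> : - (2%:R * c) * (<|u, u|> *+ true) = - 2%:R * (<|u, u|> * c) by rewrite mulr1n; ring.
rewrite uc /=; ring.
Qed.

Lemma refl_conj g g' u c : g *m g' = 1%:M -> isom S g ->
  g' *m refl u c *m g = refl (u *m g) c.
Proof.
move=> gg' [gO _ _]; have g'g := mulmx1C gg'.
apply: mx_ext => x; rewrite !mulmxA mul_refl mul_refl.
have -> : <|x *m g', u|> = <|x, u *m g|> by rewrite -gO -mulmxA g'g mulmx1.
by rewrite mulmxBl -scalemxAl -mulmxA g'g mulmx1.
Qed.

Lemma Rgen_inv g : gen Rgen g -> exists2 g', gen Rgen g' & g *m g' = 1%:M.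
Proof.
apply: gen_inv => _ [u [c [Mu uc ->]]].
by exists (refl u c); [apply: gen_in; exists u, c|apply: reflK].
Qed.

Lemma Rgen_isom g : gen Rgen g -> isom S g.
Proof.
elim=> [|g1 g2 [u [c [Mu uc ->]]] _ IH]; first exact: isom1.
by apply: isomM => //; apply: refl_isom.
Qed.

(** Put y = x *m g.  Since <y - x, y - x> + <y + x, y + x> = 4 <x, x> is a unit,
one of the two summands is.  Reflect in y - x, or in y + x and then in x. *)
Lemma refl_back g x c : isom S g -> inM S x -> <|x, x|> * c = 1 ->
  exists2 r, gen Rgen r & x *m g *m r = x /\
    forall v, <|v, x|> = 0 -> <|v, x *m g|> = 0 -> v *m r = v.
Proof.
move=> [g1 g2 _] Mx xc; pose y := x *m g.
have My : inM S y by apply: g2.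
have yy : <|y, y|> = <|x, x|> by rewrite /y g1.
have four : isu (<|y - x, y - x|> + <|y + x, y + x|>).
  exists (hf S * hf S * c); rewrite !bilE yy (bilC axS y x).
  have h2 := hf2 axS.
  have -> : forall a b d : L, (a - b - (b - a) + (a + b + (b + a))) * (hf S * hf S * d)
     = (2%:R * hf S) * (2%:R * hf S) * (a * d) by move=> a b d; ring.
  by rewrite h2 xc !mulr1.
have [[d yd]|[d yd]] := isu_add locL four.
  exists (refl (y - x) d).
    apply: gen_in; exists (y - x), d; split=> //.
    by apply: inM_D => //; apply: inM_N.
  split; last first.
    by move=> v vx vy; rewrite mul_refl !bilE vx vy subrr mulr0 scale0r subr0.
  rewrite -/y mul_refl.
  have -> : 2%:R * d * <|y, y - x|> = 1.
    apply: etrans yd; rewrite !bilE yy (bilC axS y x); ring.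
  by rewrite scale1r subKr.
exists (refl (y + x) d *m refl x c).
  apply: gen_mul; apply: gen_in; [exists (y + x), d|exists x, c]; split=> //.
  exact: inM_D.
split; last first.
  move=> v vx vy; rewrite mulmxA !mul_refl !bilE vx vy.
  by apply/rowP => j; rewrite !mxE; ring.
rewrite mulmxA -/y (mul_refl y).
have -> : 2%:R * d * <|y, y + x|> = 1.
  apply: etrans yd; rewrite !bilE yy (bilC axS y x); ring.
rewrite scale1r mul_refl !bilE.
apply/rowP => j; rewrite !mxE; ring: xc.
Qed.

Lemma coord x j : (x *m prM S) 0 j = <|x, (cogram S *m delta_mx j 0)^T|>.
Proof.
rewrite /bil trmxK -(gram_cogram axS) !mulmxA -[LHS]/((_ : 'rV_N) 0 j).
by rewrite -colE !mxE.
Qed.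

(** pr is an orthogonal projection onto a subspace spanned by k vectors, off which
g is the identity.  The projection and not a basis is carried along because the
subspace is only known to be projective.  If it contains x with <x,x> a unit, then x
is split off with [refl_back] and one spanning vector becomes
superfluous.  Otherwise no two of its vectors pair to a unit; as the form is
non-degenerate on it, Nakayama's argument shows that z 0 is a combination of the
other spanning vectors. *)
Lemma cartan_dieudonne k (z : 'I_k -> 'rV[L]_N) (pr : 'M[L]_N) g :
  pr *m pr = pr -> (forall x y, <|x *m pr, y|> = <|x, y *m pr|>) ->
  (forall x, inM S (x *m pr)) -> (forall i, z i *m pr = z i) ->
  (forall x, exists c : 'I_k -> L, x *m pr = \sum_i c i *: z i) ->
  isom S g ->
  (forall x, (x *m prM S - x *m pr) *m g = x *m prM S - x *m pr) ->
  gen Rgen g.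
Proof.
elim: k z pr g => [|k IH] z pr g prpr prs prM' zpr span Ig fix_g.
  have pr0 x : x *m pr = 0 by have [c ->] := span x; rewrite big_ord0.
  suff -> : g = 1%:M by apply: gen1.
  apply: mx_ext => x; have [_ _ g3] := Ig.
  have -> : x = (x *m prM S - x *m pr) + x *m (1%:M - prM S).
    by rewrite pr0 subr0 mulmxBr mulmx1 addrC subrK.
  by rewrite mulmxDl fix_g -mulmxA g3 mulmx1.
have [[x [c [xpr xc]]]|nounit] :=
    pselect (exists x c, x *m pr = x /\ <|x, x|> * c = 1).
  have Mx : inM S x by rewrite -xpr.
  have [r Er [xr fix_r]] := refl_back Ig Mx xc.
  have [r' Er' rr'] := Rgen_inv Er.
  suff H : gen Rgen (g *m r).
    have -> : g = g *m r *m r' by rewrite -mulmxA rr' mulmx1.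
    exact: gen_mul.
  have [d xd] := span x; rewrite xpr in xd.
  have [i [e de]] : exists i, isu (d i).
    have : isu <|x, x|> by exists c.
    rewrite {2}xd bil_sumr => /(isu_sum locL)[i]; rewrite bilZr => /isu_l.
    by exists i.
  pose pr' := pr - c *: (gram S *m x^T *m x).
  have pr'E y : y *m pr' = y *m pr - (c * <|y, x|>) *: x.
    by rewrite mulmxBr -scalemxAr !mulmxA bil_mx mul_scalar_mx scalerA.
  have prx y : <|y *m pr, x|> = <|y, x|> by rewrite prs xpr.
  have pr'pr y : y *m pr' *m pr = y *m pr'.
    by rewrite pr'E mulmxBl -scalemxAl xpr -mulmxA prpr.
  have pr'pr' : pr' *m pr' = pr'.
    apply: mx_ext => y; rewrite mulmxA (pr'E (y *m pr')) pr'pr !pr'E !bilE prx.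
    apply/rowP => j; rewrite !mxE; ring: xc.
  have xpr' : x *m pr' = 0 by rewrite pr'E xpr mulrC xc scale1r subrr.
  apply: (IH (fun j => z (lift i j) *m pr') pr') => //.
  - move=> y y'; rewrite !pr'E !bilE prs (bilC axS x y'); ring.
  - move=> y; rewrite pr'E -scaleNr; apply: inM_D => //; exact: inM_Z.
  - by move=> j; rewrite -mulmxA pr'pr'.
  - move=> y; have [a ya] := span (y *m pr').
    pose zi := z i *m pr'.
    have ziE : zi = \sum_j (- e * d (lift i j)) *: (z (lift i j) *m pr').
      have : x *m pr' = d i *: zi + \sum_j d (lift i j) *: (z (lift i j) *m pr').
        rewrite xd mulmx_suml (bigD1_ord i) //=; congr (_ + _).
          by rewrite -scalemxAl.
        by apply: eq_bigr => j _; rewrite -scalemxAl.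
      rewrite xpr' => /esym/eqP; rewrite addr_eq0 => /eqP /(congr1 (fun w => e *: w)).
      rewrite scalerA mulrC de scale1r => ->.
      by rewrite scalerN scaler_sumr -sumrN; apply: eq_bigr => j _; rewrite scalerA mulNr scaleNr.
    exists (fun j => a i * (- e * d (lift i j)) + a (lift i j)).
    rewrite -[LHS](_ : y *m pr' *m pr *m pr' = _); last by rewrite pr'pr -mulmxA pr'pr'.
    rewrite ya mulmx_suml (bigD1_ord i) //= -scalemxAl -/zi ziE.
    rewrite scaler_sumr -big_split /=; apply: eq_bigr => j _.
    by rewrite scalerA -scalemxAl -scalerDl.
  - by apply: isomM => //; apply: Rgen_isom.
  move=> y; have -> : y *m prM S - y *m pr' =
      (y *m prM S - y *m pr) + (c * <|y, x|>) *: x.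
    by rewrite pr'E opprB addrCA addrC.
  rewrite mulmxDl; congr (_ + _); last by rewrite -scalemxAl mulmxA xr.
  have vx : <|y *m prM S - y *m pr, x|> = 0.
    by rewrite !bilE prx (bil_prM axS) Mx subrr.
  rewrite mulmxA fix_g fix_r // -{1}(fix_g y).
  by have [g1 _ _] := Ig; rewrite g1.
have non x y : x *m pr = x -> y *m pr = y -> ~ isu <|x, y|>.
  move=> xpr ypr [d xy].
  have nu w : w *m pr = w -> ~ isu <|w, w|>.
    by move=> wpr [c wc]; apply: nounit; exists w, c.
  have : isu (<|x + y, x + y|> - (<|x, x|> + <|y, y|>)).
    exists (hf S * d); rewrite !bilE (bilC axS y x).
    have -> : forall a b f : L, (a + b + (b + f) - (a + f)) * (hf S * d) = (2%:R * hf S) * (b * d).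
      by move=> a b f; ring.
    by rewrite (hf2 axS) xy mulr1.
  move=> /(isu_add locL)[|/isuN]; first by apply: nu; rewrite mulmxDl xpr ypr.
  by rewrite opprK => /(isu_add locL)[]; apply: nu.
have /choice[C HC] : forall b : 'I_N, exists c : 'I_k.+1 -> L,
  delta_mx 0 b *m pr = \sum_i c i *: z i by move=> b; apply: span.
pose z0 := z ord0.
pose w b := (cogram S *m delta_mx b 0)^T *m pr : 'rV[L]_N.
pose a j := \sum_b <|z0, w b|> * C b j.
have Mz0 : inM S z0 by rewrite /z0 -zpr.
have z0E : z0 = \sum_j a j *: z j.
  have -> : z0 = z0 *m pr by rewrite /z0 zpr.
  rewrite {1}[z0]row_sum_delta mulmx_suml.
  under [RHS]eq_bigr => j _ do rewrite /a scaler_suml.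
  rewrite exchange_big /=; apply: eq_bigr => b _.
  rewrite -scalemxAl HC scaler_sumr; apply: eq_bigr => j _.
  rewrite scalerA /w -prs; congr (_ * _ *: _).
  by rewrite -[in LHS]Mz0 coord /z0 zpr.
have [e ae] : isu (1 - a ord0).
  have : isu ((1 - a ord0) + a ord0) by rewrite subrK; apply: isu1.
  move=> /(isu_addl locL); apply => /(isu_sum locL)[b] /isu_l.
  by apply: non; rewrite ?/z0 ?zpr // /w -mulmxA prpr.
have z0E' : z0 = \sum_(j < k) (e * a (lift ord0 j)) *: z (lift ord0 j).
  have : (1 - a ord0) *: z0 = \sum_(j < k) a (lift ord0 j) *: z (lift ord0 j).
    by rewrite scalerBl scale1r {1}z0E big_ord_recl /= addrC addKr.
  move=> /(congr1 (fun w => e *: w)); rewrite scalerA mulrC ae scale1r => {1}->.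
  by rewrite scaler_sumr; apply: eq_bigr => j _; rewrite scalerA.
apply: (IH (fun j => z (lift ord0 j)) pr) => // x.
have [c ->] := span x.
exists (fun j => c ord0 * (e * a (lift ord0 j)) + c (lift ord0 j)).
rewrite big_ord_recl -/z0 {1}z0E' scaler_sumr -big_split; apply: eq_bigr => j _.
by rewrite /= scalerA -scalerDl.
Qed.

Lemma isom_reflections g : isom S g -> gen Rgen g.
Proof.
move=> Ig; apply: (@cartan_dieudonne N (fun i => delta_mx 0 i *m prM S) (prM S)) => //.
- exact: prMM.
- exact: bil_prM.
- by move=> x; rewrite /inM -mulmxA (prMM axS).
- by move=> i; rewrite -mulmxA (prMM axS).
- move=> x; exists (fun j => x 0 j); rewrite {1}[x]row_sum_delta mulmx_suml.
  by apply: eq_bigr => i _; rewrite -scalemxAl.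
- by move=> x; rewrite subrr mul0mx.
Qed.

End Reflections.

(** * Local rings: commutators *)

Section LocalCommutators.
Variables (L : comNzRingType) (N : nat) (S : hspace L N).
Hypothesis axS : space_axioms S.
Variables (m : nat) (fr : 'I_m * bool -> 'rV[L]_N) (u0 : 'rV[L]_N) (c0 : L).
Hypothesis frS : frame S fr u0 c0.
Hypothesis locL : is_local L.
Local Notation "<| x , y |>" := (bil S x y).
Local Notation FE := (gen (FEgen S fr)).
Implicit Types (x y z u v w : 'rV[L]_N).
Variable a : 'I_m * bool.
Local Notation e := (fr a).
Local Notation f := (fr (opp_ix a)).

(** The diagonal isometry e |-> c e, f |-> c' f of the a-th plane; it is an
isometry when c * c' = 1. *)
Definition tor (c c' : L) : 'M[L]_N :=
  1%:M + (c - 1) *: (gram S *m f^T *m e) + (c' - 1) *: (gram S *m e^T *m f).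
(** The antidiagonal e |-> c f, f |-> c' e; it is a reflection when
c * c' = 1 ([refl_swap]). *)
Definition swap (c c' : L) : 'M[L]_N :=
  1%:M + gram S *m f^T *m (c *: f - e) + gram S *m e^T *m (c' *: e - f).

Lemma mul_tor x c c' :
  x *m tor c c' = x + ((c - 1) * <|x, f|>) *: e + ((c' - 1) * <|x, e|>) *: f.
Proof.
by rewrite /tor !mulmxDr mulmx1 -!scalemxAr !mulmxA !bil_mx !mul_scalar_mx !scalerA.
Qed.

Lemma mul_swap x c c' :
  x *m swap c c' = x + <|x, f|> *: (c *: f - e) + <|x, e|> *: (c' *: e - f).
Proof.
by rewrite /swap mulmxDr mulmxDr mulmx1 !mulmxA !bil_mx !mul_scalar_mx.
Qed.

Let ee : <|e, e|> = 0 := fr_iso axS frS a.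
Let ff : <|f, f|> = 0 := fr_iso axS frS (opp_ix a).
Let ef : <|e, f|> = 1 := fr_opp frS a.
Let fe : <|f, e|> = 1 := fr_opp' axS frS a.
Let plane := (ee, ff, ef, fe).

Ltac plane_mul :=
  apply: mx_ext => x; rewrite ?mulmxA ?mul_tor ?mul_swap ?mulmx1 !bilE !plane;
  apply/rowP => j; rewrite !mxE; ring.

Lemma tor_tor c c' d d' : tor c c' *m tor d d' = tor (c * d) (c' * d').
Proof. plane_mul. Qed.
Lemma swap_tor c c' d d' : swap c c' *m tor d d' = swap (c * d') (c' * d).
Proof. plane_mul. Qed.
Lemma swap_swap c c' d d' : swap c c' *m swap d d' = tor (c * d') (c' * d).
Proof. plane_mul. Qed.
Lemma tor1 : tor 1 1 = 1%:M.
Proof. by rewrite /tor !subrr !scale0r !addr0. Qed.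

Lemma refl_swap c d : c * d = 1 ->
  refl S (e + c *: f) (hf S * d) = swap (- c) (- d).
Proof.
move=> cd; apply: mx_ext => x; rewrite mul_refl mul_swap !bilE.
have -> : 2%:R * (hf S * d) = d by rewrite mulrA (hf2 axS) mul1r.
by apply/rowP => j; rewrite !mxE; ring: cd.
Qed.

Lemma plane_refl c d : c * d = 1 ->
  <|e + c *: f, e + c *: f|> * (hf S * d) = 1.
Proof.
move=> cd; rewrite !bilE !plane.
apply: (@etrans _ _ ((2%:R * hf S) * (c * d))); first by ring.
by rewrite (hf2 axS) cd mulr1.
Qed.

Lemma plane_inM c : inM S (e + c *: f).
Proof. by apply: inM_D; [|apply: inM_Z]; apply: (fr_inM axS frS). Qed.

(** By transitivity u is moved to e + q(u) f, so the reflection in u is a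
conjugate of a swap under the elementary group, which the swap normalizes. *)
Lemma refl_reduce u c : inM S u -> <|u, u|> * c = 1 ->
  exists c1 d1 g,
    [/\ FE g, c1 * d1 = 1, isom S (swap c1 d1) & refl S u c = swap c1 d1 *m g].
Proof.
move=> Mu uc.
have [|g Eg ug] := unimodular_transitive axS frS locL a (y := u) Mu; first by exists c.
have [g' Eg' gg'] := FE_inv axS frS Eg; have Ig := FE_isom axS frS Eg.
pose q := hf S * <|u, u|>; pose d := 2%:R * c.
have qd : q * d = 1.
  have -> : q * d = (2%:R * hf S) * (<|u, u|> * c) by rewrite /q /d; ring.
  by rewrite (hf2 axS) uc mulr1.
pose s := swap (- q) (- d).
have sE : g' *m refl S u c *m g = s.
  rewrite (refl_conj _ _ gg' Ig) ug /qf -/q /s -refl_swap //; congr refl.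
  by rewrite /d mulrCA mulrA (hf2 axS) mul1r.
have ss : s *m s = 1%:M.
  rewrite /s swap_swap -(mulrNN q) in qd *.
  by rewrite qd mulrC qd tor1.
have Is : isom S s.
  rewrite /s -refl_swap //; apply: (refl_isom axS); first exact: plane_inM.
  exact: plane_refl.
exists (- q), (- d), ((s *m g *m s) *m g'); split.
- apply: gen_mul => //; exact: (local_normal1 axS frS locL Is ss).
- by rewrite mulrNN.
- exact: Is.
rewrite -/s !mulmxA ss mul1mx -sE !mulmxA gg' mul1mx -mulmxA.
by rewrite gg' mulmx1.
Qed.

(** Multiply the reductions of the reflections.  The determinant counts their
parity, which separates diagonal from antidiagonal. *)
Lemma isom_reduce g : isom S g -> exists t h, [/\ g = t *m h, FE h, isom S t &
  (exists c c', c * c' = 1 /\ t = tor c c') /\ \det g = 1 \/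
  (exists c c', c * c' = 1 /\ t = swap c c') /\ \det g = -1].
Proof.
move=> /(isom_reflections axS locL).
elim=> [|r g1 [u [c [Mu uc ->]]] _ [t [h [-> Eh It Ht]]]].
  exists 1%:M, 1%:M; split; rewrite ?mulmx1 //; [exact: gen1|exact: isom1|left].
  by rewrite det1; split=> //; exists 1, 1; rewrite mulr1 tor1.
have [c1 [d1 [h1 [Eh1 cd1 Is re]]]] := refl_reduce Mu uc.
have [t' tt'] : exists t', t *m t' = 1%:M.
  have Et := isom_reflections axS locL It.
  by have [t' _ e] := Rgen_inv Et; exists t'.
exists (swap c1 d1 *m t), ((t' *m h1 *m t) *m h); split.
- rewrite re !mulmxA -(mulmxA (swap c1 d1) t t') tt' mulmx1.
  by [].
- apply: gen_mul => //; exact: (local_normal1 axS frS locL It tt').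
- exact: isomM.
rewrite det_mulmx (refl_det uc); case: Ht => [[[c2 [d2 [cd2 ->]]] ->]|[[c2 [d2 [cd2 ->]]] ->]].
  right; rewrite mulN1r; split=> //; rewrite swap_tor; exists (c1 * d2), (d1 * c2).
  by rewrite mulrACA cd1 mulrC mulr1 mulrC cd2.
left; rewrite mulrNN mulr1; split=> //; rewrite swap_swap; exists (c1 * d2), (d1 * c2).
by rewrite mulrACA cd1 mulrC mulr1 mulrC cd2.
Qed.

(** Modulo the normal subgroup of the elementary matrices g and h are diagonal in
the a-th plane, hence commute. *)
Theorem local_commutator g g' h h' : isom S g -> isom S h ->
  g *m g' = 1%:M -> h *m h' = 1%:M -> \det g = 1 -> \det h = 1 ->
  FE (g' *m h' *m g *m h).
Proof.
move=> Ig Ih gg' hh' dg dh.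
have two0 : (1 : L) <> -1.
  move=> e1; have := hf2 axS.
  have -> : 2%:R * hf S = (1 - (-1)) * hf S by ring.
  by rewrite -e1 subrr mul0r => /esym/eqP; rewrite oner_eq0.
have [t [x [gE Ex It Ht]]] := isom_reduce Ig.
have [s [y [hE Ey Is Hs]]] := isom_reduce Ih.
have [[c [c' [cc' tE]]] _] : (exists c c', c * c' = 1 /\ t = tor c c') /\ \det g = 1.
  by case: Ht => // -[_]; rewrite dg.
have [[d [d' [dd' sE]]] _] : (exists c c', c * c' = 1 /\ s = tor c c') /\ \det h = 1.
  by case: Hs => // -[_]; rewrite dh.
have st : s *m t = t *m s by rewrite tE sE !tor_tor (mulrC d) (mulrC d').
pose t1 := tor c' c; pose s1 := tor d' d.
have tt1 : t *m t1 = 1%:M by rewrite tE tor_tor cc' mulrC cc' tor1.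
have ss1 : s *m s1 = 1%:M by rewrite sE tor_tor dd' mulrC dd' tor1.
have ghE : g *m h = (t *m s) *m ((s1 *m x *m s) *m y).
  by rewrite gE hE !mulmxA -(mulmxA t s s1) ss1 mulmx1.
have hgE : h *m g = (t *m s) *m ((t1 *m y *m t) *m x).
  by rewrite gE hE -st !mulmxA -(mulmxA s t t1) tt1 mulmx1.
have E1 : FE ((s1 *m x *m s) *m y).
  by apply: gen_mul => //; apply: (local_normal1 axS frS locL Is ss1).
have E2 : FE ((t1 *m y *m t) *m x).
  by apply: gen_mul => //; apply: (local_normal1 axS frS locL It tt1).
have [z Ez E2z] := FE_inv axS frS E2.
have -> : g' *m h' *m g *m h = z *m ((s1 *m x *m s) *m y); last exact: gen_mul.
have hgV : (h *m g) *m (g' *m h') = 1%:M.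
  by rewrite mulmxA -(mulmxA h) gg' mulmx1.
have hgV' : (h *m g) *m (z *m (s1 *m t1)) = 1%:M.
  rewrite hgE mulmxA -(mulmxA (t *m s)) E2z mulmx1.
  by rewrite mulmxA -(mulmxA t) ss1 mulmx1.
rewrite -mulmxA ghE (inv_uniq hgV hgV').
rewrite -(mulmxA z) (mulmxA (s1 *m t1)).
have -> : s1 *m t1 *m (t *m s) = 1%:M.
  by rewrite -mulmxA (mulmxA t1) (mulmx1C tt1) mul1mx (mulmx1C ss1).
by rewrite mul1mx.
Qed.

End LocalCommutators.

(** * Relative elementary matrices, normality and commutators *)

Section RelativeSplit.
Variables (R : comNzRingType) (N : nat) (S0 : hspace R N).
Hypothesis axS0 : space_axioms S0.
Local Notation S := (smap (@polyC R) S0).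
Let axS : space_axioms S := smap_axioms _ axS0.

(** Matrix counterparts of the generators of the normal closure of the elementary
group of the ideal (X); see [EOrelgen_EO_rel]. *)
Definition EOrelgen (g : 'M[{poly R}]_N) : Prop :=
  exists h h' x z, [/\ EOm S h, h *m h' = 1%:M, lagr S x, inQ S z &
    g = h' *m eich S x ('X *: z) *m h].

Lemma EOrel_conj h h' g : EOm S h -> h *m h' = 1%:M ->
  gen EOrelgen g -> gen EOrelgen (h' *m g *m h).
Proof.
move=> Eh hh'; apply: gen_conj => // _ [k [k' [x [z [Ek kk' lx Qz ->]]]]].
apply: gen_in; exists (k *m h), (h' *m k'), x, z; split=> //.
- exact: gen_mul.
- by rewrite mulmxA -(mulmxA k) hh' mulmx1.
- by rewrite !mulmxA.
Qed.

Lemma EOrel_eich x z : lagr S x -> inQ S z -> gen EOrelgen (eich S x ('X *: z)).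
Proof.
move=> lx Qz; apply: gen_in; exists 1%:M, 1%:M, x, z.
by split; rewrite ?mulmx1 ?mul1mx //; apply: gen1.
Qed.


(** Induction on the word for g, with h the inverse of g(0).  In the first letter
E(x, z) both entries are split as constant term plus 'X times the rest; by
[eich_sum] and [eich_comm] everything but E(x(0), z(0)) is a product of
conjugates of transvections with a factor 'X, and the constant letter conjugates
the remaining word. *)
Lemma EO_rel_split g : EOm S g -> forall h, map_mx (psub 0) g *m h = 1%:M ->
  gen EOrelgen (g *m h).
Proof.
have Sp : smap (psub 0) S = S by apply: smap_psub.
elim=> [|e g1 [x [z [lx Qz ->]]] _ IH] h.
  by rewrite map_mx1 mul1mx => ->; apply: gen1.
set e0 := map_mx (psub 0) (eich S x z).
rewrite map_mxM -/e0 -mulmxA => e1.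
have e2 := mulmx1C e1; rewrite -mulmxA in e2; have {}IH := IH _ e2.
pose x0 := map_mx (psub 0) x; pose z0 := map_mx (psub 0) z.
have e0E : e0 = eich S x0 z0 by rewrite /e0 eich_map Sp.
have lx0 : lagr S x0 by have := lagr_map (psub 0) lx; rewrite Sp.
have Qz0 : inQ S z0 by have := inQ_map (psub 0) Qz; rewrite Sp.
have iso y w : lagr S y -> inQ S w -> bil S y w = 0 by apply: bil_lagrQ.
have e0V : eich S x0 (- z0) *m e0 = 1%:M.
  by rewrite e0E; apply: mulmx1C; apply: (eichN axS); [apply: (lagr_iso axS)|apply: iso].
have Ee0 : EOm S e0 by rewrite e0E; apply: gen_in; exists x0, z0.
have Ee0' : EOm S (eich S x0 (- z0)).
  by apply: gen_in; exists x0, (- z0); split=> //; apply: inQ_N.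
set e0' := eich S x0 (- z0) in e0V Ee0'.
have -> : eich S x z *m g1 *m h = (e0 *m (e0' *m eich S x z) *m e0') *m (e0 *m (g1 *m (h *m e0)) *m e0').
  rewrite !mulmxA (mulmx1C e0V) mul1mx -(mulmxA (eich S x z) e0' e0) e0V mulmx1.
  by rewrite -(mulmxA _ e0 e0') (mulmx1C e0V) mulmx1.
apply: gen_mul; apply: EOrel_conj => //.
have [z1 Qz1 zE] : exists2 z1, inQ S z1 & z = z0 + 'X *: z1.
  have [z1 ez] := mx_poly_split z; exists (z1 *m prQ S).
    by rewrite /inQ -mulmxA (prQQ axS).
  rewrite scalemxAl; have -> : 'X *: z1 = z - z0 by rewrite {1}ez addrK.
  by rewrite mulmxBl Qz Qz0 addrC subrK.
have [x1 [lx1 x1x0 xE]] : exists x1, [/\ lagr S x1, bil S x1 x0 = 0 & x = x0 + 'X *: x1].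
  have [x1 ex] := mx_poly_split x.
  have e' : 'X *: x1 = x - x0 by rewrite {1}ex addrK.
  have x0P : x *m prP S = x -> x0 *m prP S = x0.
    move/(congr1 (map_mx (psub 0))).
    by rewrite map_mxM -[map_mx _ (prP S)]/(prP (smap (psub 0) S)) Sp.
  have x0D : x *m prD S = x -> x0 *m prD S = x0.
    move/(congr1 (map_mx (psub 0))).
    by rewrite map_mxM -[map_mx _ (prD S)]/(prD (smap (psub 0) S)) Sp.
  case: lx => lx.
    exists (x1 *m prP S); split.
    - by left; rewrite -mulmxA (prPP axS).
    - by rewrite (bil_prP axS) -x0P // -mulmxA (prPD axS) mulmx0 bil0r.
    - by rewrite scalemxAl e' mulmxBl lx x0P // addrC subrK.
  exists (x1 *m prD S); split.
  - by right; rewrite -mulmxA (prDD axS).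
  - by rewrite (bil_prD axS) -x0D // -mulmxA (prDP axS) mulmx0 bil0r.
  - by rewrite scalemxAl e' mulmxBl lx x0D // addrC subrK.
have Ex1 w : inQ S w -> gen EOrelgen (eich S ('X *: x1) w).
  by move=> Qw; rewrite eichZ; apply: EOrel_eich.
have lX : lagr S ('X *: x1) by apply: lagr_Z.
have Qhz : inQ S (hf S *: z) by apply: inQ_Z.
have xx0 : bil S x0 x0 = 0 by apply: (lagr_iso axS).
have xxX : bil S ('X *: x1) ('X *: x1) = 0 by apply: (lagr_iso axS).
have xX0 : bil S ('X *: x1) x0 = 0 by rewrite bilZl x1x0 mulr0.
have QXz1 : inQ S ('X *: z1) by apply: inQ_Z.
rewrite xE (eich_sum axS) ?(iso x0 z) ?(iso ('X *: x1) z) //.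
have -> : eich S x0 z = eich S x0 z0 *m eich S x0 ('X *: z1).
  have i0 : bil S x0 z0 = 0 by apply: iso.
  have i1 : bil S x0 ('X *: z1) = 0 by apply: iso.
  by rewrite (eichD axS xx0 i0 i1) -zE.
rewrite !mulmxA -e0E e0V mul1mx; apply: gen_mul; first apply: gen_mul.
- exact: EOrel_eich.
- exact: Ex1.
rewrite (eich_comm axS) ?(iso x0 z) ?(iso x0 (hf S *: z)) ?(iso ('X *: x1) z) ?(iso ('X *: x1) (hf S *: z)) //.
apply: gen_mul; first by apply/Ex1/inQ_N.
apply: EOrel_conj; last exact: Ex1.
  by apply: gen_in; exists x0, (hf S *: z).
by apply: (eichN axS); rewrite ?(iso x0 (hf S *: z)).
Qed.

End RelativeSplit.

(** [local_normal] in terms of the frame-free generators. *)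
Lemma local_normal_EO (L : comNzRingType) N (S : hspace L N) m
    (fr : 'I_m * bool -> 'rV[L]_N) u c (L' : comNzRingType)
    (k : {rmorphism L -> L'}) g g' h :
  space_axioms S -> frame S fr u c -> is_local L -> isom S g -> g *m g' = 1%:M ->
  EOm (smap k S) h -> EOm (smap k S) (map_mx k g' *m h *m map_mx k g).
Proof.
move=> axS frS locL Ig gg' Eh; apply: (FE_EO (frame_map k frS)).
apply: (local_normal axS frS locL Ig gg').
exact: (EO_FE (smap_axioms k axS) (frame_map k frS)).
Qed.

Lemma commutator_inv (B : comNzRingType) N (a a' b b' : 'M[B]_N) :
  a *m a' = 1%:M -> b *m b' = 1%:M ->
  (a' *m b *m a *m b') *m (b *m a' *m b' *m a) = 1%:M.
Proof.
move=> aa' bb'; rewrite -!mulmxA (mulmxA b' b) (mulmx1C bb') mul1mx.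
by rewrite (mulmxA a a') aa' mul1mx (mulmxA b b') bb' mul1mx (mulmx1C aa').
Qed.

Lemma map_horner_polyC (B : comNzRingType) m n (c : B) (M : 'M[B]_(m, n)) :
  map_mx (horner_eval c) (map_mx polyC M) = M.
Proof. by apply/matrixP => i j; rewrite !mxE /horner_eval hornerC. Qed.

Lemma smap_horner_polyC (B : comNzRingType) N (c : B) (S : hspace B N) :
  smap (horner_eval c) (smap polyC S) = S.
Proof.
apply: hspace_eq => /=; rewrite ?map_horner_polyC //.
by rewrite /horner_eval hornerC.
Qed.

Section Global.
Variables (R : comNzRingType) (N : nat) (S : hspace R N).
Hypothesis axS : space_axioms S.
Hypothesis frames : forall (L : comNzRingType) (chi : {rmorphism R -> L}),
  is_local L -> exists m (fr : 'I_m * bool -> 'rV_N) u c, frame (smap chi S) fr u c.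

(** It suffices to conjugate a generator E(x, z), which is joined to 1 by
E(x, Tz).  The matrix g^-1 E(x,Tz) g E(x,Tz)^-1 is 1 at T = 0 and elementary over
every B_m[T] by [local_normal]. *)
Lemma EO_normal (B : comNzRingType) (psi : {rmorphism R -> B}) g g' h :
  isom (smap psi S) g -> g *m g' = 1%:M ->
  EOm (smap psi S) h -> EOm (smap psi S) (g' *m h *m g).
Proof.
set T := smap psi S => Ig gg'.
have axT : space_axioms T by apply: smap_axioms.
apply: gen_conj => // _ [x [z [lx Qz ->]]].
have xz : bil T x z = 0 by apply: bil_lagrQ.
have xx : bil T x x = 0 by apply: (lagr_iso axT).
pose T1 := smap polyC T; have axT1 : space_axioms T1 by apply: smap_axioms.
pose cm k l (M : 'M[B]_(k, l)) := map_mx polyC M.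
have c_xx : bil T1 (cm _ _ x) (cm _ _ x) = 0 by rewrite bil_map xx.
have c_xz a : bil T1 (cm _ _ x) (a *: cm _ _ z) = 0.
  by rewrite bilZr bil_map xz mulr0.
pose E := eich T1 (cm _ _ x) ('X *: cm _ _ z).
pose E' := eich T1 (cm _ _ x) (- ('X *: cm _ _ z)).
have EE' : E *m E' = 1%:M by apply: (eichN axT1).
have c_gg' : cm _ _ g *m cm _ _ g' = 1%:M by rewrite -map_mxM gg' map_mx1.
pose sig := cm _ _ g' *m E *m cm _ _ g *m E'.
pose sig' := E *m cm _ _ g' *m E' *m cm _ _ g.
have sigV : sig *m sig' = 1%:M by apply: commutator_inv.
have hX c : horner_eval c ('X : {poly B}) = c by rewrite /horner_eval hornerX.
have evE c : map_mx (horner_eval c) E = eich T x (c *: z).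
  by rewrite /E eich_map map_mxZ smap_horner_polyC /= hX !map_horner_polyC.
have evE' c : map_mx (horner_eval c) E' = eich T x (- (c *: z)).
  by rewrite /E' eich_map map_mxN map_mxZ smap_horner_polyC /= hX !map_horner_polyC.
have evc c k l (M : 'M_(k, l)) : map_mx (horner_eval c) (cm _ _ M) = M.
  exact: map_horner_polyC.
have sig0 : map_mx (psub 0) sig = 1%:M.
  have -> : map_mx (psub 0) sig = cm _ _ (map_mx (horner_eval 0) sig).
    apply/matrixP => i j; rewrite !mxE /psub /= comp_poly0r.
    by rewrite /horner_eval horner_coef0.
  rewrite !map_mxM !evc evE evE' scale0r oppr0 eich0 mulmx1 mulmx1.
  by rewrite (mulmx1C gg') /cm map_mx1.
suff : forall I (hI : maximal_ideal I),
  let phi := @to_loc B (prime_of_maximal hI) in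
  (exists m (fr : 'I_m * bool -> 'rV_N) u c, frame (smap phi T) fr u c) /\
  EOm (smap polyC (smap phi T)) (map_mx (map_poly phi) sig).
  move=> locEO; have := local_global axT sigV sig0 locEO.
  rewrite !map_mxM !evc evE evE' scale1r => Es.
  have -> : g' *m eich T x z *m g =
      (g' *m eich T x z *m g *m eich T x (- z)) *m eich T x z.
    by rewrite -(mulmxA _ (eich T x (- z))) (mulmx1C (eichN axT xx xz)) mulmx1.
  by apply: gen_mul => //; apply: gen_in; exists x, z.
move=> I hI phi.
have [m [fr [u [c]]]] := frames (phi \o psi) (localization_local (p := prime_of_maximal hI)).
rewrite -(@smap_comp _ _ _ psi phi (phi \o psi) _ S) // -/T => frL.
split; first by exists m, fr, u, c.
have EE : EOm T1 E.
  apply: gen_in; exists (cm _ _ x), ('X *: cm _ _ z); split=> //.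
    exact: lagr_map.
  exact/inQ_Z/inQ_map.
have EEL : EOm (smap polyC (smap phi T)) (map_mx (map_poly phi) E).
  by rewrite -smap_phiX; apply: EOm_map.
have cmL k l (M : 'M_(k, l)) : map_mx (map_poly phi) (cm _ _ M) = map_mx polyC (map_mx phi M).
  by apply/matrixP => i j; rewrite !mxE /= map_polyC.
have axL : space_axioms (smap phi T) by apply: smap_axioms.
rewrite !map_mxM !cmL; apply: gen_mul.
  apply: (local_normal_EO axL frL) => //.
  - exact: localization_local.
  - exact: isom_map.
  - by rewrite -map_mxM gg' map_mx1.
apply: (EOm_inverse _ EEL); last by rewrite -map_mxM EE' map_mx1.
exact: smap_axioms.
Qed.

Definition loc_EO (B : comNzRingType) (psi : {rmorphism R -> B}) (g : 'M[B]_N) :=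
  forall I (hI : maximal_ideal I), let phi := @to_loc B (prime_of_maximal hI) in
  EOm (smap phi (smap psi S)) (map_mx phi g).

Lemma local_frames (B : comNzRingType) (psi : {rmorphism R -> B})
    (p : prime_idealr B) : let phi := @to_loc B p in
  exists m (fr : 'I_m * bool -> 'rV_N) u c, frame (smap phi (smap psi S)) fr u c.
Proof.
move=> phi; have [m [fr [u [c]]]] := frames (phi \o psi) (localization_local (p := p)).
by rewrite -(@smap_comp _ _ _ psi phi (phi \o psi)) // => frL; exists m, fr, u, c.
Qed.

Lemma loc_EO_commutator (B : comNzRingType) (psi : {rmorphism R -> B}) g g' h h' :
  isom (smap psi S) g -> isom (smap psi S) h ->
  g *m g' = 1%:M -> h *m h' = 1%:M -> \det g = 1 -> \det h = 1 ->
  loc_EO psi (g' *m h' *m g *m h).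
Proof.
move=> Ig Ih gg' hh' dg dh I hI phi.
have axT : space_axioms (smap psi S) by apply: smap_axioms.
have [m [fr [u [c frL]]]] := local_frames psi (prime_of_maximal hI).
rewrite !map_mxM; apply: (FE_EO frL).
have m0 : (0 < m)%N by apply: ltnW (fr_m frL).
have locL := localization_local (p := prime_of_maximal hI).
apply: (local_commutator (smap_axioms phi axT) frL locL (Ordinal m0, true)).
- exact: isom_map.
- exact: isom_map.
- by rewrite -map_mxM gg' map_mx1.
- by rewrite -map_mxM hh' map_mx1.
- by rewrite det_map_mx dg rmorph1.
- by rewrite det_map_mx dh rmorph1.
Qed.

(** The commutator of g with h(XT) joins 1 to the commutator of g with h.  At a
localization of R[X] the matrix g is elementary, and its conjugate by h(XT) is
too, by [EO_normal] over the polynomial ring of that localization. *)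
Theorem commutator_EO g g' h h' :
  let T := smap (@polyC R) S in
  isom T g -> isom T h -> g *m g' = 1%:M -> h *m h' = 1%:M ->
  loc_EO polyC g -> map_mx (psub 0) h = 1%:M ->
  EOm T (g' *m h' *m g *m h).
Proof.
move=> T Ig Ih gg' hh' locg h0.
have axT : space_axioms T by apply: smap_axioms.
(* The substitution X := X T, from R[X] to R[X][T]. *)
pose tw := ev (polyCC R) ('X%:P * 'X).
have twC (b : R) : tw b%:P = b%:P%:P by exact: evC.
have twX : tw 'X = 'X%:P * 'X by exact: evX.
pose cm (M : 'M[{poly R}]_N) := map_mx polyC M.
pose sig := cm g' *m map_mx tw h' *m cm g *m map_mx tw h.
pose sig' := map_mx tw h' *m cm g' *m map_mx tw h *m cm g.
have c_gg' : cm g *m cm g' = 1%:M by rewrite -map_mxM gg' map_mx1.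
have t_hh' : map_mx tw h *m map_mx tw h' = 1%:M by rewrite -map_mxM hh' map_mx1.
have sigV : sig *m sig' = 1%:M by exact: (commutator_inv c_gg' (mulmx1C t_hh')).
have h'0 : map_mx (psub 0) h' = 1%:M.
  by rewrite -[LHS]mul1mx -h0 -map_mxM hh' map_mx1.
have tw0 (M : 'M_N) : map_mx (psub 0) (map_mx tw M) = cm (map_mx (psub 0) M).
  apply/matrixP => r s; rewrite !mxE; move: (M r s).
  have := @poly_hom_ext _ _ (psub 0 \o tw) (polyC \o psub 0); apply=> /=.
    by move=> a; rewrite twC !psubC.
  by rewrite twX rmorphM /= psubC !psubX mulr0.
have tw1 (M : 'M_N) : map_mx (horner_eval 1) (map_mx tw M) = M.
  apply/matrixP => r s; rewrite !mxE; move: (M r s).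
  have := @poly_hom_ext _ _ (horner_eval 1 \o tw) idfun; apply=> /=.
    by move=> a; rewrite twC /horner_eval hornerC.
  by rewrite twX rmorphM /= /horner_eval hornerC hornerX mulr1.
have cm1 (M : 'M_N) : map_mx (horner_eval 1) (cm M) = M.
  exact: map_horner_polyC.
have sig0 : map_mx (psub 0) sig = 1%:M.
  rewrite !map_mxM !tw0 h0 h'0 !psub_const /cm !map_mx1 !mulmx1.
  exact: mulmx1C.
suff : forall I (hI : maximal_ideal I),
  let phi := @to_loc _ (prime_of_maximal hI) in
  (exists m (fr : 'I_m * bool -> 'rV_N) u c, frame (smap phi T) fr u c) /\
  EOm (smap polyC (smap phi T)) (map_mx (map_poly phi) sig).
  move=> locEO; have := local_global axT sigV sig0 locEO.
  by rewrite !map_mxM !cm1 !tw1.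
move=> I hI phi; split; first exact: local_frames.
have Eg : EOm (smap polyC (smap phi T)) (map_mx polyC (map_mx phi g)).
  by apply: EOm_map; apply: locg.
have axL : space_axioms (smap polyC (smap phi T)) by do 2!apply: smap_axioms.
have cmL (M : 'M_N) : map_mx (map_poly phi) (cm M) = map_mx polyC (map_mx phi M).
  by apply/matrixP => i j; rewrite !mxE /= map_polyC.
pose psi : {rmorphism R -> {poly localization (prime_of_maximal hI)}} :=
  polyC \o (phi \o polyC).
have TE : smap polyC (smap phi T) = smap psi S by exact: smap_comp3.
have TE' : smap (map_poly phi) (smap tw T) = smap psi S.
  by apply: smap_comp3 => b; rewrite twC /= !map_polyC.
have It : isom (smap psi S) (map_mx (map_poly phi) (map_mx tw h)).
  by rewrite -TE'; apply: isom_map; [apply: smap_axioms|apply: isom_map].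
rewrite /sig -!(mulmxA (cm g')) map_mxM !cmL; apply: gen_mul.
  apply: (EOm_inverse axL Eg).
  by rewrite -!map_mxM gg' !map_mx1.
have hV : map_mx (map_poly phi) (map_mx tw h) *m
    map_mx (map_poly phi) (map_mx tw h') = 1%:M.
  by rewrite -!map_mxM hh' !map_mx1.
by rewrite TE in Eg *; rewrite !map_mxM cmL; exact: (EO_normal It hV Eg).
Qed.

End Global.

(** * Coordinates on projective modules and on their extensions *)

(** Lift the identity along the surjection given by a finite generating family. *)
Lemma fg_projective_retract (A : comNzRingType) (M : lmodType A) :
  finitely_generated M -> projective M ->
  exists k (i : {linear M -> 'rV[A]_k}) (p : {linear 'rV[A]_k -> M}), cancel i p.
Proof.
move=> [k [e He]] proj.
have lg : linear (fun v : 'rV[A]_k => \sum_j v 0 j *: e j).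
  move=> a u v; rewrite scaler_sumr -big_split; apply: eq_bigr => j _.
  by rewrite !mxE scalerDl scalerA.
pose g : {linear 'rV[A]_k -> M} := HB.pack (fun v : 'rV[A]_k => \sum_j v 0 j *: e j)
  (GRing.isLinear.Build _ _ _ _ _ lg).
have lid : linear (@id M) by [].
pose f : {linear M -> M} := HB.pack (@id M) (GRing.isLinear.Build _ _ _ _ _ lid).
have [|i Hi] := proj _ _ g f.
  move=> x; have [c ->] := He x; exists (\row_j c j).
  by apply: eq_bigr => j _; rewrite mxE.
by exists k, i, g.
Qed.

Definition idem_mx (A : comNzRingType) (M : lmodType A) k
    (i : {linear M -> 'rV[A]_k}) (p : {linear 'rV[A]_k -> M}) : 'M[A]_k :=
  lin1_mx (i \o p).

Lemma mul_idem_mx (A : comNzRingType) (M : lmodType A) k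
    (i : {linear M -> 'rV[A]_k}) (p : {linear 'rV[A]_k -> M}) v :
  v *m idem_mx i p = i (p v).
Proof. exact: (mul_rV_lin1 (i \o p)). Qed.

Section ExtCoord.
Variables (A B : comNzRingType) (phi : {rmorphism A -> B}) (M : lmodType A).
Variables (k : nat) (i : {linear M -> 'rV[A]_k}) (p : {linear 'rV[A]_k -> M}).
Hypothesis ip : cancel i p.
Local Notation ext := (extension phi M).

Definition tens (x : M) : ext := \pi_(extension phi M) [:: (1, x)].

Lemma ext_pi_cat s t : \pi_ext (s ++ t) = \pi_ext s + \pi_ext t.
Proof. by rewrite -[RHS]/(ext_add _ _) ext_addE. Qed.

Lemma ext_pi_nil : \pi_ext [::] = 0.
Proof. by rewrite -[RHS]/(ext_zero _ _) ext_zeroE. Qed.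

Lemma scale_tens b x : b *: tens x = \pi_ext [:: (b, x)].
Proof. by rewrite -[LHS]/(ext_scale _ _) ext_scaleE /scale_seq /= mulr1. Qed.

Lemma ext_pi_sum s : \pi_ext s = \sum_(u <- s) u.1 *: tens u.2.
Proof.
elim: s => [|[b x] s IH]; first by rewrite big_nil ext_pi_nil.
by rewrite big_cons -cat1s ext_pi_cat IH scale_tens.
Qed.

Lemma tensD x y : tens (x + y) = tens x + tens y.
Proof.
by rewrite /tens -ext_pi_cat; apply/ext_eqP; apply: TensorAddr.
Qed.

Lemma tensZ r x : tens (r *: x) = phi r *: tens x.
Proof.
rewrite scale_tens; apply/ext_eqP; rewrite -[phi r]mul1r; exact: TensorScale.
Qed.

Lemma tens0 : tens 0 = 0.
Proof. by rewrite -(scale0r 0) tensZ rmorph0 scale0r. Qed.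

Lemma tens_sum I r (P : pred I) (F : I -> M) :
  tens (\sum_(j <- r | P j) F j) = \sum_(j <- r | P j) tens (F j).
Proof. by elim/big_rec2: _ => [|j x y _ <-]; rewrite ?tens0 ?tensD. Qed.

Definition seq_coord (s : seq (B * M)) : 'rV[B]_k :=
  \sum_(u <- s) u.1 *: map_mx phi (i u.2).

Lemma seq_coord_eq s t : tensor_eq phi s t -> seq_coord s = seq_coord t.
Proof.
rewrite /seq_coord; elim=> {s t} //=.
- by move=> s t w _ -> _ ->.
- by move=> s s' t t' _ h _ h'; rewrite !big_cat /= h h'.
- by move=> s t; rewrite !big_cat /= addrC.
- by move=> x; rewrite big_seq1 big_nil scale0r.
- by move=> a b x; rewrite !big_cons !big_nil !addr0 scalerDl.
- by move=> b x y; rewrite !big_cons !big_nil !addr0 /= linearD map_mxD scalerDr.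
- by move=> b r x; rewrite !big_seq1 /= linearZ map_mxZ scalerA.
Qed.

Definition ext_coord (x : ext) : 'rV[B]_k := seq_coord (repr x).

Lemma ext_coordE s : ext_coord (\pi_ext s) = seq_coord s.
Proof. exact/esym/seq_coord_eq/ext_repr. Qed.

Lemma ext_coord_linear : linear ext_coord.
Proof.
move=> a; elim/quotW=> s; elim/quotW=> t.
rewrite -[X in X + _]/(ext_scale _ _) ext_scaleE -ext_pi_cat !ext_coordE.
rewrite /seq_coord big_cat /= /scale_seq big_map scaler_sumr.
by congr (_ + _); apply: eq_bigr => u _; rewrite scalerA.
Qed.
HB.instance Definition _ :=
  GRing.isLinear.Build B ext 'rV[B]_k *:%R ext_coord ext_coord_linear.

Definition ext_proj (v : 'rV[B]_k) : ext := \sum_j v 0 j *: tens (p (delta_mx 0 j)).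

Lemma ext_proj_linear : linear ext_proj.
Proof.
move=> a u v; rewrite scaler_sumr -big_split; apply: eq_bigr => j _.
by rewrite !mxE scalerDl scalerA.
Qed.
HB.instance Definition _ :=
  GRing.isLinear.Build B 'rV[B]_k ext *:%R ext_proj ext_proj_linear.

Lemma ext_coord_sum I r (P : pred I) (F : I -> ext) :
  ext_coord (\sum_(j <- r | P j) F j) = \sum_(j <- r | P j) ext_coord (F j).
Proof. exact: (linear_sum (ext_coord : {linear ext -> 'rV[B]_k})). Qed.
Lemma ext_coordZ b x : ext_coord (b *: x) = b *: ext_coord x.
Proof. exact: (linearZ_LR (ext_coord : {linear ext -> 'rV[B]_k})). Qed.
Lemma ext_proj_sum I r (P : pred I) (F : I -> 'rV[B]_k) :
  ext_proj (\sum_(j <- r | P j) F j) = \sum_(j <- r | P j) ext_proj (F j).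
Proof. exact: (linear_sum (ext_proj : {linear 'rV[B]_k -> ext})). Qed.
Lemma ext_projZ b x : ext_proj (b *: x) = b *: ext_proj x.
Proof. exact: (linearZ_LR (ext_proj : {linear 'rV[B]_k -> ext})). Qed.

Lemma ext_proj_map v : ext_proj (map_mx phi v) = tens (p v).
Proof.
rewrite {2}[v]row_sum_delta linear_sum tens_sum; apply: eq_bigr => j _.
by rewrite linearZ tensZ mxE.
Qed.

Lemma ext_coord_tens x : ext_coord (tens x) = map_mx phi (i x).
Proof. by rewrite ext_coordE /seq_coord big_seq1 scale1r. Qed.

Lemma ext_coordK : cancel ext_coord ext_proj.
Proof.
elim/quotW=> s; rewrite ext_pi_sum ext_coord_sum ext_proj_sum.
apply: eq_bigr => u _.
by rewrite ext_coordZ ext_projZ ext_coord_tens ext_proj_map ip.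
Qed.

Lemma ext_projK v : ext_coord (ext_proj v) = v *m map_mx phi (idem_mx i p).
Proof.
rewrite ext_coord_sum {2}[v]row_sum_delta mulmx_suml; apply: eq_bigr => j _.
rewrite ext_coordZ ext_coord_tens -scalemxAl; congr (_ *: _).
by rewrite -mul_idem_mx -(map_delta_mx phi) -map_mxM.
Qed.

Lemma ext_idem_mx : idem_mx ext_coord ext_proj = map_mx phi (idem_mx i p).
Proof. by apply: mx_ext => v; rewrite mul_idem_mx; exact: ext_projK. Qed.

End ExtCoord.

Section Rank.
Variables (R : comNzRingType) (M : lmodType R) (n : nat).
Hypothesis M_rank : has_rank M n.
Variables (k : nat) (i : {linear M -> 'rV[R]_k}) (p : {linear 'rV[R]_k -> M}).
Hypothesis ip : cancel i p.

(** V *m U is the idempotent by definition of the coordinates V of the standard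
vectors; U *m V = 1 is the uniqueness of coordinates in a basis. *)
Lemma basis_mx (q : prime_idealr R) :
  exists (U : 'M_(n, k)) (V : 'M_(k, n)),
    U *m V = 1%:M /\ V *m U = map_mx (@to_loc R q) (idem_mx i p).
Proof.
have [e He] := M_rank q; set phi := @to_loc R q in e He *.
have /choice[c Hc] : forall j : 'I_k, exists c : {ffun 'I_n -> localization q},
    ext_proj phi p (delta_mx 0 j) = \sum_i0 c i0 *: e i0.
  by move=> j; have [c [Hc _]] := He (ext_proj phi p (delta_mx 0 j)); exists c.
pose U := \matrix_(a < n) ext_coord i (e a).
pose V := \matrix_(j < k, a < n) c j a.
have rU a : row a U = ext_coord i (e a) by apply: rowK.
have projV v : ext_proj phi p v = \sum_a (v *m V) 0 a *: e a.
  rewrite [v]row_sum_delta ext_proj_sum.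
  under eq_bigr => j _ do rewrite ext_projZ Hc scaler_sumr.
  rewrite exchange_big /=; apply: eq_bigr => a _.
  rewrite mulmx_suml summxE scaler_suml; apply: eq_bigr => j _.
  by rewrite -scalemxAl scalerA -rowE !mxE.
exists U, V; split.
  apply/row_matrixP => a; rewrite row_mul rU.
  have [d [_ uniq]] := He (e a).
  have e1 : e a = \sum_b (ext_coord i (e a) *m V) 0 b *: e b.
    by rewrite -projV ext_coordK.
  have h1 := uniq [ffun b => (ext_coord i (e a) *m V) 0 b].
  have h2 := uniq [ffun b => (a == b)%:R].
  apply/rowP => b; rewrite rowE mulmx1 [RHS]mxE eqxx /=.
  have -> : (ext_coord i (e a) *m V) 0 b = d b.
    rewrite h1 ?ffunE // {1}e1; apply: eq_bigr => b' _; by rewrite ffunE.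
  rewrite h2 ?ffunE 1?eq_sym // (bigD1 a) //= ffunE eqxx scale1r big1 ?addr0 //.
  by move=> b' ba; rewrite ffunE eq_sym (negPf ba) scale0r.
apply: mx_ext => v; rewrite mulmxA -(ext_projK phi) projV ext_coord_sum.
rewrite [v *m V]row_sum_delta mulmx_suml; apply: eq_bigr => a _.
by rewrite ext_coordZ -scalemxAl -rowE rU -row_sum_delta.
Qed.

(** A morphism from R to a local ring L factors through the localization at the
preimage of the nonunits of L; the matrices of [basis_mx] there have numerators
over R and denominators that become units in L. *)
Lemma rank_mx (L : comNzRingType) (chi : {rmorphism R -> L}) : is_local L ->
  exists (U : 'M[L]_(n, k)) (V : 'M[L]_(k, n)),
    U *m V = 1%:M /\ V *m U = map_mx chi (idem_mx i p).
Proof.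
move=> locL.
have [|||J HJ] := @idealr_of R (fun x => ~ isu (chi x)).
- by rewrite rmorph0 => -[z]; rewrite mul0r => /esym/eqP; rewrite oner_eq0.
- by apply; rewrite rmorph1; apply: isu1.
- move=> a x y nx ny; rewrite rmorphD rmorphM => /(isu_add locL)[/isu_r|//]; exact: nx.
have Jpr : prime_idealr_closed (J : {pred R}).
  move=> x y /HJ; rewrite rmorphM => nxy.
  have [hx|hx] := pselect (isu (chi x)); last by apply/orP; left; apply/HJ.
  have [hy|hy] := pselect (isu (chi y)); last by apply/orP; right; apply/HJ.
  by case: nxy; apply: isuM.
pose q : prime_idealr R := HB.pack (J : R -> bool) (Idealr.on J)
  (isPrimeIdealrClosed.Build R J Jpr).
have qu s : s \notin q -> isu (chi s).
  by move=> sq; apply: contrapT => /HJ sJ; move: sq; rewrite sJ.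
have [U [V [UV VU]]] := basis_mx q; have lz := localizing_loc q.
have [s sq [U1 HU]] := lz_num_mx lz U.
have [t tq [V1 HV]] := lz_num_mx lz V.
have e1 : map_mx (@to_loc R q) (U1 *m V1 - (s * t)%:M) = 0.
  rewrite map_mxB map_mxM -HU -HV -scalemxAl -scalemxAr UV scalerA.
  by rewrite scalemx1 map_scalar_mx rmorphM subrr.
have e2 : map_mx (@to_loc R q) (V1 *m U1 - (s * t) *: idem_mx i p) = 0.
  rewrite map_mxB map_mxM map_mxZ -HU -HV -scalemxAl -scalemxAr VU scalerA.
  by rewrite rmorphM mulrC subrr.
have [r1 r1q E1] := lz_ker_mx lz e1; have [r2 r2q E2] := lz_ker_mx lz e2.
have cancel_chi (r : R) a b (X Y : 'M_(a, b)) : r \notin q -> r *: (X - Y) = 0 ->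
    map_mx chi X = map_mx chi Y.
  move=> /qu[z rz] /(congr1 (map_mx chi)); rewrite map_mx0 map_mxZ map_mxB.
  move=> /(congr1 (fun W => z *: W)); rewrite scalerA mulrC rz scale1r scaler0.
  exact: subr0_eq.
have [z sz] := qu _ sq; have [w tw] := qu _ tq.
exists (z *: map_mx chi U1), (w *: map_mx chi V1); split.
  rewrite -scalemxAl -scalemxAr scalerA -map_mxM (cancel_chi _ _ _ _ _ r1q E1).
  rewrite map_scalar_mx scale_scalar_mx rmorphM /= mulrACA (mulrC z) (mulrC w).
  by rewrite sz tw mulr1.
rewrite -scalemxAl -scalemxAr scalerA -map_mxM (cancel_chi _ _ _ _ _ r2q E2).
rewrite map_mxZ scalerA rmorphM /= (mulrC (chi s)) mulrACA (mulrC z) (mulrC w).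
by rewrite sz tw mulr1 scale1r.
Qed.

End Rank.

(** * Products of transvections along one Lagrangian *)

Section Exponential.
Variables (B : comNzRingType) (N : nat) (S : hspace B N).
Hypothesis axS : space_axioms S.
Local Notation "<| x , y |>" := (bil S x y).
Implicit Types (x y z u v w : 'rV[B]_N) (n : 'M[B]_N).

(** The infinitesimal isometry x |-> <x,u> v - <x,v> u.  For the sums of such
maps considered below the cube vanishes, and [expm] is its exponential series. *)
Definition nil2 u v : 'M[B]_N := gram S *m u^T *m v - gram S *m v^T *m u.
Definition expm n : 'M[B]_N := 1%:M + n + hf S *: (n *m n).

Lemma mul_nil2 x u v : x *m nil2 u v = <|x, u|> *: v - <|x, v|> *: u.
Proof. by rewrite /nil2 mulmxBr !mulmxA !bil_mx !mul_scalar_mx. Qed.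

Lemma mul_expm x n : x *m expm n = x + x *m n + hf S *: (x *m n *m n).
Proof. by rewrite /expm !mulmxDr mulmx1 -scalemxAr mulmxA. Qed.

(** The transvection is 1 plus a matrix of rank two, whose determinant is that of
a 2 by 2 matrix, here unitriangular. *)
Lemma eich_det u v : <|u, u|> = 0 -> <|u, v|> = 0 -> \det (eich S u v) = 1.
Proof.
move=> uu uv; have vu : <|v, u|> = 0 by rewrite (bilC axS).
pose C := row_mx (gram S *m u^T) (gram S *m v^T).
pose D := col_mx (v - (hf S * <|v, v|>) *: u) (- u).
have -> : eich S u v = 1%:M + C *m D.
  rewrite /eich /C /D mul_row_col mulmxBr mulmxN -scalemxAr.
  by apply/matrixP => i j; rewrite !mxE; ring.
rewrite sylvester_det /C /D mul_col_row (scalar_mx_block 1 1 1) add_block_mx.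
have e1 : - u *m (gram S *m u^T) = 0 by rewrite mulNmx mulmxA bil_mx uu raddf0 oppr0.
have e2 : - u *m (gram S *m v^T) = 0 by rewrite mulNmx mulmxA bil_mx uv raddf0 oppr0.
have e3 : (v - (hf S * <|v, v|>) *: u) *m (gram S *m u^T) = 0.
  by rewrite mulmxA bil_mx !bilE vu uu mulr0 oppr0 addr0 raddf0.
by rewrite e1 e2 e3 !addr0 det_ublock !det1 mulr1.
Qed.

Lemma EOm_det g : EOm S g -> \det g = 1.
Proof.
elim=> [|g1 g2 [x [z [lx Qz ->]]] _ IH]; first exact: det1.
rewrite det_mulmx IH mulr1; apply: eich_det.
  exact: (lagr_iso axS).
exact: (bil_lagrQ axS).
Qed.

Variable pr : 'M[B]_N.
Hypothesis pr_side : pr = prP S \/ pr = prD S.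

Let pr_lagr x : x *m pr = x -> lagr S x.
Proof. by case: pr_side => ->; [left|right]. Qed.

Let pr_iso x y : x *m pr = x -> y *m pr = y -> <|x, y|> = 0.
Proof.
case: pr_side => -> <- <-.
  by rewrite (bil_prP axS) -mulmxA (prPD axS) mulmx0 bil0r.
by rewrite (bil_prD axS) -mulmxA (prDP axS) mulmx0 bil0r.
Qed.

(** E_alpha is the exponential of a sum of such infinitesimal isometries, with the
u_i in P.  They commute up to terms u_i ^ (v_j n) inside P, so the exponential of
n + nil2 u v is that of n times E(u, v) times E(u, (v n) / 2).  The last factor is
again elementary: it is the commutator of E(u, v / 2) with the exponential of n,
in view of [eich_conj]. *)
Lemma expm_EO I (r : seq I) (u v : I -> 'rV[B]_N) :
  (forall i, u i *m pr = u i) -> (forall i, inQ S (v i)) ->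
  EOm S (expm (\sum_(i <- r) nil2 (u i) (v i))).
Proof.
move=> pu Qv.
pose skew n := [/\ forall x y, <|x *m n, y|> = - <|x, y *m n|>,
   forall x, x *m pr = x -> x *m n = 0 &
   forall z, inQ S z -> z *m n *m pr = z *m n].
have skewE (s : seq I) : skew (\sum_(i <- s) nil2 (u i) (v i)).
  elim: s => [|i s [h1 h2 h3]].
    by rewrite big_nil; split=> *; rewrite ?mulmx0 ?mul0mx // bil0l bil0r oppr0.
  rewrite big_cons; split=> [x y|x px|z Qz].
  - rewrite (mulmxDr x (nil2 _ _)) (mulmxDr y (nil2 _ _)) !bilDl !bilDr h1 !mul_nil2.
    by rewrite !bilE (bilC axS (v i) y) (bilC axS (u i) y); ring.
  - rewrite (mulmxDr x (nil2 _ _)) h2 // addr0 mul_nil2 pr_iso // (bil_lagrQ axS) ?scale0r ?subr0 //.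
    exact: pr_lagr.
  - rewrite (mulmxDr z (nil2 _ _)) mulmxDl h3 //; congr (_ + _); rewrite mul_nil2.
    rewrite (bilC axS) (bil_lagrQ axS) //; last exact: pr_lagr.
    by rewrite scale0r sub0r mulNmx -scalemxAl pu.
elim: r => [|i r IH].
  by rewrite big_nil /expm mulmx0 scaler0 !addr0; apply: gen1.
rewrite big_cons addrC; have [h1 h2 h3] := skewE r.
move: (\sum_(j <- r) _) IH h1 h2 h3 => n En h1 h2 h3.
have uu : <|u i, u i|> = 0 by apply: pr_iso.
have lu : lagr S (u i) by apply: pr_lagr.
have uQ z : inQ S z -> <|u i, z|> = 0 by apply: (bil_lagrQ axS).
have un : u i *m n = 0 by apply: h2.
have Qhv : inQ S (hf S *: v i) by apply: inQ_Z.
have pvn : v i *m n *m pr = v i *m n by apply: h3.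
have vnn : v i *m n *m n = 0 by apply: h2.
have vnvn : <|v i *m n, v i *m n|> = 0 by apply: pr_iso.
have uvn : <|u i, v i *m n|> = 0 by apply: pr_iso.
have vvn : <|v i, v i *m n|> = 0.
  by rewrite (bilC axS) (bil_lagrQ axS) //; apply: pr_lagr.
have xu x : <|x *m n, u i|> = 0 by rewrite h1 un bil0r oppr0.
have Eu z : inQ S z -> EOm S (eich S (u i) z).
  by move=> Qz; apply: gen_in; exists (u i), z.
have uu' : u i *m expm n = u i by rewrite mul_expm un mul0mx scaler0 !addr0.
have vv' : (hf S *: v i) *m expm n = hf S *: v i + hf S *: (v i *m n).
  by rewrite mul_expm -!scalemxAl vnn !scaler0 addr0.
have Euw : EOm S (eich S (u i) (hf S *: (v i *m n))).
  have [g Eg ng] := EOm_inv axS En; have [nO _ _] := EOm_isom axS En.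
  have := eich_conj (u i) (hf S *: v i) ng nO; rewrite uu' vv' => e.
  have -> : eich S (u i) (hf S *: (v i *m n)) =
      eich S (u i) (- (hf S *: v i)) *m (g *m eich S (u i) (hf S *: v i) *m expm n).
    rewrite e (eichD axS) ?bilDr ?bilNr ?bilZr ?(uQ _ (Qv i)) ?uvn ?mulr0 ?oppr0 ?addr0 //.
    by rewrite addKr.
  apply: gen_mul; first exact/Eu/inQ_N.
  apply: gen_mul => //; apply: gen_mul; last exact: Eu.
  exact: (EOm_inverse axS En).
suff -> : expm (n + nil2 (u i) (v i)) =
    expm n *m eich S (u i) (v i) *m eich S (u i) (hf S *: (v i *m n)).
  apply: gen_mul => //; apply: gen_mul => //; exact: Eu.
apply: mx_ext => x; rewrite !mulmxA mul_expm.
have uv : <|u i, v i|> = 0 by apply: uQ.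
have vu : <|v i, u i|> = 0 by rewrite (bilC axS).
have n'E y := mul_nil2 y (u i) (v i).
move: (nil2 (u i) (v i)) n'E => n' n'E.
set w := v i *m n in vnn vnvn uvn vvn *.
have {}xv y : <|y *m n, v i|> = - <|y, w|> by rewrite h1.
have xw y : <|y *m n, w|> = 0 by rewrite h1 vnn bil0r oppr0.
rewrite (mulmxDr x n n') mulmxDr !mulmxDl !n'E xu xv !mulmxBl -!scalemxAl un -/w.
rewrite !bilE uu uv vu mul_expm.
set y := x + x *m n + _.
have yu : <|y, u i|> = <|x, u i|> by rewrite /y !bilE !xu; ring.
have yv : <|y, v i|> = <|x, v i|> - <|x, w|> by rewrite /y !bilE !xv xw; ring.
have yw : <|y, w|> = <|x, w|> by rewrite /y !bilE !xw; ring.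
have yE : y = x + x *m n + hf S *: (x *m n *m n) by [].
clearbody y; rewrite (mul_eich _ y) yu yv.
have vw : <|v i, w|> = 0 by [].
have uw : <|u i, w|> = 0 by [].
rewrite mul_eich !bilE yu uu vu yw vw uw vnvn yE.
apply/rowP => j; rewrite !mxE.
apply: (hf_eq axS (t := <|x, w|> * u i 0 j)); ring.
Qed.

End Exponential.

(** * The matrix model of a quadratic space *)

(** The space Q + P + P^* in coordinates: Q is the image of e with Gram matrix G,
P the image of p, and P^* the image of p^T. *)
Definition model (A : comNzRingType) k l (G Z e : 'M[A]_k) (p : 'M[A]_l) (h : A) :
    hspace A (k + (l + l)) :=
  HSpace (block_mx G 0 0 (block_mx 0 p p^T 0))
    (block_mx Z 0 0 (block_mx 0 p^T p 0))
    (block_mx e 0 0 0) (block_mx 0 0 0 (block_mx p 0 0 0))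
    (block_mx 0 0 0 (block_mx 0 0 0 p^T)) h.

Lemma smap_model (A B : comNzRingType) (f : {rmorphism A -> B}) k l
    (G Z e : 'M[A]_k) (p : 'M[A]_l) h :
  smap f (model G Z e p h) =
  model (map_mx f G) (map_mx f Z) (map_mx f e) (map_mx f p) (f h).
Proof. by apply: hspace_eq => //=; rewrite !map_block_mx ?map_trmx !map_mx0. Qed.

Section Model.
Variables (A : comNzRingType) (k l : nat) (G Z e : 'M[A]_k) (p : 'M[A]_l) (h : A).
Hypothesis G_sym : G^T = G.
Hypothesis ee : e *m e = e.
Hypothesis pp : p *m p = p.
Hypothesis GZ : G *m Z = e.
Hypothesis eG : e *m G = G.
Hypothesis h2 : 2%:R * h = 1.
Local Notation S := (model G Z e p h).

Let Ge : G *m e^T = G.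
Proof. by apply: trmx_inj; rewrite trmx_mul trmxK G_sym eG. Qed.

Let ppT : p^T *m p^T = p^T.
Proof. by rewrite -trmx_mul pp. Qed.

Lemma prM_model : prM S = block_mx e 0 0 (block_mx p 0 0 p^T).
Proof. by rewrite /prM /= !(add_block_mx, addr0, add0r). Qed.

Lemma model_axioms : space_axioms S.
Proof.
split; rewrite ?prM_model /= ?tr_block_mx ?trmx0 ?trmxK ?tr_block_mx ?trmx0 ?trmxK;
  rewrite ?mulmx_block ?mul0mx ?mulmx0 ?addr0 ?add0r ?mulmx_block
    ?mul0mx ?mulmx0 ?addr0 ?add0r ?G_sym ?GZ ?pp ?ppT ?ee ?eG ?Ge //;
  by rewrite !block_mx0.
Qed.

Lemma bil_model (a : 'rV_k) (b c : 'rV_l) a' b' c' :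
  bil S (row_mx a (row_mx b c)) (row_mx a' (row_mx b' c')) =
    (a *m G *m a'^T) 0 0 + ((b *m p *m c'^T) 0 0 + (c *m p^T *m b'^T) 0 0).
Proof.
rewrite /bil /= !mul_row_block !mulmx0 !addr0 !add0r !tr_row_mx !mul_row_col.
by rewrite mxE; congr (_ + _); rewrite mxE addrC.
Qed.

Lemma model_Q (a : 'rV_k) (b c : 'rV_l) :
  row_mx a (row_mx b c) *m prQ S = row_mx (a *m e) 0.
Proof. by rewrite /= mul_row_block !mulmx0 !addr0. Qed.
Lemma model_P (a : 'rV_k) (b c : 'rV_l) :
  row_mx a (row_mx b c) *m prP S = row_mx 0 (row_mx (b *m p) 0).
Proof. by rewrite /= !mul_row_block !mulmx0 !addr0 !add0r. Qed.
Lemma model_D (a : 'rV_k) (b c : 'rV_l) :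
  row_mx a (row_mx b c) *m prD S = row_mx 0 (row_mx 0 (c *m p^T)).
Proof. by rewrite /= !mul_row_block !mulmx0 !add0r. Qed.

Hypothesis locA : is_local A.
Variables (n m : nat) (UQ : 'M[A]_(n, k)) (VQ : 'M[A]_(k, n)).
Variables (U : 'M[A]_(m, l)) (V : 'M[A]_(l, m)).
Hypothesis n1 : (1 <= n)%N.
Hypothesis m2 : (2 <= m)%N.
Hypothesis UVQ : UQ *m VQ = 1%:M.
Hypothesis VUQ : VQ *m UQ = e.
Hypothesis UV : U *m V = 1%:M.
Hypothesis VU : V *m U = p.

(** Over a local ring Q contains x and y with <x, y> = 1, and
2 = <x+y, x+y> - <x, x> - <y, y> is a unit; hence one of the three terms is. *)
Lemma model_unit : exists u c, inQ S u /\ bil S u u * c = 1.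
Proof.
pose i0 := Ordinal n1.
pose x : 'rV_(k + (l + l)) := row_mx (row i0 UQ) 0.
pose y : 'rV_(k + (l + l)) := row_mx ((Z *m col i0 VQ)^T *m e) 0.
have U_e : UQ *m e = UQ by rewrite -VUQ mulmxA UVQ mul1mx.
have Qx : inQ S x.
  by rewrite /inQ /x -(row_mx0 _ 1 l l) model_Q -row_mul U_e (row_mx0 _ 1 l l).
have Qy : inQ S y.
  by rewrite /inQ /y -(row_mx0 _ 1 l l) model_Q -mulmxA ee (row_mx0 _ 1 l l).
have xy : bil S x y = 1.
  rewrite /x /y -(row_mx0 _ 1 l l) bil_model !mul0mx.
  rewrite [X in _ + (X + _)]mxE [X in _ + (_ + X)]mxE !addr0 trmx_mul trmxK.
  rewrite !mulmxA -(mulmxA _ G e^T) Ge -(mulmxA _ G Z) GZ -row_mul U_e.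
  by rewrite colE mulmxA -row_mul UVQ -colE !mxE eqxx.
have axS := model_axioms.
have two : isu (bil S (x + y) (x + y) - (bil S x x + bil S y y)).
  exists h; rewrite !bilE (bilC axS y x) xy -[RHS]h2; ring.
have [[c xc]|] := isu_add locA two; first by exists (x + y), c; split=> //; apply: inQ_D.
move=> /isuN; rewrite opprK => /(isu_add locA)[[c xc]|[c yc]].
  by exists x, c.
by exists y, c.
Qed.

(** U lists a basis of P over the local ring, and V the dual basis. *)
Definition model_frame (a : 'I_m * bool) : 'rV[A]_(k + (l + l)) :=
  row_mx 0 (if a.2 then row_mx (row a.1 U) 0 else row_mx 0 (col a.1 V)^T).

Lemma row_mx_suml (c : 'I_m -> A) (F : 'I_m -> 'rV[A]_l) :
  \sum_i c i *: row_mx (0 : 'rV_k) (row_mx (F i) (0 : 'rV_l)) =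
  row_mx 0 (row_mx (\sum_i c i *: F i) 0).
Proof.
elim/big_rec2: _ => [|i x y _ ->]; first by rewrite !row_mx0.
by rewrite !scale_row_mx !add_row_mx !scaler0 !addr0.
Qed.
Lemma row_mx_sumr (c : 'I_m -> A) (F : 'I_m -> 'rV[A]_l) :
  \sum_i c i *: row_mx (0 : 'rV_k) (row_mx (0 : 'rV_l) (F i)) =
  row_mx 0 (row_mx 0 (\sum_i c i *: F i)).
Proof.
elim/big_rec2: _ => [|i x y _ ->]; first by rewrite !row_mx0.
by rewrite !scale_row_mx !add_row_mx !scaler0 !addr0.
Qed.

Lemma frame_model : exists u c, frame S model_frame u c.
Proof.
have [u [c [Qu uc]]] := model_unit; exists u, c.
have Up : U *m p = U by rewrite -VU mulmxA UV mul1mx.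
have pV : p *m V = V by rewrite -VU -mulmxA UV mulmx1.
have UVij i j : (row i U *m (col j V)) 0 0 = (i == j)%:R.
  by rewrite colE mulmxA -row_mul UV -colE !mxE.
have pcol i : p *m col i V = col i V by rewrite colE mulmxA pV.
have VpT i : (col i V)^T *m p^T = (col i V)^T.
  by rewrite -trmx_mul pcol.
split=> //.
- move=> [i s] [j t]; rewrite /model_frame /opp_ix -pair_eqE /=.
  case: s; case: t => /=; rewrite bil_model !mul0mx ?trmx0 ?mulmx0 ![(0 : 'M_(1, 1)) 0 0]mxE ?addr0 ?add0r.
  + by rewrite andbF.
  + by rewrite -row_mul Up trmxK UVij andbT eq_sym.
  + by rewrite VpT -trmx_mul mxE UVij andbT.
  + by rewrite andbF.
- by move=> i; rewrite /model_frame /= model_P -row_mul Up.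
- by move=> i; rewrite /model_frame /= model_D VpT.
- move=> x; rewrite -[x]hsubmxK -[rsubmx x]hsubmxK model_P.
  move: (lsubmx x) (lsubmx (rsubmx x)) (rsubmx (rsubmx x)) => a b d.
  have -> : b *m p = \sum_i (b *m V) 0 i *: row i U.
    by rewrite -VU mulmxA -mulmx_sum_row.
  rewrite /model_frame /=.
  apply: etrans (_ : \sum_i (b *m V) 0 i *: row_mx 0 (row_mx (row i U) 0) = _).
    apply/esym; apply: row_mx_suml.
  apply: eq_bigr => i _; congr (_ *: _).
  rewrite bil_model trmxK !trmx0 !mulmx0 ![(0 : 'M_(1, 1)) 0 0]mxE addr0 add0r.
  by rewrite -(mulmxA b) pcol colE mulmxA -colE !mxE.
move=> x; rewrite -[x]hsubmxK -[rsubmx x]hsubmxK model_D.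
move: (lsubmx x) (lsubmx (rsubmx x)) (rsubmx (rsubmx x)) => a b d.
have -> : d *m p^T = \sum_i (d *m U^T) 0 i *: (col i V)^T.
  rewrite -VU trmx_mul mulmxA mulmx_sum_row; apply: eq_bigr => i _.
  by rewrite tr_col.
rewrite /model_frame /=.
apply: etrans (_ : \sum_i (d *m U^T) 0 i *: row_mx 0 (row_mx 0 (col i V)^T) = _).
  apply/esym; apply: row_mx_sumr.
apply: eq_bigr => i _; congr (_ *: _).
rewrite bil_model !trmx0 !mulmx0 ![(0 : 'M_(1, 1)) 0 0]mxE !add0r.
by rewrite -(mulmxA d) -trmx_mul -row_mul Up tr_row colE mulmxA -colE !mxE.
Qed.

End Model.

(** * Automorphisms of the quadratic space as matrices *)

Lemma half_unique (A : comNzRingType) (h : A) : 2%:R * h = 1 -> Defs.half A = h.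
Proof.
move=> h2; rewrite /Defs.half; case: xgetP => [u _ /= u2|no]; last by case: (no h).
by rewrite -[u]mulr1 -h2 mulrA (mulrC u) u2 mul1r.
Qed.

Lemma sub_gen (G : groupType) (T K : set G) :
  K 1%g -> (forall x y, K x -> K y -> K (x * y)%g) ->
  (forall x, K x -> K (x^-1)%g) -> (forall x, T x -> K x) ->
  forall x, gen_subgroup T x -> K x.
Proof.
move=> K1 KM KV TK x; apply; split=> //.
split=> [|y z /set_mem Ky /set_mem Kz]; apply/mem_set => //.
by apply: KM => //; apply: KV.
Qed.

Lemma gen_is_subgroup (G : groupType) (T : set G) : is_subgroup (gen_subgroup T).
Proof.
split=> [|x y /set_mem Tx /set_mem Ty]; apply/mem_set => K [[K1 KB] TK].
  exact/set_mem.
by apply/set_mem/KB; apply/mem_set; [apply: Tx|apply: Ty].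
Qed.

Lemma gen_incl (G : groupType) (T : set G) x : T x -> gen_subgroup T x.
Proof. by move=> Tx K [_]; apply. Qed.

Section DualLinear.
Variables (A : comNzRingType) (M : lmodType A) (f : dual M).

Lemma dualD x y : f (x + y) = f x + f y.
Proof. by have := dual_lin f 1 x y; rewrite scale1r mul1r. Qed.
Lemma dual_at0 : f 0 = 0.
Proof. by apply: (addrI (f 0)); rewrite -dualD !addr0. Qed.
Lemma dualZ a x : f (a *: x) = a * f x.
Proof. by have := dual_lin f a x 0; rewrite dual_at0 !addr0. Qed.
Lemma dual_sum I r (F : I -> M) : f (\sum_(i <- r) F i) = \sum_(i <- r) f (F i).
Proof. by elim/big_rec2: _ => [|i x y _ <-]; rewrite ?dual_at0 ?dualD. Qed.
End DualLinear.

Section Translate.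
Variables (A : comNzRingType) (Q P : lmodType A) (q : Q -> A).
Hypothesis hq : is_quadratic_form q.
Variables (k : nat) (iQ : {linear Q -> 'rV[A]_k}) (pQ : {linear 'rV[A]_k -> Q}).
Variables (l : nat) (iP : {linear P -> 'rV[A]_l}) (pP : {linear 'rV[A]_l -> P}).
Hypothesis ipQ : cancel iQ pQ.
Hypothesis ipP : cancel iP pP.
Local Notation e := (idem_mx iQ pQ).
Local Notation p := (idem_mx iP pP).
Variables (G Z : 'M[A]_k) (h : A).
Hypothesis GE : forall x y, polar q x y = (iQ x *m G *m (iQ y)^T) 0 0.
Hypothesis G_sym : G^T = G.
Hypothesis GZ : G *m Z = e.
Hypothesis eG : e *m G = G.
Hypothesis h2 : 2%:R * h = 1.
Local Notation S := (model G Z e p h).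
Local Notation Md := (Q * (P * dual P))%type.
Local Notation N := (k + (l + l))%N.

Lemma ee : e *m e = e.
Proof. by apply: mx_ext => v; rewrite mulmxA !mul_idem_mx ipQ. Qed.
Lemma pp : p *m p = p.
Proof. by apply: mx_ext => v; rewrite mulmxA !mul_idem_mx ipP. Qed.
Lemma iQe x : iQ x *m e = iQ x.
Proof. by rewrite mul_idem_mx ipQ. Qed.
Lemma iPp x : iP x *m p = iP x.
Proof. by rewrite mul_idem_mx ipP. Qed.

Lemma axS : space_axioms S.
Proof. by apply: model_axioms => //; [apply: ee|apply: pp]. Qed.

(** A linear form on P is recorded by its values at the generators of P; the
vectors obtained are the image of the transpose of the idempotent of P. *)
Definition drow (f : dual P) : 'rV[A]_l := \row_j f (pP (delta_mx 0 j)).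
Lemma dvec_lin (c : 'rV[A]_l) : scalar (fun x => (iP x *m c^T) 0 0).
Proof. by move=> a x y; rewrite linearP mulmxDl -scalemxAl !mxE. Qed.
Definition dvec (c : 'rV[A]_l) : dual P := mk_dual (dvec_lin c).

Lemma drowE (f : dual P) v : (v *m (drow f)^T) 0 0 = f (pP v).
Proof.
rewrite mxE {2}[v]row_sum_delta linear_sum dual_sum.
by apply: eq_bigr => j _; rewrite !mxE linearZ dualZ.
Qed.

Lemma drowK : cancel drow dvec.
Proof. by move=> f; apply: dual_eq => x; rewrite /= drowE ipP. Qed.

Lemma drow_p (f : dual P) : drow f *m p^T = drow f.
Proof.
apply: trmx_inj; rewrite trmx_mul trmxK; apply: mx_ext => v.
apply/matrixP => i j; rewrite !ord1 mulmxA mul_idem_mx !drowE ipP //.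
Qed.

Lemma drow_linear : linear drow.
Proof. by move=> a f g; apply/rowP => j; rewrite !mxE. Qed.

Definition iM (x : Md) : 'rV[A]_N := row_mx (iQ x.1) (row_mx (iP x.2.1) (drow x.2.2)).
Definition pM (v : 'rV[A]_N) : Md :=
  (pQ (lsubmx v), (pP (lsubmx (rsubmx v)), dvec (rsubmx (rsubmx v)))).

Lemma iM_linear : linear iM.
Proof.
move=> a x y; rewrite /iM /= !linearP drow_linear.
by rewrite !scale_row_mx !add_row_mx.
Qed.
HB.instance Definition _ := GRing.isLinear.Build A Md 'rV[A]_N *:%R iM iM_linear.

Lemma dvec_linear : linear dvec.
Proof.
move=> a u v; apply: dual_eq => x.
by rewrite /= linearP /= mulmxDr -scalemxAr !mxE.
Qed.

Lemma pM_linear : linear pM.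
Proof. by move=> a u v; rewrite /pM !linearP dvec_linear. Qed.
HB.instance Definition _ := GRing.isLinear.Build A 'rV[A]_N Md *:%R pM pM_linear.

Lemma iMK : cancel iM pM.
Proof.
by case=> z [x f]; rewrite /pM /iM /= row_mxKl !row_mxKr row_mxKl ipQ ipP drowK.
Qed.

Lemma iMpM v : iM (pM v) = v *m prM S.
Proof.
rewrite prM_model -{2}[v]hsubmxK -[X in row_mx _ X *m _]hsubmxK.
rewrite !mul_row_block !mulmx0 !addr0 !add0r /iM /=.
rewrite !mul_idem_mx; congr (row_mx _ (row_mx _ _)).
apply/rowP => j; rewrite mxE /= -mul_idem_mx -mulmxA -rowE [LHS]mxE.
by rewrite -[X in fun_of_matrix X j 0]trmxK trmx_mul trmxK [LHS]mxE.
Qed.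

Lemma iM_inM x : inM S (iM x).
Proof. by rewrite /inM -iMpM iMK. Qed.

Lemma bil_iM x y : bil S (iM x) (iM y) = polar (qperp q (hyperbolic P)) x y.
Proof.
case: x y => [z [x f]] [z' [x' f']]; rewrite /iM bil_model /= iPp drow_p drowE ipP.
rewrite -[drow f]trmxK -trmx_mul [X in _ + (_ + X)]mxE drowE ipP -GE.
rewrite /polar /qperp /hyperbolic /=.
rewrite !dualD; ring.
Qed.

(** The matrix of s in coordinates, completed by the identity on the kernel of the
retraction, the same completion as in [proj_det].  As vectors are rows, [mxs]
reverses products. *)
Definition mxs (s : Md -> Md) : 'M[A]_N := lin1_mx (stabilize iM pM s).

Lemma stab_linear (s : Md -> Md) : linear s -> linear (stabilize iM pM s).
Proof.
move=> ls a u v; rewrite /stabilize !linearP ls !linearP.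
by apply/rowP => j; rewrite !mxE; ring.
Qed.

Lemma mul_mxs (s : lin_aut Md) v : v *m mxs s = iM (s (pM v)) + (v - iM (pM v)).
Proof.
pose f : {linear 'rV[A]_N -> 'rV[A]_N} := HB.pack (stabilize iM pM s)
  (GRing.isLinear.Build _ _ _ _ _ (stab_linear (aut_linear s))).
exact: (mul_rV_lin1 f).
Qed.

Lemma iM_mxs (s : lin_aut Md) x : iM x *m mxs s = iM (s x).
Proof. by rewrite mul_mxs iMK subrr addr0. Qed.

Lemma mxsM (s t : lin_aut Md) : mxs (s * t)%g = mxs t *m mxs s.
Proof.
apply: mx_ext => v; rewrite mulmxA !mul_mxs linearD linearB /= !iMK subrr addr0.
by rewrite [iM (t (pM v)) + _ - _]addrAC subrr add0r.
Qed.

Lemma mxs1 : mxs (1%g : lin_aut Md) = 1%:M.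
Proof. by apply: mx_ext => v; rewrite mul_mxs mulmx1 addrC subrK. Qed.

Lemma mxsV (s : lin_aut Md) : mxs s *m mxs (s^-1)%g = 1%:M.
Proof. by rewrite -mxsM mulVg mxs1. Qed.

Lemma mxs_inj (s t : lin_aut Md) : mxs s = mxs t -> s = t.
Proof.
move=> e; apply: lin_aut_eq => x; apply: (can_inj iMK).
by rewrite -!iM_mxs e.
Qed.

Lemma mxs_onto g g' : isom S g -> g *m g' = 1%:M ->
  exists2 s : lin_aut Md, mxs s = g & forall x, s x = pM (iM x *m g).
Proof.
move=> Ig gg'; have [_ g2 g3] := Ig.
have [_ g2' _] := isom_inv axS Ig gg'.
have Mg x : iM x *m g *m prM S = iM x *m g by apply: g2; apply: iM_inM.
have Mg' x : iM x *m g' *m prM S = iM x *m g' by apply: g2'; apply: iM_inM.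
have l_s : linear (fun x => pM (iM x *m g)).
  by move=> a x y; rewrite linearP mulmxDl -scalemxAl linearP.
have K1 : cancel (fun x => pM (iM x *m g)) (fun x => pM (iM x *m g')).
  by move=> x; rewrite iMpM Mg -mulmxA gg' mulmx1 iMK.
have K2 : cancel (fun x => pM (iM x *m g')) (fun x => pM (iM x *m g)).
  by move=> x; rewrite iMpM Mg' -mulmxA (mulmx1C gg') mulmx1 iMK.
exists (LinAut l_s K1 K2) => //.
apply: mx_ext => v; rewrite mul_mxs /= [iM (pM (_ *m g))]iMpM Mg !iMpM.
have -> : v - v *m prM S = v *m (1%:M - prM S) *m g.
  by rewrite -mulmxA g3 mulmxBr mulmx1.
by rewrite -mulmxDl -mulmxDr addrC subrK mulmx1.
Qed.

Lemma isom_mxs (s : lin_aut Md) :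
  isom S (mxs s) <-> Defs.orthogonal (qperp q (hyperbolic P)) s.
Proof.
split=> [[g1 _ _] x y|os]; first by rewrite -!bil_iM -!iM_mxs g1.
have sv v : v *m mxs s = iM (s (pM v)) + (v - v *m prM S).
  by rewrite mul_mxs iMpM.
have Ms v : inM S v -> v *m mxs s = iM (s (pM v)).
  by move=> Mv; rewrite sv Mv subrr addr0.
have M1 v : v *m prM S *m mxs s = iM (s (pM v)).
  have -> : pM v = pM (v *m prM S) by rewrite -iMpM iMK.
  by apply: Ms; rewrite /inM -mulmxA (prMM axS).
have M0 : (1%:M - prM S) *m mxs s = 1%:M - prM S.
  apply: mx_ext => v; rewrite mulmxA mulmxBr mulmx1 mulmxBl M1 sv.
  by rewrite addrAC subrr add0r.
split=> // [x y|x Mx]; last by rewrite Ms //; apply: iM_inM.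
have orth z w : bil S (iM z) (w - w *m prM S) = 0.
  by rewrite bilDr bilNr -(bil_prM axS) iM_inM subrr.
have orth' z w : bil S (w - w *m prM S) (iM z) = 0.
  by rewrite (bilC axS) orth.
have split_bil z w z' w' : bil S (iM z + (w - w *m prM S)) (iM z' + (w' - w' *m prM S)) =
    bil S (iM z) (iM z') + bil S (w - w *m prM S) (w' - w' *m prM S).
  by rewrite bilDl [bil _ (iM z) _]bilDr [bil _ (w - _) (iM z' + _)]bilDr orth orth' addr0 add0r.
rewrite !sv split_bil bil_iM os -bil_iM -split_bil !iMpM.
by rewrite ![_ + (_ - _)]addrC !subrK.
Qed.

Lemma det_mxs (s : lin_aut Md) : proj_det s = \det (mxs s).
Proof.
pose f : {linear Md -> Md} := HB.pack (aut_fun s)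
  (GRing.isLinear.Build _ _ _ _ _ (aut_linear s)).
exact: (@proj_detE A Md f N iM pM iMK).
Qed.

(** Non-degeneracy, read off from G *m Z = e. *)
Lemma polar_inj x y : (forall w, polar q x w = polar q y w) -> x = y.
Proof.
move=> xy; apply: (can_inj ipQ); rewrite -(iQe x) -(iQe y) -GZ !mulmxA.
congr (_ *m _); apply: trmx_inj; apply: mx_ext => v.
apply: trmx_inj; rewrite !trmx_mul !trmxK; apply/matrixP => i j; rewrite !ord1.
have Ge : G *m e^T = G by apply: trmx_inj; rewrite trmx_mul trmxK G_sym eG.
have := xy (pQ v); rewrite !GE -mul_idem_mx trmx_mul.
by rewrite !mulmxA -(mulmxA _ G e^T) -(mulmxA (iQ y) G e^T) Ge.
Qed.

Lemma polar_sym x y : polar q x y = polar q y x.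
Proof. exact: polarC. Qed.

Lemma riesz (f : Q -> A) : scalar f -> exists z, forall w, polar q z w = f w.
Proof.
move=> lf; pose c : 'cV_k := \col_a f (pQ (delta_mx 0 a)).
exists (pQ (Z *m c)^T) => w; rewrite polar_sym GE -mul_idem_mx !trmx_mul trmxK.
have Ge : G *m e^T = G by apply: trmx_inj; rewrite trmx_mul trmxK G_sym eG.
rewrite !mulmxA -(mulmxA _ G e^T) Ge -(mulmxA _ G Z) GZ iQe.
pose g : {scalar Q} := HB.pack f (GRing.isLinear.Build A Q A *%R f lf).
rewrite mxE -[in RHS](ipQ w) [in RHS](row_sum_delta (iQ w)) -[f]/(g : _ -> _) !linear_sum.
by apply: eq_bigr => j _; rewrite !mxE !linearZ.
Qed.

Lemma drow0 : drow 0 = 0.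
Proof. by apply/rowP => j; rewrite !mxE. Qed.

Lemma iM_prQ z x f : iM (z, (x, f)) *m prQ S = iM (z, (0, 0)).
Proof. by rewrite /iM model_Q iQe /= linear0 drow0 row_mx0. Qed.
Lemma iM_prP z x f : iM (z, (x, f)) *m prP S = iM (0, (x, 0)).
Proof. by rewrite /iM model_P iPp /= linear0 drow0. Qed.
Lemma iM_prD z x f : iM (z, (x, f)) *m prD S = iM (0, (0, f)).
Proof. by rewrite /iM model_D drow_p /= !linear0. Qed.

Lemma iM_Q z : inQ S (iM (z, (0, 0))).
Proof. exact: iM_prQ. Qed.
Lemma iM_P x : iM (0, (x, 0)) *m prP S = iM (0, (x, 0)).
Proof. exact: iM_prP. Qed.
Lemma iM_D f : iM (0, (0, f)) *m prD S = iM (0, (0, f)).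
Proof. exact: iM_prD. Qed.

Lemma inM_iM v : inM S v -> iM (pM v) = v.
Proof. by rewrite iMpM. Qed.

Lemma inQ_iM v : inQ S v -> v = iM ((pM v).1, (0, 0)).
Proof.
move=> Qv; rewrite -[LHS]Qv -{1}(inM_iM (inQ_inM axS Qv)).
by case: (pM v) => z [x f]; rewrite iM_prQ.
Qed.
Lemma inP_iM v : v *m prP S = v -> v = iM (0, ((pM v).2.1, 0)).
Proof.
move=> Pv; rewrite -[LHS]Pv -{1}(inM_iM (lagr_inM axS (or_introl Pv))).
by case: (pM v) => z [x f]; rewrite iM_prP.
Qed.
Lemma inD_iM v : v *m prD S = v -> v = iM (0, (0, (pM v).2.2)).
Proof.
move=> Dv; rewrite -[LHS]Dv -{1}(inM_iM (lagr_inM axS (or_intror Dv))).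
by case: (pM v) => z [x f]; rewrite iM_prD.
Qed.

Lemma polar_md z x (f : dual P) z' x' (f' : dual P) :
  polar (qperp q (hyperbolic P)) (z, (x, f)) (z', (x', f')) =
  polar q z z' + (f x' + f' x).
Proof.
rewrite /polar /qperp /hyperbolic /= !dualD; ring.
Qed.

(** Recognizes s = 1 + d + d^2 / 2, where d is the endomorphism with matrix n. *)
Lemma expm_mxs (s : lin_aut Md) (n : 'M_N) (d : Md -> Md) :
  (forall x, iM x *m n = iM (d x)) -> (1%:M - prM S) *m n = 0 ->
  (forall x, s x = x + d x + h *: d (d x)) -> mxs s = expm S n.
Proof.
move=> nd n0 sE; apply: mx_ext => v; rewrite mul_mxs mul_expm sE iMpM.
have vn : v *m n = iM (pM v) *m n.
  rewrite iMpM -{1}[v]mulmx1 -{1}(subrK (prM S) 1%:M) mulmxDr mulmxDl.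
  by rewrite -[v *m (_ - _) *m n]mulmxA n0 mulmx0 add0r.
rewrite vn !nd 2!linearD linearZ /= iMpM.
by apply/rowP => j; rewrite !mxE; ring.
Qed.

Lemma nil2_sum_orth (I : finType) (u v : I -> 'rV_N) :
  (forall i, inM S (u i)) -> (forall i, inM S (v i)) ->
  (1%:M - prM S) *m (\sum_i nil2 S (u i) (v i)) = 0.
Proof.
move=> Mu Mv; apply: mx_ext => x; rewrite mulmxA mulmx0 mulmx_sumr big1 // => i _.
have orth w : inM S w -> bil S (x *m (1%:M - prM S)) w = 0.
  by move=> Mw; rewrite mulmxBr mulmx1 bilDl bilNl (bil_prM axS) Mw subrr.
by rewrite mul_nil2 !orth // !scale0r subr0.
Qed.

Let half_h : Defs.half A = h := half_unique h2.

(** The image of a vector under a sum of infinitesimal isometries, collected into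
its components in Q and in P + P^*. *)
Lemma pair_sum (I : finType) (a : I -> A) (zz : I -> Q) (b : I -> A) (y : I -> P * dual P) :
  \sum_i (a i *: iM (- zz i, (0, 0)) - (- b i) *: iM (0, y i)) =
  iM (- \sum_i a i *: zz i, \sum_i b i *: y i).
Proof.
have E i : a i *: iM (- zz i, (0, 0)) - (- b i) *: iM (0, y i) =
    iM (a i *: (- zz i, (0, 0)) + b i *: (0, y i)).
  by rewrite scaleNr opprK linearD !linearZ.
under eq_bigr do rewrite E.
have lM := linear_sum (iM : {linear Md -> 'rV[A]_N}); rewrite -lM /=.
congr iM.
elim: (index_enum I) => [|i r IH]; first by rewrite !big_nil oppr0.
rewrite !big_cons IH; congr (_, _) => /=.
  by rewrite scaler0 addr0 scalerN opprD.
by have -> : ((0, 0) : P * dual P) = 0 by []; rewrite scaler0 add0r.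
Qed.

Lemma P_expand y : y = \sum_j iP y 0 j *: pP (delta_mx 0 j).
Proof.
rewrite -{1}(ipP y) {1}[iP y]row_sum_delta linear_sum.
by apply: eq_bigr => j _; rewrite linearZ.
Qed.

(** alpha = sum of <z_j, -> y_j for the generators y_j of P, so that E_alpha is the
exponential of the sum of the nil2 (y_j) (- z_j). *)
Lemma E_EO (alpha : {linear Q -> P}) (s : lin_aut Md) :
  is_E q alpha s -> EOm S (mxs s).
Proof.
move=> [alpha' [Ha sE]].
have /choice[z Hz] : forall j : 'I_l, exists z, forall w, polar q z w = iP (alpha w) 0 j.
  by move=> j; apply: riesz => a x y; rewrite !linearP !mxE.
have a'E f : alpha' f = \sum_j f (pP (delta_mx 0 j)) *: z j.
  apply: polar_inj => w; rewrite Ha polar_sym.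
  rewrite -{1}(ipP (alpha w)) (row_sum_delta (iP (alpha w))) linear_sum dual_sum.
  elim: (index_enum _) => [|j r IH]; first by rewrite !big_nil polar0.
  rewrite !big_cons polarD // -IH polarZ // [polar q w (z j)]polar_sym Hz linearZ dualZ.
  by rewrite mulrC.
pose u j := iM (0, (pP (delta_mx 0 j), 0)); pose v j := iM (- z j, (0, 0)).
rewrite (@expm_mxs s (\sum_j nil2 S (u j) (v j))
  (fun x => (- alpha' x.2.2, (alpha x.1, 0)))).
- apply: (expm_EO axS (pr := prP S)); first by left.
    by move=> j; apply: iM_P.
  by move=> j; apply: iM_Q.
- case=> y [x f]; rewrite mulmx_sumr.
  have E j : iM (y, (x, f)) *m nil2 S (u j) (v j) =
      f (pP (delta_mx 0 j)) *: iM (- z j, (0, 0))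
      - (- iP (alpha y) 0 j) *: iM (0, (pP (delta_mx 0 j), 0)).
    rewrite mul_nil2 /u /v !bil_iM !polar_md; congr (_ *: _ - _ *: _).
      by rewrite polar0 // add0r /= addr0.
    have -> : f 0 + (0 : dual P) x = 0 by rewrite (dual_at0 f) add0r.
    by rewrite addr0 -scaleN1r polarZ // mulN1r polar_sym Hz.
  under eq_bigr do rewrite E.
  rewrite pair_sum /= -a'E; congr (iM (_, _)).
  rewrite [in RHS](P_expand (alpha y)).
  elim: (index_enum _) => [|j r IH]; first by rewrite !big_nil.
  by rewrite !big_cons IH; congr (_, _) => /=; rewrite scaler0 addr0.
- apply: nil2_sum_orth => j; first by apply/(lagr_inM axS)/or_introl/iM_P.
  exact/(inQ_inM axS)/iM_Q.
have a'0 : alpha' 0 = 0.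
  by apply: polar_inj => w; rewrite Ha polar_sym polar0.
case=> y [x f] /=; rewrite sE half_h a'0 oppr0.
congr (_, _) => /=; first by rewrite scaler0 addr0.
congr (_, _) => /=; first by rewrite linearN scalerN.
by rewrite scaler0 !addr0.
Qed.

Lemma dual_sumE (I : Type) (r : seq I) (F : I -> dual P) x :
  (\sum_(j <- r) F j) x = \sum_(j <- r) F j x.
Proof. by elim/big_rec2: _ => // j y g _ <-. Qed.

Lemma dvec_delta j x : dvec (delta_mx 0 j) x = iP x 0 j.
Proof. by rewrite /= trmx_delta -colE mxE. Qed.

Lemma dual_coord (f : dual P) x : f x = \sum_j iP x 0 j * drow f 0 j.
Proof.
by rewrite -[in LHS](ipP x) -drowE mxE; apply: eq_bigr => j _; rewrite [_^T _ _]mxE.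
Qed.

Lemma dual_expand f : f = \sum_j drow f 0 j *: dvec (delta_mx 0 j).
Proof.
apply: dual_eq => x; apply: etrans (esym (dual_sumE _ _ x)).
rewrite {1}(P_expand x) dual_sum.
by apply: eq_bigr => j _; rewrite dualZ -[RHS]/(_ * _) dvec_delta mxE mulrC.
Qed.

Lemma Estar_EO (beta : {linear Q -> dual P}) (s : lin_aut Md) :
  is_Estar q beta s -> EOm S (mxs s).
Proof.
move=> [beta' [Hb0 sE]].
have Hb x w : polar q (beta' x) w = dual_fun (beta w) x := Hb0 x w.
have /choice[z Hz] : forall j : 'I_l, exists z, forall w, polar q z w = drow (beta w) 0 j.
  move=> j; apply: riesz => a x y; rewrite linearP !mxE.
  by [].
have b'E x : beta' x = \sum_j iP x 0 j *: z j.
  apply: polar_inj => w; rewrite Hb polar_sym dual_coord.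
  elim: (index_enum _) => [|j r IH]; first by rewrite !big_nil polar0.
  by rewrite !big_cons polarD // -IH polarZ // [polar q w (z j)]polar_sym Hz.
pose u j := iM (0, (0, dvec (delta_mx 0 j))); pose v j := iM (- z j, (0, 0)).
rewrite (@expm_mxs s (\sum_j nil2 S (u j) (v j))
  (fun x => (- beta' x.2.1, (0, beta x.1)))).
- apply: (expm_EO axS (pr := prD S)); first by right.
    by move=> j; apply: iM_D.
  by move=> j; apply: iM_Q.
- case=> y [x f]; rewrite mulmx_sumr.
  have E j : iM (y, (x, f)) *m nil2 S (u j) (v j) =
      iP x 0 j *: iM (- z j, (0, 0))
      - (- drow (beta y) 0 j) *: iM (0, (0, dvec (delta_mx 0 j))).
    rewrite mul_nil2 /u /v !bil_iM !polar_md; congr (_ *: _ - _ *: _).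
      by rewrite polar0 // (dual_at0 f) !add0r dvec_delta.
    have -> : f 0 + (0 : dual P) x = 0 by rewrite (dual_at0 f) add0r.
    by rewrite addr0 -scaleN1r polarZ // mulN1r polar_sym Hz.
  under eq_bigr do rewrite E.
  rewrite pair_sum /= -b'E; congr (iM (_, _)).
  rewrite [in RHS](dual_expand (beta y)).
  elim: (index_enum _) => [|j r IH]; first by rewrite !big_nil.
  by rewrite !big_cons IH; congr (_, _) => /=; rewrite scaler0 addr0.
- apply: nil2_sum_orth => j; first by apply/(lagr_inM axS)/or_intror/iM_D.
  exact/(inQ_inM axS)/iM_Q.
have b'0 : beta' 0 = 0.
  by apply: polar_inj => w; rewrite Hb polar_sym polar0 // dual_at0.
case=> y [x f] /=; rewrite sE half_h b'0 oppr0.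
congr (_, _) => /=; first by rewrite scaler0 addr0.
congr (_, _) => /=; first by rewrite scaler0 !addr0.
by rewrite linearN scalerN addrC addrA.
Qed.

Lemma EO_EOm (s : lin_aut Md) : EO q P s -> EOm S (mxs s).
Proof.
rewrite /EO; move: s; apply: (sub_gen (K := fun s : lin_aut Md => EOm S (mxs s))).
- by rewrite mxs1; apply: gen1.
- by move=> s1 s2 E1 E2; rewrite mxsM; apply: gen_mul.
- by move=> s1 E1; apply: (EOm_inverse axS E1); apply: mxsV.
by move=> s1 [[alpha /E_EO]|[beta /Estar_EO]].
Qed.

(** The transvection of y in P and t in Q is E_alpha for the rank one map
alpha(w) = - <w, t> y. *)
Lemma eich_E t y : exists2 s : lin_aut Md,
  mxs s = eich S (iM (0, (y, 0))) (iM (t, (0, 0))) &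
  exists2 alpha : {linear Q -> P},
    forall w, alpha w = - polar q w t *: y & is_E q alpha s.
Proof.
set x := iM (0, (y, 0)); set z := iM (t, (0, 0)).
have Px : x *m prP S = x by apply: iM_P.
have Qz : inQ S z by apply: iM_Q.
have lx : lagr S x by left.
have xz : bil S x z = 0 by apply: (bil_lagrQ axS).
have xx : bil S x x = 0 by apply: (lagr_iso axS).
have [|s sE sx] := mxs_onto _ (eichN axS xx xz).
  by apply: (eich_isom axS) => //; [apply: (lagr_inM axS)|apply: (inQ_inM axS)].
exists s => //.
have la : linear (fun w => - polar q w t *: y).
  by move=> a v w; rewrite (polar_linl hq t a v w) opprD scalerDl -mulrN scalerA.
pose alpha : {linear Q -> P} := HB.pack (fun w => - polar q w t *: y)
  (GRing.isLinear.Build _ _ _ _ _ la).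
exists alpha => //; exists (fun f : dual P => - f y *: t); split.
  move=> f w; rewrite polar_sym polarZ // -[alpha w]/(- polar q w t *: y) dualZ.
  ring.
move=> w v f; rewrite sx mul_eich !bil_iM !polar_md half_h.
have -> : hf S = h by [].
have e1 : polar q w 0 + (dual_fun f y + (0 : dual P) v) = dual_fun f y by rewrite polar0 // add0r addr0.
have e2 : polar q w t + (dual_fun f 0 + (0 : dual P) v) = polar q w t.
  by rewrite (dual_at0 f) !addr0.
have e3 : polar q t t + ((0 : dual P) 0 + (0 : dual P) 0) = polar q t t by rewrite !addr0.
rewrite e1 e2 e3 2!linearB linearD !linearZ /= !iMK.
congr (_, _) => /=; first by rewrite !oppr0 !scaler0 !addr0 scaleNr scalerN opprK.
congr (_, _) => /=; last by rewrite !oppr0 !scaler0 !addr0.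
rewrite scaler0 addr0 [polar q (_ *: t) t]polar_sym polarZ // !scalerN !scalerA -!scaleNr.
by congr (_ + _ *: _ + _ *: _); ring.
Qed.

Lemma eich_Estar t (f0 : dual P) : exists2 s : lin_aut Md,
  mxs s = eich S (iM (0, (0, f0))) (iM (t, (0, 0))) &
  exists2 beta : {linear Q -> dual P},
    forall w, beta w = - polar q w t *: f0 & is_Estar q beta s.
Proof.
set x := iM (0, (0, f0)); set z := iM (t, (0, 0)).
have Px : x *m prD S = x by apply: iM_D.
have Qz : inQ S z by apply: iM_Q.
have lx : lagr S x by right.
have xz : bil S x z = 0 by apply: (bil_lagrQ axS).
have xx : bil S x x = 0 by apply: (lagr_iso axS).
have [|s sE sx] := mxs_onto _ (eichN axS xx xz).
  by apply: (eich_isom axS) => //; [apply: (lagr_inM axS)|apply: (inQ_inM axS)].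
exists s => //.
have la : linear (fun w => - polar q w t *: f0).
  by move=> a v w; rewrite (polar_linl hq t a v w) opprD scalerDl -mulrN scalerA.
pose beta : {linear Q -> dual P} := HB.pack (fun w => - polar q w t *: f0)
  (GRing.isLinear.Build _ _ _ _ _ la).
exists beta => //; exists (fun v : P => - f0 v *: t); split.
  move=> v w; rewrite polar_sym polarZ // -[RHS]/(- polar q w t * f0 v).
  ring.
move=> w v f; rewrite sx mul_eich !bil_iM !polar_md half_h.
have -> : hf S = h by [].
have e1 : polar q w 0 + (dual_fun f 0 + f0 v) = f0 v.
  by rewrite (dual_at0 f) polar0 // !add0r.
have e2 : polar q w t + (dual_fun f 0 + (0 : dual P) v) = polar q w t.
  by rewrite (dual_at0 f) !addr0.
have e3 : polar q t t + ((0 : dual P) 0 + (0 : dual P) 0) = polar q t t by rewrite !addr0.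
rewrite e1 e2 e3 2!linearB linearD !linearZ /= !iMK.
congr (_, _) => /=; first by rewrite !oppr0 !scaler0 !addr0 scaleNr scalerN opprK.
congr (_, _) => /=; first by rewrite !oppr0 !scaler0 !addr0.
rewrite scaler0 addr0 [polar q (_ *: t) t]polar_sym polarZ // !scalerN !scalerA -!scaleNr.
rewrite [RHS]addrC addrA.
by congr (_ + _ *: _ + _ *: _); ring.
Qed.

Lemma EO_1 : EO q P 1%g.
Proof. by apply: (sg1 (gen_is_subgroup _)). Qed.
Lemma EO_M s t : EO q P s -> EO q P t -> EO q P (s * t)%g.
Proof. by apply: (sgM (gen_is_subgroup _)). Qed.

Lemma EOm_EO g : EOm S g -> exists2 s : lin_aut Md, mxs s = g & EO q P s.
Proof.
elim=> [|g1 g2 [x [z [lx Qz ->]]] _ [s sE Es]].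
  by exists 1%g; [apply: mxs1|apply: EO_1].
suff [t tE Et] : exists2 t : lin_aut Md, mxs t = eich S x z & EO q P t.
  by exists (s * t)%g; [rewrite mxsM tE sE|apply: EO_M].
rewrite (inQ_iM Qz); case: lx => [/inP_iM|/inD_iM] ->.
  have [t tE [alpha _ Ha]] := eich_E (pM z).1 (pM x).2.1.
  by exists t => //; apply: gen_incl; left; exists alpha.
have [t tE [beta _ Hb]] := eich_Estar (pM z).1 (pM x).2.2.
by exists t => //; apply: gen_incl; right; exists beta.
Qed.

Section Reduction.
Variables (B : comNzRingType) (rho : {rmorphism A -> B}) (J : {pred A}).
Hypothesis rhoJ : forall a, a \in J -> rho a = 0.

Lemma ideal_mul_mx (M : lmodType A) n (f : {linear M -> 'rV[A]_n}) y :
  ideal_mul J y -> map_mx rho (f y) = 0.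
Proof.
move=> [r [a [x [Ja ->]]]]; rewrite linear_sum; apply/rowP => j.
rewrite !mxE summxE rmorph_sum big1 // => i _.
by rewrite linearZ mxE rmorphM rhoJ // mul0r.
Qed.

Lemma ideal_mul_dual (M : lmodType A) (f : dual M) y : ideal_mul J y -> rho (f y) = 0.
Proof.
move=> [r [a [x [Ja ->]]]]; rewrite dual_sum rmorph_sum big1 // => i _.
by rewrite dualZ rmorphM rhoJ // mul0r.
Qed.

Lemma dual_ideal_mul (f : dual P) y : ideal_mul J f -> rho (f y) = 0.
Proof.
move=> [r [a [g [Ja ->]]]]; have H := dual_sumE (index_enum 'I_r) (fun i => a i *: g i) y.
apply: etrans (congr1 rho H) _; rewrite rmorph_sum big1 // => i _.
by apply: etrans (rmorphM rho (a i) (g i y)) _; rewrite rhoJ // mul0r.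
Qed.

(** A vector of Q whose pairings with Q lie in the kernel of rho is itself zero
under rho, as Z recovers its coordinates from the pairings; this is how the
condition on alpha passes to alpha^*. *)
Lemma iQ_reduce y : (forall w, rho (polar q y w) = 0) -> map_mx rho (iQ y) = 0.
Proof.
move=> yw; rewrite -iQe -GZ mulmxA map_mxM.
suff -> : map_mx rho (iQ y *m G) = 0 by rewrite mul0mx.
have Ge : G *m e^T = G by apply: trmx_inj; rewrite trmx_mul trmxK G_sym eG.
have E a : (iQ y *m G) 0 a = polar q y (pQ (delta_mx 0 a)).
  rewrite GE -mul_idem_mx trmx_mul mulmxA -(mulmxA _ G) Ge trmx_delta -colE.
  by rewrite [RHS]mxE.
by apply/rowP => a; rewrite [RHS]mxE [LHS]mxE E yw.
Qed.

Lemma mxs_reduce (s : lin_aut Md) :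
  (forall x, map_mx rho (iM (s x - x)) = 0) -> map_mx rho (mxs s) = 1%:M.
Proof.
move=> H; apply/row_matrixP => j; rewrite -map_row rowE mul_mxs.
have -> : iM (s (pM (delta_mx 0 j))) + (delta_mx 0 j - iM (pM (delta_mx 0 j))) =
   delta_mx 0 j + iM (s (pM (delta_mx 0 j)) - pM (delta_mx 0 j)).
  by rewrite linearB /= addrCA.
by rewrite map_mxD H addr0 map_delta_mx rowE mulmx1.
Qed.

Lemma drow_reduce f : ideal_mul J f -> map_mx rho (drow f) = 0.
Proof. by move=> Jf; apply/rowP => j; rewrite !mxE dual_ideal_mul. Qed.

(** Under rho alpha vanishes by assumption and alpha^* by [iQ_reduce]. *)
Lemma E_reduce (alpha : {linear Q -> P}) (s : lin_aut Md) :
  (forall z, ideal_mul J (alpha z)) -> is_E q alpha s -> map_mx rho (mxs s) = 1%:M.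
Proof.
move=> Ja [alpha' [Ha sE]]; apply: mxs_reduce => -[z [x f]]; rewrite sE.
rewrite /iM !map_row_mx.
have -> : (z - alpha' f, (x + alpha z - Defs.half A *: alpha (alpha' f), f)) - (z, (x, f)) =
    (- alpha' f, (alpha (z - Defs.half A *: alpha' f), 0)) :> Md.
  congr (_, _) => /=; first by rewrite addrAC subrr add0r.
  congr (_, _) => /=; last by rewrite subrr.
  by rewrite [RHS]linearB [in RHS]linearZ -[x + _ - _]addrA [x + _]addrC addrK.
rewrite /= linearN map_mxN iQ_reduce ?oppr0 => [|w]; last first.
  by rewrite Ha ideal_mul_dual.
by rewrite drow0 map_mx0 (ideal_mul_mx iP (Ja _)) !row_mx0.
Qed.

Lemma Estar_reduce (beta : {linear Q -> dual P}) (s : lin_aut Md) :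
  (forall z, ideal_mul J (beta z)) -> is_Estar q beta s -> map_mx rho (mxs s) = 1%:M.
Proof.
move=> Jb [beta' [Hb sE]]; apply: mxs_reduce => -[z [x f]]; rewrite sE.
rewrite /iM !map_row_mx.
have -> : (z - beta' x, (x, beta z - Defs.half A *: beta (beta' x) + f)) - (z, (x, f)) =
    (- beta' x, (0, beta (z - Defs.half A *: beta' x))) :> Md.
  congr (_, _) => /=; first by rewrite addrAC subrr add0r.
  congr (_, _) => /=; first by rewrite subrr.
  by rewrite [RHS]linearB [in RHS]linearZ addrK.
rewrite /= linearN map_mxN iQ_reduce ?oppr0 => [|w]; last first.
  by rewrite Hb; apply: (dual_ideal_mul x (Jb w)).
by rewrite linear0 map_mx0 drow_reduce // !row_mx0.
Qed.

Lemma ideal_reduce (s : lin_aut Md) :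
  (forall x, ideal_mul J (s x - x)) -> map_mx rho (mxs s) = 1%:M.
Proof.
move=> H; apply: mxs_reduce => x.
exact: (ideal_mul_mx (iM : {linear Md -> 'rV[A]_N}) (H x)).
Qed.

End Reduction.

End Translate.

(** * Quotients that are nilpotent of class at most two *)

Section QuotientNilpotent.
Local Open Scope group_scope.

Lemma subgroupI (G : groupType) (K : set G) :
  K 1 -> (forall x y, K x -> K y -> K (x * y)) -> (forall x, K x -> K x^-1) ->
  is_subgroup K.
Proof.
move=> K1 KM KV; split=> [|x y /set_mem Kx /set_mem Ky]; apply/mem_set => //.
by apply: KM => //; apply: KV.
Qed.

Variables (G : groupType) (N H : set G) (NH : normal_in N H).

Lemma quotient_coset (C : quotient_group NH) :
  exists2 h, H h & coset_set C = left_coset N h.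
Proof. exact: coset_setP. Qed.

Lemma coset_mulg (C D : quotient_group NH) x y : H x -> H y ->
  coset_set C = left_coset N x -> coset_set D = left_coset N y ->
  coset_set (C * D : quotient_group NH) = left_coset N (x * y).
Proof. by move=> Hx Hy eC eD; rewrite -(qmul_cosets NH) // -eC -eD. Qed.

Lemma coset_invg (C : quotient_group NH) x : H x -> coset_set C = left_coset N x ->
  coset_set (C^-1 : quotient_group NH) = left_coset N x^-1.
Proof. by move=> Hx eC; rewrite -(qinv_coset NH) // -eC. Qed.

Lemma coset_commg (C D : quotient_group NH) x y : H x -> H y ->
  coset_set C = left_coset N x -> coset_set D = left_coset N y ->
  coset_set ([~ C, D] : quotient_group NH) = left_coset N [~ x, y].
Proof.
move=> Hx Hy eC eD; have HG := normal_group NH.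
have Hx' := sgV HG Hx; have Hy' := sgV HG Hy.
rewrite !commgEl !conjgE.
apply: coset_mulg => //; first by do !apply: (sgM HG).
  exact: coset_invg.
apply: coset_mulg => //; first exact: (sgM HG).
  exact: coset_invg.
exact: coset_mulg.
Qed.

(** The image of K in the quotient contains the commutators and is central. *)
Lemma quotient_nilpotent2 (K : set G) : is_subgroup K -> (forall x, K x -> H x) ->
  (forall x y, H x -> H y -> K [~ x, y]) ->
  (forall x y, H x -> K y -> N [~ x, y]) ->
  nilpotent_of_class_le (quotient_group NH) 2.
Proof.
move=> KG KH HHK HKN; have HG := normal_group NH.
have L1 (C : quotient_group NH) : @lower_central (quotient_group NH) 1 C ->
    exists2 y, K y & coset_set C = left_coset N y.
  apply: (sub_gen (K := fun C : quotient_group NH =>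
    exists2 y, K y & coset_set C = left_coset N y)).
  - by exists 1; [apply: (sg1 KG)|apply: (N_coset N)].
  - move=> C1 C2 [x Kx eC] [y Ky eD]; exists (x * y); first exact: (sgM KG).
    by apply: coset_mulg => //; apply: KH.
  - move=> C1 [x Kx eC]; exists x^-1; first exact: (sgV KG).
    by apply: coset_invg => //; apply: KH.
  move=> _ [C1 [D1 [_ ->]]].
  have [x Hx eC] := quotient_coset C1; have [y Hy eD] := quotient_coset D1.
  by exists [~ x, y]; [apply: HHK|apply: coset_commg].
apply/seteqP; split=> [C|C ->]; last exact: (sg1 (gen_is_subgroup _)).
apply: (sub_gen (K := fun C : quotient_group NH => C = 1)) => //.
- by move=> x y -> ->; rewrite mulg1.
- by move=> x ->; rewrite invg1.
move=> _ [C1 [D1 [/L1[y Ky eD] ->]]]; have [x Hx eC] := quotient_coset C1.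
apply: quotient_eq; rewrite (coset_commg Hx (KH _ Ky) eC eD).
have Nxy := HKN _ _ Hx Ky; have NG := normal_subgroup NH.
rewrite -[RHS]/N; apply/seteqP; split=> [_ [n Nn <-]|n Nn]; first exact: (sgM NG).
by exists ([~ x, y]^-1 * n); [apply: (sgM NG) => //; apply: (sgV NG)|rewrite mulVKg].
Qed.

End QuotientNilpotent.

(** * The groups over the polynomial ring *)

(** The forms and the idempotents of the two modules over R[X] have constant
coordinates G0, Z0, e0, p0, so that the space is extended from R. *)
Section PolynomialGroups.
Variables (R : comNzRingType) (Q P : lmodType {poly R}) (q : Q -> {poly R}).
Hypothesis hq : is_quadratic_form q.
Variables (k : nat) (iQ : {linear Q -> 'rV[{poly R}]_k}) (pQ : {linear 'rV[{poly R}]_k -> Q}).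
Variables (l : nat) (iP : {linear P -> 'rV[{poly R}]_l}) (pP : {linear 'rV[{poly R}]_l -> P}).
Hypothesis ipQ : cancel iQ pQ.
Hypothesis ipP : cancel iP pP.
Variables (G0 Z0 e0 : 'M[R]_k) (p0 : 'M[R]_l) (h0 : R).
Local Notation S0 := (model G0 Z0 e0 p0 h0).
Hypothesis eE : idem_mx iQ pQ = map_mx polyC e0.
Hypothesis pE : idem_mx iP pP = map_mx polyC p0.
Local Notation G := (map_mx polyC G0).
Local Notation Z := (map_mx polyC Z0).
Local Notation h := (h0%:P).
Hypothesis GE : forall x y, polar q x y = (iQ x *m G *m (iQ y)^T) 0 0.
Hypothesis axS0 : space_axioms S0.
Hypothesis frames : forall (L : comNzRingType) (chi : {rmorphism R -> L}),
  is_local L ->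
  exists m (fr : 'I_m * bool -> 'rV_(k + (l + l))) u c, frame (smap chi S0) fr u c.
Hypothesis G_sym : G^T = G.
Hypothesis GZ : G *m Z = idem_mx iQ pQ.
Hypothesis eG : idem_mx iQ pQ *m G = G.
Hypothesis h2 : 2%:R * h = 1.

Local Notation S := (smap polyC S0).
Local Notation Md := (Q * (P * dual P))%type.
Local Notation J := (principal_ideal ('X : {poly R})).
Local Notation mx := (@mxs _ Q P k iQ pQ l iP pP).
Local Notation rho := (psub (0 : {poly R})).

Lemma modelE : model G Z (idem_mx iQ pQ) (idem_mx iP pP) h = S.
Proof. by rewrite smap_model eE pE. Qed.

Lemma rho_ideal a : a \in J -> rho a = 0.
Proof. by move=> /asboolP[c ->]; rewrite rmorphM /= psubX mulr0. Qed.

Lemma mul_ideal c : c * 'X \in J.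
Proof. by apply/asboolP; exists c. Qed.

Let axS : space_axioms S := smap_axioms polyC axS0.

Lemma mxM (s t : lin_aut Md) : mx (s * t)%g = mx t *m mx s.
Proof. exact: mxsM. Qed.

Lemma mxV (s : lin_aut Md) : mx s *m mx (s^-1)%g = 1%:M.
Proof. exact: mxsV. Qed.

Lemma EO_EOm_poly (s : lin_aut Md) : EO q P s -> EOm S (mx s).
Proof. by move=> /(EO_EOm hq ipQ ipP GE G_sym GZ eG h2); rewrite modelE. Qed.

Lemma EOm_EO_poly g : EOm S g -> exists2 s : lin_aut Md, mx s = g & EO q P s.
Proof. by rewrite -modelE; apply: EOm_EO. Qed.

(** Both conditions define a normal subgroup, and a transformation with alpha in
(X) satisfies them. *)
Lemma EO_rel_EOm (s : lin_aut Md) : EO_rel q P J s ->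
  EOm S (mx s) /\ map_mx rho (mx s) = 1%:M.
Proof.
pose K (s : lin_aut Md) := EOm S (mx s) /\ map_mx rho (mx s) = 1%:M.
have K1 : K 1%g by split; rewrite /= mxs1 ?map_mx1 //; apply: gen1.
have KM x y : K x -> K y -> K (x * y)%g.
  move=> [E1 R1] [E2 R2]; split; rewrite mxM; first exact: gen_mul.
  by rewrite map_mxM R1 R2 mulmx1.
have KV x : K x -> K (x^-1)%g.
  move=> [E1 R1]; split; first exact: (EOm_inverse axS E1 (mxV x)).
  by have := congr1 (map_mx rho) (mxV x); rewrite map_mxM R1 mul1mx map_mx1.
apply: (sub_gen (K := K)) => // _ [g [t [Eg Et ->]]].
have [E1 R1] : K t.
  apply: (sub_gen K1 KM KV _ Et) => u [[alpha Ja Hu]|[beta Jb Hu]]; split.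
  - by apply: EO_EOm_poly; apply: gen_incl; left; exists alpha.
  - exact: (E_reduce iP pP ipQ GE G_sym GZ eG rho_ideal Ja Hu).
  - by apply: EO_EOm_poly; apply: gen_incl; right; exists beta.
  - exact: (Estar_reduce iP pP ipQ GE G_sym GZ eG rho_ideal Jb Hu).
have Eg' := EO_EOm_poly Eg; have EV := EOm_inverse axS Eg' (mxV g).
rewrite /K conjgE invgK !mxM; split.
  by do ?apply: gen_mul.
by rewrite !map_mxM R1 mulmx1 -map_mxM (mulmx1C (mxV g)) map_mx1.
Qed.

(** A transvection with vector X z is E_alpha for an alpha with values in (X). *)
Lemma EOrelgen_EO_rel g : gen (EOrelgen S0) g ->
  exists2 s : lin_aut Md, mx s = g & EO_rel q P J s.
Proof.
have relG := gen_is_subgroup.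
elim=> [|g1 g2 [a [a' [x [z [Ea aa' lx Qz ->]]]]] _ [s sE Es]].
  by exists 1%g; [apply: mxs1|apply: (sg1 (relG _ _))].
suff [t tE Et] : exists2 t : lin_aut Md, mx t = a' *m eich S x ('X *: z) *m a &
    EO_rel q P J t.
  by exists (s * t)%g; [rewrite mxM tE sE|apply: (sgM (relG _ _))].
have [b bE Eb] := EOm_EO_poly Ea.
suff [t tE Et] : exists2 t : lin_aut Md, mx t = eich S x ('X *: z) & EO_ideal q P J t.
  exists (t ^ b^-1)%g; last by apply: gen_incl; exists b, t.
  rewrite conjgE invgK !mxM tE bE; congr (_ *m _ *m _).
  by apply: inv_uniq aa'; rewrite -bE mxV.
rewrite -modelE in lx Qz *.
have Jc (M : lmodType {poly R}) (y : M) (w t : Q) :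
    ideal_mul J (- polar q w ('X *: t) *: y).
  exists 1%N, (fun=> - polar q w t * 'X), (fun=> y); split=> [i|]; first exact: mul_ideal.
  by rewrite big_ord1 polarZ // mulNr mulrC.
have XQ : 'X *: z = iM iQ iP pP ('X *: (pM pQ iP pP z).1, (0, 0)).
  rewrite {1}(inQ_iM ipQ ipP G_sym GZ eG h2 Qz).
  rewrite -[LHS](linearZ_LR (iM iQ iP pP : {linear Md -> _})).
  by congr (iM _ _ _ (_, (_, _))); rewrite scaler0.
rewrite XQ; case: lx => lx.
  rewrite (inP_iM ipQ ipP G_sym GZ eG h2 lx).
  have [t tE [alpha aE Ht]] := eich_E hq ipQ ipP GE G_sym GZ eG h2 ('X *: (pM pQ iP pP z).1) (pM pQ iP pP x).2.1.
  exists t => //; apply: gen_incl; left; exists alpha => // w.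
  by rewrite aE; apply: Jc.
rewrite (inD_iM ipQ ipP G_sym GZ eG h2 lx).
have [t tE [alpha aE Ht]] := eich_Estar hq ipQ ipP GE G_sym GZ eG h2 ('X *: (pM pQ iP pP z).1) (pM pQ iP pP x).2.2.
exists t => //; apply: gen_incl; right; exists alpha => // w.
by rewrite aE; apply: Jc.
Qed.

Lemma EOm_EO_rel (s : lin_aut Md) : EOm S (mx s) -> map_mx rho (mx s) = 1%:M -> EO_rel q P J s.
Proof.
move=> Es Rs; have := EO_rel_split axS0 Es (h := 1%:M).
rewrite Rs !mulmx1 => /(_ erefl) /EOrelgen_EO_rel[t tE Et].
by rewrite -(mxs_inj ipQ ipP tE).
Qed.

Local Notation SO := (special_orthogonal_rel J (qperp q (hyperbolic P))).

(** A matrix that is 1 at X = 0 is 1 + X W, which gives s x - x in X M. *)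
Lemma SO_mx (s : lin_aut Md) : SO s <->
  [/\ isom S (mx s), \det (mx s) = 1 & map_mx rho (mx s) = 1%:M].
Proof.
have isoE := isom_mxs ipQ ipP GE G_sym GZ eG h2 s; rewrite modelE in isoE.
split=> [[[/isoE Is Js] ds]|[/isoE Os ds Rs]].
  by split=> //; [rewrite -det_mxs|apply: (ideal_reduce iQ pQ iP pP rho_ideal)].
split; last by rewrite (det_mxs ipQ ipP).
split=> // x; have [W WE] := mx_poly_split (mx s); rewrite Rs in WE.
have iE : iM iQ iP pP (s x - x) = 'X *: (iM iQ iP pP x *m W).
  rewrite [LHS](linearB (iM iQ iP pP : {linear Md -> _})) /= -(iM_mxs ipQ ipP) WE.
  by rewrite mulmxDr mulmx1 addrK scalemxAr.
have sE : s x - x = 'X *: pM pQ iP pP (iM iQ iP pP x *m W).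
  by rewrite -[LHS](iMK ipQ ipP) iE (linearZ_LR (pM pQ iP pP : {linear _ -> Md})).
exists 1%N, (fun=> 'X), (fun=> pM pQ iP pP (iM iQ iP pP x *m W)).
split; first by move=> _; rewrite -[X in X \in _]mul1r mul_ideal.
by rewrite big_ord1.
Qed.

Lemma SO_subgroup : is_subgroup SO.
Proof.
apply: subgroupI.
- by apply/SO_mx; rewrite mxs1 det1 map_mx1; split=> //; apply: isom1.
- move=> s t /SO_mx[Is ds Rs] /SO_mx[It dt Rt]; apply/SO_mx; rewrite mxM.
  by split; [apply: isomM|rewrite det_mulmx ds dt mulr1|rewrite map_mxM Rs Rt mulmx1].
move=> s /SO_mx[Is ds Rs]; have sV := mxV s; apply/SO_mx; split.
- exact: (isom_inv axS Is sV).
- by have := congr1 determinant sV; rewrite det_mulmx ds mul1r det1.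
by have := congr1 (map_mx rho) sV; rewrite map_mxM Rs mul1mx map_mx1.
Qed.

Lemma EO_rel_normal : normal_in (EO_rel q P J) SO.
Proof.
split; [exact: SO_subgroup|exact: gen_is_subgroup| |].
  move=> s /EO_rel_EOm[Es Rs]; apply/SO_mx; split=> //; first exact: EOm_isom.
  exact: (EOm_det axS).
move=> s t /SO_mx[Is ds Rs] /EO_rel_EOm[Et Rt]; have sV := mxV s.
have Is' := isom_inv axS Is sV; have Vs := mulmx1C sV.
apply: EOm_EO_rel; rewrite conjgE !mxM; last by rewrite !map_mxM Rt mulmx1 -map_mxM sV map_mx1.
exact: (EO_normal axS0 frames Is' Vs Et).
Qed.

Definition locally_elementary : set (lin_aut Md) :=
  [set s | SO s /\ loc_EO S0 polyC (mx s)].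

Lemma mx_commg (s t : lin_aut Md) :
  mx [~ s, t]%g = mx t *m mx s *m mx (t^-1)%g *m mx (s^-1)%g.
Proof. by rewrite commgEl conjgE !mxM. Qed.

Lemma locally_elementary_subgroup : is_subgroup locally_elementary.
Proof.
have SG := SO_subgroup; apply: subgroupI.
- by split; [apply: (sg1 SG)|move=> I hI phi; rewrite mxs1 map_mx1; apply: gen1].
- move=> s t [Os Ls] [Ot Lt]; split; first exact: (sgM SG).
  by move=> I hI phi; rewrite mxM map_mxM; apply: gen_mul; [apply: Lt|apply: Ls].
move=> s [Os Ls]; split; first exact: (sgV SG).
move=> I hI phi; apply: (EOm_inverse (smap_axioms phi axS) (Ls I hI)).
by rewrite -map_mxM mxV map_mx1.
Qed.

Lemma SO_commg s t : SO s -> SO t -> locally_elementary [~ s, t]%g.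
Proof.
have SG := SO_subgroup => Os Ot.
have Os' := sgV SG Os; have Ot' := sgV SG Ot; split.
  by rewrite commgEl conjgE; do !apply: (sgM SG).
rewrite mx_commg.
have [/= Is' ds' _] := (SO_mx _).1 Os'; have [/= It' dt' _] := (SO_mx _).1 Ot'.
exact: (loc_EO_commutator axS0 frames It' Is' (mulmx1C (mxV t)) (mulmx1C (mxV s)) dt' ds').
Qed.

Lemma locally_elementary_commg s t : SO s -> locally_elementary t ->
  EO_rel q P J [~ s, t]%g.
Proof.
have SG := SO_subgroup => Os Kt; have [Ot Lt] := Kt.
have [Ot' Lt'] := sgV locally_elementary_subgroup Kt.
have Os' := sgV SG Os.
have [/= Is' ds' Rs'] := (SO_mx _).1 Os'; have [/= It' dt' Rt'] := (SO_mx _).1 Ot'.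
have [_ _ Rs] := (SO_mx _).1 Os; have [_ _ Rt] := (SO_mx _).1 Ot.
apply: EOm_EO_rel; rewrite mx_commg; last by rewrite !map_mxM Rs Rt Rs' Rt' !mulmx1.
exact: (commutator_EO axS0 frames It' Is' (mulmx1C (mxV t)) (mulmx1C (mxV s)) Lt' Rs').
Qed.

Lemma SO_quotient_nilpotent : nilpotent_of_class_le (quotient_group EO_rel_normal) 2.
Proof.
apply: (quotient_nilpotent2 _ locally_elementary_subgroup).
- by move=> s [].
- exact: SO_commg.
- exact: locally_elementary_commg.
Qed.

End PolynomialGroups.

(** * Gram matrices and the conclusion *)

Section GramMatrix.
Variables (R : comNzRingType) (Q : lmodType R) (q : Q -> R).
Hypothesis hq : is_quadratic_form q.
Variables (k : nat) (i : {linear Q -> 'rV[R]_k}) (p : {linear 'rV[R]_k -> Q}).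
Hypothesis ip : cancel i p.

Definition gram_mx : 'M[R]_k :=
  \matrix_(a, b) polar q (p (delta_mx 0 a)) (p (delta_mx 0 b)).

Lemma polar_sumr x n (c : 'I_n -> R) (y : 'I_n -> Q) :
  polar q x (\sum_b c b *: y b) = \sum_b c b * polar q x (y b).
Proof.
elim/big_rec2: _ => [|b s t _ <-]; first exact: polar0.
by rewrite polarD // polarZ.
Qed.

Lemma mul_gram_mx v w : (v *m gram_mx *m w^T) 0 0 = polar q (p v) (p w).
Proof.
rewrite [in RHS](row_sum_delta w) linear_sum.
under [in RHS]eq_bigr do rewrite linearZ.
rewrite polar_sumr mxE; apply: eq_bigr => b _.
rewrite [w^T _ _]mxE mulrC; congr (_ * _).
rewrite polarC [in RHS](row_sum_delta v) linear_sum.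
under [in RHS]eq_bigr do rewrite linearZ.
rewrite polar_sumr mxE; apply: eq_bigr => a _.
by rewrite polarC mxE.
Qed.

Lemma polar_gram_mx x y : polar q x y = (i x *m gram_mx *m (i y)^T) 0 0.
Proof. by rewrite mul_gram_mx !ip. Qed.

Lemma gram_mx_sym : gram_mx^T = gram_mx.
Proof. by apply/matrixP => a b; rewrite !mxE polarC. Qed.

Lemma mx_form_ext m n (X Y : 'M[R]_(m, n)) :
  (forall (v : 'rV_m) (w : 'rV_n), (v *m X *m w^T) 0 0 = (v *m Y *m w^T) 0 0) -> X = Y.
Proof.
move=> XY; apply/matrixP => a b.
have := XY (delta_mx 0 a) (delta_mx 0 b).
by rewrite trmx_delta -!rowE -!colE !mxE.
Qed.

Lemma idem_gram_mx : idem_mx i p *m gram_mx = gram_mx.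
Proof.
by apply: mx_form_ext => v w; rewrite mulmxA mul_idem_mx !mul_gram_mx ip.
Qed.

(** The rows of Z are the vectors of Q that represent the coordinate forms. *)
Lemma cogram_mx : Defs.nondegenerate q -> exists Z, gram_mx *m Z = idem_mx i p.
Proof.
move=> nd.
have lin j : scalar (fun w => i w 0 j) by move=> a x y; rewrite linearP !mxE.
have /choice[z Hz] : forall j : 'I_k, exists z, forall w, polar q z w = i w 0 j.
  by move=> j; have [z [Hz _]] := nd (mk_dual (lin j)); exists z.
exists (\matrix_j i (z j))^T; apply: mx_ext => v; rewrite mulmxA mul_idem_mx.
apply/rowP => j; rewrite -[RHS]Hz polarC -{1}(ip (z j)) -mul_gram_mx mxE.
by rewrite [RHS]mxE; apply: eq_bigr => b _; rewrite !mxE.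
Qed.

Section Extend.
Variables (B : comNzRingType) (phi : {rmorphism R -> B}).
Local Notation ext := (extension phi Q).
Local Notation qe := (@qext _ _ phi _ q).

(** Both sides are the same double sum over representatives of x and y. *)
Lemma polar_qext (x y : ext) :
  polar qe x y = (ext_coord i x *m map_mx phi gram_mx *m (ext_coord i y)^T) 0 0.
Proof.
elim/quotW: x => s; elim/quotW: y => t.
rewrite /polar -ext_pi_cat !(qextE phi hq) qseq_cat !ext_coordE.
have -> : qseq phi q s + qseq phi q t + Defs.bseq phi q s t - qseq phi q s - qseq phi q t = Defs.bseq phi q s t.
  ring.
rewrite /seq_coord 2!mulmx_suml summxE; apply: eq_bigr => u _.
have -> : (\sum_(v <- t) v.1 *: map_mx phi (i v.2))^T =
    \sum_(v <- t) v.1 *: map_mx phi (i v.2)^T.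
  rewrite raddf_sum; apply: eq_bigr => v _.
  by apply/matrixP => a b; rewrite !mxE.
rewrite mulmx_sumr summxE; apply: eq_bigr => v _.
rewrite -!scalemxAl -scalemxAr -!map_mxM [RHS]mxE [X in _ = _ * X]mxE.
rewrite [X in _ = _ * (_ * X)]mxE -polar_gram_mx.
ring.
Qed.

Lemma qext_quadratic : is_quadratic_form qe.
Proof.
split=> [r|y a x z|x a y z].
- elim/quotW=> s; rewrite -[r *: _]/(ext_scale _ _) ext_scaleE !(qextE phi hq).
  elim: s => [|u s IH] /=; first by rewrite mulr0.
  rewrite IH big_map !mulrDr; congr (_ + _ + _); first by ring.
  by rewrite mulr_sumr; apply: eq_bigr => v _ /=; ring.
- by rewrite !polar_qext linearP !mulmxDl -!scalemxAl !mxE.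
- by rewrite !polar_qext linearP /= linearP /= mulmxDr -scalemxAr !mxE.
Qed.

End Extend.
End GramMatrix.

Section Frames.
Variables (R : comNzRingType) (Q P : lmodType R) (n m : nat).
Hypotheses (Q_rank : has_rank Q n) (n_ge1 : (1 <= n)%N).
Hypotheses (P_rank : has_rank P m) (m_ge2 : (2 <= m)%N).
Variables (k : nat) (iQ : {linear Q -> 'rV[R]_k}) (pQ : {linear 'rV[R]_k -> Q}).
Variables (l : nat) (iP : {linear P -> 'rV[R]_l}) (pP : {linear 'rV[R]_l -> P}).
Hypotheses (ipQ : cancel iQ pQ) (ipP : cancel iP pP).
Local Notation e := (idem_mx iQ pQ).
Local Notation p := (idem_mx iP pP).
Variables (G Z : 'M[R]_k) (h : R).
Hypotheses (G_sym : G^T = G) (GZ : G *m Z = e) (eG : e *m G = G).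
Hypothesis h2 : 2%:R * h = 1.

(** Over a local R-algebra the ranks n and m give bases of Q and P. *)
Lemma model_frames (L : comNzRingType) (chi : {rmorphism R -> L}) : is_local L ->
  exists m (fr : 'I_m * bool -> 'rV_(k + (l + l))) u c,
    frame (smap chi (model G Z e p h)) fr u c.
Proof.
move=> locL.
have [UQ [VQ [UVQ VUQ]]] := rank_mx Q_rank ipQ chi locL.
have [U [V [UV VU]]] := rank_mx P_rank ipP chi locL.
have [u [c Hf]] : exists u c, frame (smap chi (model G Z e p h)) (model_frame k U V) u c.
  rewrite smap_model; apply: (frame_model _ _ _ _ _ _ locL n_ge1 m_ge2 UVQ VUQ UV VU).
  - by rewrite map_trmx G_sym.
  - by rewrite -map_mxM (ee ipQ).
  - by rewrite -map_mxM (ee ipP).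
  - by rewrite -map_mxM GZ.
  - by rewrite -map_mxM eG.
  - by rewrite -(rmorph_nat chi) -rmorphM h2 rmorph1.
by exists m, (model_frame k U V), u, c.
Qed.
End Frames.

Theorem theorem1p4 (R : comNzRingType)
    (two_invertible : exists u : R, 2%:R * u = 1)
    (R_noetherian : noetherian R)
    (Q : lmodType R) (q : Q -> R) (n : nat)
    (Q_space : is_quadratic_space q) (Q_rank : has_rank Q n) (n_ge1 : (1 <= n)%N)
    (P : lmodType R) (m : nat)
    (P_fg : finitely_generated P) (P_proj : projective P)
    (P_rank : has_rank P m) (m_ge2 : (2 <= m)%N)
    (local_phi : forall (I : idealr R) (I_max : maximal_ideal I),
       is_locally_phi_tilde P q (n + 2 * m) (prime_of_maximal I_max)) :
  exists EO_normal :
    normal_in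
      (EO_rel (poly_form q) (poly_module P) (principal_ideal 'X))
      (special_orthogonal_rel (principal_ideal 'X)
         (qperp (poly_form q) (hyperbolic (poly_module P)))),
    nilpotent_of_class_le (quotient_group EO_normal) 2.
Proof.
have [h h2] := two_invertible; have hq := quad_form Q_space.
have [k [iQ [pQ ipQ]]] := fg_projective_retract (quad_fg Q_space) (quad_proj Q_space).
have [l [iP [pP ipP]]] := fg_projective_retract P_fg P_proj.
have G_sym := gram_mx_sym q pQ; have eG := idem_gram_mx hq ipQ.
have [Z GZ] := cogram_mx hq ipQ (quad_nondeg Q_space).
have axS0 : space_axioms (model (gram_mx q pQ) Z (idem_mx iQ pQ) (idem_mx iP pP) h).
  exact: axS.
have frames := model_frames Q_rank n_ge1 P_rank m_ge2 ipQ ipP G_sym GZ eG h2.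
have eE := ext_idem_mx polyC iQ pQ; have pE := ext_idem_mx polyC iP pP.
pose iQ' : {linear poly_module Q -> 'rV_k} := ext_coord iQ.
pose pQ' : {linear 'rV_k -> poly_module Q} := ext_proj polyC pQ.
pose iP' : {linear poly_module P -> 'rV_l} := ext_coord iP.
pose pP' : {linear 'rV_l -> poly_module P} := ext_proj polyC pP.
have ipQ' : cancel iQ' pQ' by apply: ext_coordK.
have ipP' : cancel iP' pP' by apply: ext_coordK.
have G_sym' : (map_mx polyC (gram_mx q pQ))^T = map_mx polyC (gram_mx q pQ).
  by rewrite map_trmx G_sym.
have GZ' : map_mx polyC (gram_mx q pQ) *m map_mx polyC Z = idem_mx iQ' pQ'.
  by rewrite -map_mxM GZ eE.
have eG' : idem_mx iQ' pQ' *m map_mx polyC (gram_mx q pQ) = map_mx polyC (gram_mx q pQ).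
  by rewrite eE -map_mxM eG.
have h2' : 2%:R * h%:P = 1 :> {poly R} by rewrite -polyC_natr -polyCM h2.
have GE' := polar_qext hq ipQ (phi := polyC).
have hq' := qext_quadratic hq ipQ polyC.
exists (EO_rel_normal hq' ipQ' ipP' eE pE GE' axS0 frames G_sym' GZ' eG' h2').
exact: SO_quotient_nilpotent.
Qed.
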